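(* Let $D$ be a connected locally-finite triangle-free digraph with more than one end. If $D$ is connected-homogeneous then: (i) $D$ is highly arc-transitive; (ii) the reachability relation $\mathcal{A}$ on $ED$ is not universal, and hence $\Delta(D)$ is bipartite; (iii) in particular $\Delta(D)$ (viewed as an undirected bipartite graph) is isomorphic to one of: a cycle $C_m$ with $m$ even, a complete bipartite graph $K_{m,n}$ ($m,n\in\mathbb{N}$), the complement of a perfect matching $CP_n$ ($n\in\mathbb{N}$), or an infinite semiregular tree $T_{a,b}$ ($a,b\in\mathbb{N}$); (iv) conversely, for every bipartite graph $B$ listed in (iii), the digraph $DL(B)$ is a connected triangle-free locally-finite connected-homogeneous digraph with $\Delta(DL(B))$ isomorphic to $B$. In addition, if $D$ has more than two ends then (v) for every vertex $u\in VD$ the subdigraphs induced by $\mathrm{desc}(u)$ and by $\mathrm{anc}(u)$ are trees.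
   Context: A digraph is a set $VD$ with an irreflexive antisymmetric binary relation $ED$ (arcs); write $x\to y$ for $(x,y)\in ED$. $D^+(v)=\{w:v\to w\}$, $D^-(v)=\{w:w\to v\}$; $D$ is locally-finite if all these are finite. Connectivity, ends, ''triangle-free'' (no three mutually adjacent vertices) and ''tree'' refer to the underlying undirected graph. The ends of a connected locally-finite graph are equivalence classes of rays (one-way infinite paths), two rays being equivalent if some third ray meets each of them infinitely often. A digraph is connected-homogeneous if every isomorphism between finite connected induced subdigraphs extends to an automorphism. A $k$-arc is a sequence $(x_0,\dots,x_k)$ with $x_i\to x_{i+1}$; $D$ is highly arc-transitive if for every $k$ its automorphism group is transitive on $k$-arcs. An alternating walk is a sequence $(x_1,\dots,x_n)$ whose consecutive arcs alternate in direction; arcs $e,e'$ are related by $\mathcal{A}$ if some alternating walk has first arc $e$ and last arc $e'$; $\mathcal{A}$ is an equivalence relation on $ED$. For arc-transitive $D$, $\Delta(D)$ denotes the (common up to isomorphism) subdigraph induced by an $\mathcal{A}$-class; it is called bipartite if its vertex set splits into $X\cup Y$ with all arcs from $X$ to $Y$. $CP_n$ is the bipartite graph with parts $X,Y$ of size $n$, a bijection $\eta:X\to Y$, and $x\sim y$ iff $y\ne\eta(x)$. $T_{a,b}$ is the infinite tree in which vertices of one part of the bipartition have degree $a$ and those of the other have degree $b$. $\mathrm{desc}(u)$ is the set of vertices reachable from $u$ by a directed path; $\mathrm{anc}(u)$ the set of vertices from which $u$ is reachable by a directed path. Construction $DL(\Delta)$: for an edge-transitive connected bipartite graph $\Delta$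 with bipartition $X\cup Y$, let $T$ be a directed tree with every in-degree $|X|$ and every out-degree $|Y|$; for each $t\in VT$ fix bijections $\varphi_t:T^-(t)\to X$, $\psi_t:T^+(t)\to Y$; $DL(\Delta)$ has vertex set $ET$ and an arc $(a,b)\to(c,d)$ iff $b=c$ and $\{\psi_b(a),\varphi_b(d)\}$ is an edge of $\Delta$ (up to isomorphism independent of choices). Here the bipartition of $B$ in (iv) is the natural one.
   Formalization: In (iv) CP_n is taken with n ≥ 3 (CP_1, CP_2 are disconnected, so DL is not defined or not connected), K_{m,n} with m,n ≥ 1, T_{a,b} with a,b ≥ 2; in DL(Δ) the edge condition is read as {φ_b(a), ψ_b(d)}, since ψ_b(a) and φ_b(d) are undefined. *)

(* Defs.v *)
From Stdlib Require Import List Arith PeanoNat Relations.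
Import ListNotations.

Section DigraphDefs.
Context {V : Type} (E : V -> V -> Prop).

Definition is_digraph : Prop :=
  (forall x, ~ E x x) /\ (forall x y, E x y -> ~ E y x).

Definition adjU (x y : V) : Prop := E x y \/ E y x.

Definition induced_connected (P : V -> Prop) : Prop :=
  forall x y, P x -> P y ->
    clos_refl_trans V (fun a b => P a /\ P b /\ adjU a b) x y.

Definition connected : Prop := induced_connected (fun _ => True).

Definition finite_set (P : V -> Prop) : Prop :=
  exists l : list V, forall w, P w -> In w l.

Definition locally_finite : Prop :=
  forall v, finite_set (fun w => E v w) /\ finite_set (fun w => E w v).

Definition triangle_free : Prop :=
  forall x y z, adjU x y -> adjU y z -> adjU x z -> False.

Fixpoint adj_chain (x : V) (l : list V) : Prop :=
  match l with
  | [] => True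
  | y :: l' => adjU x y /\ adj_chain y l'
  end.

Definition induced_acyclic (P : V -> Prop) : Prop :=
  forall (x : V) (l : list V), NoDup (x :: l) -> 2 <= length l ->
    (forall v, In v (x :: l) -> P v) -> adj_chain x l -> adjU (last l x) x -> False.

Definition induced_tree (P : V -> Prop) : Prop :=
  induced_connected P /\ induced_acyclic P.

Definition ray (r : nat -> V) : Prop :=
  (forall n m, r n = r m -> n = m) /\ (forall n, adjU (r n) (r (S n))).

Definition meets_inf (r s : nat -> V) : Prop :=
  forall N, exists n m, N <= n /\ r n = s m.

Definition equiv_rays (r1 r2 : nat -> V) : Prop :=
  exists r3, ray r3 /\ meets_inf r3 r1 /\ meets_inf r3 r2.

Definition more_than_one_end : Prop :=
  exists r1 r2, ray r1 /\ ray r2 /\ ~ equiv_rays r1 r2.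

Definition more_than_two_ends : Prop :=
  exists r1 r2 r3, ray r1 /\ ray r2 /\ ray r3 /\
    ~ equiv_rays r1 r2 /\ ~ equiv_rays r1 r3 /\ ~ equiv_rays r2 r3.

Definition is_aut (g : V -> V) : Prop :=
  (exists h, (forall x, h (g x) = x) /\ (forall y, g (h y) = y)) /\
  (forall x y, E x y <-> E (g x) (g y)).

(* every isomorphism between finite connected induced subdigraphs
   (domain the finite set S, given by f restricted to S) extends to an
   automorphism *)
Definition conn_hom : Prop :=
  forall (S : list V) (f : V -> V),
    induced_connected (fun x => In x S) ->
    (forall x y, In x S -> In y S -> f x = f y -> x = y) ->
    (forall x y, In x S -> In y S -> (E x y <-> E (f x) (f y))) ->
    exists g, is_aut g /\ forall x, In x S -> g x = f x.

Fixpoint dpath (x : V) (l : list V) : Prop :=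
  match l with
  | [] => True
  | y :: l' => E x y /\ dpath y l'
  end.

Definition highly_arc_transitive : Prop :=
  forall (k : nat) (x : V) (l : list V) (x' : V) (l' : list V),
    length l = k -> length l' = k -> dpath x l -> dpath x' l' ->
    exists g, is_aut g /\ g x = x' /\ map g l = l'.

Definition is_arc (e : V * V) : Prop := E (fst e) (snd e).

Definition step_arc (b : bool) (x y : V) : V * V := if b then (x, y) else (y, x).

Fixpoint alt_walk (b : bool) (x : V) (l : list V) : Prop :=
  match l with
  | [] => True
  | y :: l' => (if b then E x y else E y x) /\ alt_walk (negb b) y l'
  end.

Fixpoint last_arc (b : bool) (x : V) (l : list V) : option (V * V) :=
  match l with
  | [] => None
  | y :: l' =>
      match l' with
      | [] => Some (step_arc b x y)
      | _ :: _ => last_arc (negb b) y l'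
      end
  end.

Definition Arel (e e' : V * V) : Prop :=
  exists (b : bool) (x y : V) (l : list V),
    alt_walk b x (y :: l) /\ step_arc b x y = e /\ last_arc b x (y :: l) = Some e'.

Definition A_universal : Prop :=
  forall e e', is_arc e -> is_arc e' -> Arel e e'.

Definition Delta_vertex (e0 : V * V) (v : V) : Prop :=
  exists w, Arel e0 (v, w) \/ Arel e0 (w, v).

Definition DeltaV (e0 : V * V) : Type := {v : V | Delta_vertex e0 v}.

Definition Delta_arc (e0 : V * V) (v w : DeltaV e0) : Prop :=
  Arel e0 (proj1_sig v, proj1_sig w).

Definition Delta_und (e0 : V * V) (v w : DeltaV e0) : Prop :=
  Delta_arc e0 v w \/ Delta_arc e0 w v.

Definition Delta_bipartite (e0 : V * V) : Prop :=
  exists P : V -> Prop, forall v w, Arel e0 (v, w) -> P v /\ ~ P w.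

(* desc(u), anc(u) (a vertex reaches itself by the trivial path) *)
Definition desc (u v : V) : Prop := exists l, dpath u l /\ last l u = v.
Definition anc (u v : V) : Prop := exists l, dpath v l /\ last l v = u.

End DigraphDefs.

Definition rel_iso {A B : Type} (RA : A -> A -> Prop) (RB : B -> B -> Prop) : Prop :=
  exists (f : A -> B) (g : B -> A),
    (forall a, g (f a) = a) /\ (forall b, f (g b) = b) /\
    (forall a a', RA a a' <-> RB (f a) (f a')).

Record bigraph := { BX : Type; BY : Type; badj : BX -> BY -> Prop }.

Definition bor (B : bigraph) (u v : BX B + BY B) : Prop :=
  match u, v with
  | inl x, inr y => badj B x y
  | _, _ => False
  end.

Definition bund (B : bigraph) (u v : BX B + BY B) : Prop := bor B u v \/ bor B v u.

Definition fin (k : nat) : Type := {i : nat | i < k}.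

(* the cycle C_{2k}: x_i ~ y_i, x_i ~ y_{i+1 mod k} *)
Definition cycle_bg (k : nat) : bigraph :=
  {| BX := fin k; BY := fin k;
     badj := fun x y => proj1_sig y = proj1_sig x \/ proj1_sig y = (proj1_sig x + 1) mod k |}.

Definition complete_bg (m n : nat) : bigraph :=
  {| BX := fin m; BY := fin n; badj := fun _ _ => True |}.

Definition CP_bg (n : nat) : bigraph :=
  {| BX := fin n; BY := fin n; badj := fun x y => proj1_sig x <> proj1_sig y |}.

Definition is_Tab (B : bigraph) (a b : nat) : Prop :=
  induced_tree (bund B) (fun _ => True) /\ inhabited (BX B + BY B) /\
  (forall x : BX B, exists l : list (BY B),
      length l = a /\ NoDup l /\ forall y, In y l <-> badj B x y) /\
  (forall y : BY B, exists l : list (BX B),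
      length l = b /\ NoDup l /\ forall x, In x l <-> badj B x y).

Definition listed (B : bigraph) : Prop :=
  (exists k, 2 <= k /\ rel_iso (bor B) (bor (cycle_bg k))) \/
  (exists m n, 1 <= m /\ 1 <= n /\ rel_iso (bor B) (bor (complete_bg m n))) \/
  (exists n, 3 <= n /\ rel_iso (bor B) (bor (CP_bg n))) \/
  (exists a b, 2 <= a /\ 2 <= b /\ is_Tab B a b).

(* Construction DL(B): T = (VT, ET) a directed tree, phi t : T^-(t) -> X and
   psi t : T^+(t) -> Y bijections (given as total functions whose restriction
   to the in-/out-neighbourhood of t is a bijection). *)
Definition DL_data (B : bigraph) {VT : Type} (ET : VT -> VT -> Prop)
  (phi : VT -> VT -> BX B) (psi : VT -> VT -> BY B) : Prop :=
  is_digraph ET /\ induced_tree ET (fun _ => True) /\ inhabited VT /\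
  (forall t,
     (forall s s', ET s t -> ET s' t -> phi t s = phi t s' -> s = s') /\
     (forall x, exists s, ET s t /\ phi t s = x)) /\
  (forall t,
     (forall s s', ET t s -> ET t s' -> psi t s = psi t s' -> s = s') /\
     (forall y, exists s, ET t s /\ psi t s = y)).

Definition DLV {VT : Type} (ET : VT -> VT -> Prop) : Type :=
  {p : VT * VT | ET (fst p) (snd p)}.

Definition DL_arc (B : bigraph) {VT : Type} (ET : VT -> VT -> Prop)
  (phi : VT -> VT -> BX B) (psi : VT -> VT -> BY B) (p q : DLV ET) : Prop :=
  snd (proj1_sig p) = fst (proj1_sig q) /\
  badj B (phi (snd (proj1_sig p)) (fst (proj1_sig p)))
         (psi (snd (proj1_sig p)) (snd (proj1_sig q))).

(* Main.v *)
(** A ray pair that is not equivalent is separated by a finite edge cut.  Among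
    the cuts of minimal size with both sides infinite, those crossing the fewest
    others are pairwise nested (Krön), so the number of them separating two
    vertices is an automorphism-invariant metric [d] satisfying the four-point
    condition of trees.  By homogeneity [d] is constant, equal to [k], on arcs and
    constant on each of the three kinds of two-paths; boundedness of [d] is only
    avoided if it is [k + delta] with [delta > 0] on directed two-paths.  Hence
    directed paths are geodesics of the tree, in particular induced, which is (i);
    the four-point condition also keeps a reachability class from containing two
    consecutive arcs, which is (ii), and from inducing further arcs, so that the
    class is itself a homogeneous bipartite graph.

    For (iii) let [a] be the degree and [c] the number of common neighbours on one
    side.  If [c = a] the graph is complete, if [c = a - 1] it is the complement
    of a perfect matching, and [2 <= c <= a - 2] is impossible.  If [c = 1] a
    shortest cycle is either the whole graph or a hexagon, and the latter leads
    to a projective plane, which is not homogeneous.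

    For (iv) finite partial isomorphisms of DL(B) extend vertex by vertex because
    those of B do and the copies of B are glued along a tree; back-and-forth
    finishes.

    For (v), two distinct directed paths with the same ends force, via [d], all
    directed paths of equal length from a vertex to be parallel; the digraph then
    has finite levels indexed by the integers and at most two ends. *)

Require Import Defs.
From Stdlib Require Import List Arith PeanoNat Relations.
From Stdlib Require Import Lia Bool ZArith.
From Stdlib Require FinFun.
From Stdlib Require Import Classical ClassicalEpsilon FunctionalExtensionality.
Import ListNotations.

(** Triangle-freeness makes every two-path induced, so homogeneity gives [d] one value on each kind.
    Read in the tree, an arc is a segment of length [k]; two arcs with a common tail overlap in
    [k - ap/2], two with a common head in [k - am/2]. If these overlaps fill an arc
    ([ap + am <= 2 * k]), or one kind of sibling is missing, a whole reachability class stays close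
    to its first arc; otherwise every arc contributes progress and a non-backtracking alternating
    walk never returns. Either way the class misses the continuation of its first arc. In (v),
    finitely many arcs can share a piece of the tree, because finitely many optimal cuts separate
    two vertices and each has a finite boundary; this bounds the levels. The contradictions in (iii)
    rest on one device: two vertices of the same colour with equal adjacency to a finite set can be
    exchanged while that set stays fixed, provided everything together is connected. In (iv) each
    vertex of DL(B) is a cut point between the two copies of B that contain it, so an extension
    problem is confined to one copy. *)

Definition holds (P : Prop) : bool :=
  if excluded_middle_informative P then true else false.

Lemma holds_true (P : Prop) : holds P = true <-> P.
Proof. unfold holds. destruct (excluded_middle_informative P); split; intuition congruence. Qed.

Lemma holds_false (P : Prop) : holds P = false <-> ~ P.
Proof. unfold holds. destruct (excluded_middle_informative P); split; intuition congruence. Qed.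

Definition eq_dec_classic {T : Type} (x y : T) : {x = y} + {x <> y} :=
  excluded_middle_informative (x = y).

Lemma choice_fun {A B : Type} (R : A -> B -> Prop) :
  (forall a, exists b, R a b) -> exists f : A -> B, forall a, R a (f a).
Proof.
  intros H.
  exists (fun a => proj1_sig (constructive_indefinite_description _ (H a))).
  intros a. exact (proj2_sig (constructive_indefinite_description _ (H a))).
Qed.

Lemma least_nat (P : nat -> Prop) :
  (exists n, P n) -> exists n, P n /\ forall m, P m -> n <= m.
Proof.
  intros [n Hn]. induction n as [n IH] using lt_wf_ind.
  destruct (classic (exists m, m < n /\ P m)) as [[m [Hm HP]]|H].
  - exact (IH m Hm HP).
  - exists n. split; auto. intros m HP.
    destruct (le_lt_dec n m); auto. exfalso; apply H; eauto.
Qed.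

Lemma last_cons {T : Type} (x y : T) l : last (y :: l) x = last l y.
Proof.
  revert x y. induction l as [|z l IH]; intros x y; auto.
  change (last (z :: l) x = last (z :: l) y). rewrite !IH. auto.
Qed.

Lemma last_app_cons {T : Type} (x a : T) l1 l2 : last (l1 ++ a :: l2) x = last l2 a.
Proof.
  revert x. induction l1 as [|y l1 IH]; intros x; simpl app; rewrite last_cons; auto.
Qed.

Lemma last_in {T : Type} (x : T) l : In (last l x) (x :: l).
Proof.
  revert x. induction l as [|y l IH]; intros x; [left; auto|].
  rewrite last_cons. right. auto.
Qed.

(** * Counting finite sets *)

Section Counting.
Context {T : Type}.
Implicit Types (P Q : T -> Prop) (l : list T).

Definition card_is P (n : nat) : Prop :=
  exists l, NoDup l /\ length l = n /\ forall x, In x l <-> P x.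

(** Total by choice: on an infinite set the value is arbitrary, so the lemmas that compare values
    carry finiteness hypotheses. *)
Definition cardf P : nat := epsilon (inhabits 0) (card_is P).

Lemma finite_enum P :
  finite_set P -> exists l, NoDup l /\ forall x, In x l <-> P x.
Proof.
  intros [l Hl]. exists (nodup eq_dec_classic (filter (fun x => holds (P x)) l)). split.
  - apply NoDup_nodup.
  - intros x. rewrite nodup_In, filter_In, holds_true. intuition.
Qed.

Lemma card_is_fun P n m : card_is P n -> card_is P m -> n = m.
Proof.
  intros [l [H1 [H2 H3]]] [l' [H1' [H2' H3']]]. subst.
  apply Nat.le_antisymm; apply NoDup_incl_length; auto; intros x Hx.
  - apply H3', H3; auto.
  - apply H3, H3'; auto.
Qed.

Lemma card_is_cardf P n : card_is P n -> cardf P = n.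
Proof.
  intros H. apply (card_is_fun P); auto.
  unfold cardf. apply epsilon_spec. eauto.
Qed.

Lemma cardf_card P : finite_set P -> card_is P (cardf P).
Proof.
  intros H. destruct (finite_enum P H) as [l [H1 H2]].
  assert (Hc : card_is P (length l)) by (exists l; auto).
  rewrite (card_is_cardf P _ Hc); auto.
Qed.

Lemma cardf_list l P :
  NoDup l -> (forall x, In x l <-> P x) -> cardf P = length l.
Proof. intros H1 H2. apply card_is_cardf. exists l; auto. Qed.

Lemma cardf_filter l P :
  NoDup l -> (forall x, P x -> In x l) ->
  cardf P = length (filter (fun x => holds (P x)) l).
Proof.
  intros H1 H2. apply cardf_list.
  - apply NoDup_filter; auto.
  - intros x. rewrite filter_In, holds_true. intuition.
Qed.

Lemma finite_sub P Q : (forall x, P x -> Q x) -> finite_set Q -> finite_set P.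
Proof. intros H [l Hl]. exists l. auto. Qed.

Lemma finite_or P Q : finite_set P -> finite_set Q -> finite_set (fun x => P x \/ Q x).
Proof.
  intros [l Hl] [m Hm]. exists (l ++ m). intros w Hw. apply in_or_app.
  destruct Hw; auto.
Qed.

Lemma finite_bigor {I : Type} (li : list I) (F : I -> T -> Prop) :
  (forall i, In i li -> finite_set (F i)) ->
  finite_set (fun x => exists i, In i li /\ F i x).
Proof.
  induction li as [|i li IH]; intros H.
  - exists []. intros w [j [[] _]].
  - apply finite_sub with (fun x => F i x \/ exists j, In j li /\ F j x).
    + intros x [j [[->|Hj] HF]]; eauto.
    + apply finite_or; [apply H; left; auto | apply IH; intros; apply H; right; auto].
Qed.

Lemma cardf_ext P Q : (forall x, P x <-> Q x) -> finite_set P -> cardf P = cardf Q.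
Proof.
  intros H HP. destruct (cardf_card P HP) as [l [H1 [H2 H3]]].
  rewrite <- H2. symmetry. apply cardf_list; auto.
  intros x. rewrite H3, H. reflexivity.
Qed.

(** Compares indicator functions pointwise. Submodularity of cut sizes and of crossing numbers, and
    later the four-point condition, are instances; the second half gets strictness from a point
    counted only on the right. *)
Lemma cardf_sum_le P1 P2 P3 P4 :
  finite_set P3 -> finite_set P4 ->
  (forall x, P1 x -> P3 x \/ P4 x) -> (forall x, P2 x -> P3 x \/ P4 x) ->
  (forall x, P1 x -> P2 x -> P3 x /\ P4 x) ->
  cardf P1 + cardf P2 <= cardf P3 + cardf P4 /\
  ((exists x, (P3 x \/ P4 x) /\ ~ P1 x /\ ~ P2 x) ->
   cardf P1 + cardf P2 < cardf P3 + cardf P4).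
Proof.
  intros F3 F4 H1 H2 H12.
  destruct (finite_enum _ (finite_or _ _ F3 F4)) as [l [Hl Hin]].
  rewrite !(cardf_filter l) by (auto; intros; apply Hin; auto).
  assert (Hx : forall x, In x l ->
    Nat.b2n (holds (P1 x)) + Nat.b2n (holds (P2 x)) <=
    Nat.b2n (holds (P3 x)) + Nat.b2n (holds (P4 x))).
  { intros x Hx. apply Hin in Hx. specialize (H1 x). specialize (H2 x). specialize (H12 x).
    unfold holds. destruct (excluded_middle_informative (P1 x));
    destruct (excluded_middle_informative (P2 x));
    destruct (excluded_middle_informative (P3 x));
    destruct (excluded_middle_informative (P4 x)); simpl; try lia; tauto. }
  assert (Hs : forall x, (P3 x \/ P4 x) /\ ~ P1 x /\ ~ P2 x -> In x l /\
    Nat.b2n (holds (P1 x)) + Nat.b2n (holds (P2 x)) <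
    Nat.b2n (holds (P3 x)) + Nat.b2n (holds (P4 x))).
  { intros x [H3 [H4 H5]]. split; [apply Hin; auto|].
    rewrite (proj2 (holds_false _) H4), (proj2 (holds_false _) H5).
    destruct H3 as [H3|H3]; rewrite (proj2 (holds_true _) H3); simpl; lia. }
  clear - Hx Hs. split.
  - clear Hs. induction l as [|x l IH]; simpl; [lia|].
    pose proof (Hx x (or_introl eq_refl)).
    assert (IH' := IH (fun y Hy => Hx y (or_intror Hy))).
    destruct (holds (P1 x)), (holds (P2 x)), (holds (P3 x)), (holds (P4 x)); simpl in *; lia.
  - intros [x Hx0]. destruct (Hs x Hx0) as [Hxl Hlt]. clear Hs Hx0.
    assert (Hle : forall l, (forall x, In x l ->
      Nat.b2n (holds (P1 x)) + Nat.b2n (holds (P2 x)) <=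
      Nat.b2n (holds (P3 x)) + Nat.b2n (holds (P4 x))) ->
      length (filter (fun x => holds (P1 x)) l) + length (filter (fun x => holds (P2 x)) l) <=
      length (filter (fun x => holds (P3 x)) l) + length (filter (fun x => holds (P4 x)) l)).
    { clear. induction l as [|x l IH]; simpl; intros Hx; [lia|].
      pose proof (Hx x (or_introl eq_refl)).
      assert (IH' := IH (fun y Hy => Hx y (or_intror Hy))).
      destruct (holds (P1 x)), (holds (P2 x)), (holds (P3 x)), (holds (P4 x)); simpl in *; lia. }
    destruct (in_split _ _ Hxl) as [l1 [l2 ->]].
    rewrite !filter_app, !length_app. simpl.
    assert (A1 := Hle l1 (fun y Hy => Hx y (in_or_app _ _ _ (or_introl Hy)))).
    assert (A2 := Hle l2 (fun y Hy => Hx y (in_or_app l1 (x :: l2) y (or_intror (or_intror Hy))))).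
    destruct (holds (P1 x)), (holds (P2 x)), (holds (P3 x)), (holds (P4 x)); simpl in *; lia.
Qed.

Lemma cardf_le P Q : finite_set Q -> (forall x, P x -> Q x) -> cardf P <= cardf Q.
Proof.
  intros F H.
  assert (Fz : finite_set (fun _ : T => False)) by (exists []; auto).
  destruct (cardf_sum_le P (fun _ => False) Q (fun _ => False)) as [A _]; try tauto; auto.
  lia.
Qed.

Lemma cardf_lt P Q x :
  finite_set Q -> (forall x, P x -> Q x) -> Q x -> ~ P x -> cardf P < cardf Q.
Proof.
  intros F H HQ HP.
  assert (Fz : finite_set (fun _ : T => False)) by (exists []; auto).
  destruct (cardf_sum_le P (fun _ => False) Q (fun _ => False)) as [_ A]; try tauto; auto.
  assert (Hs : cardf P + cardf (fun _ : T => False) < cardf Q + cardf (fun _ : T => False)).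
  { apply A. exists x. tauto. }
  lia.
Qed.

Lemma cardf_pos P x : finite_set P -> P x -> 0 < cardf P.
Proof.
  intros F H. apply Nat.le_lt_trans with (cardf (fun _ : T => False)); [lia|].
  apply cardf_lt with x; tauto.
Qed.

End Counting.

Lemma cardf_bij {T U : Type} (P : T -> Prop) (Q : U -> Prop) (f : T -> U) (h : U -> T) :
  finite_set P -> (forall x, h (f x) = x) -> (forall y, f (h y) = y) ->
  (forall x, P x <-> Q (f x)) -> cardf P = cardf Q.
Proof.
  intros F hf fh H. destruct (cardf_card P F) as [l [H1 [H2 H3]]].
  rewrite <- H2, <- (length_map f l). symmetry. apply cardf_list.
  - apply FinFun.Injective_map_NoDup; auto. intros x y E. rewrite <- (hf x), E; auto.
  - intros y. rewrite in_map_iff. split.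
    + intros [x [<- Hx]]. apply H, H3; auto.
    + intros Hy. exists (h y). split; auto. apply H3, H. rewrite fh; auto.
Qed.

(** * Connectivity inside a vertex set *)

Section Connectivity.
Context {V : Type} (E : V -> V -> Prop).
Implicit Types (P Q : V -> Prop) (x y z : V) (l : list V).

Definition conn P : V -> V -> Prop :=
  clos_refl_trans V (fun a b => P a /\ P b /\ adjU E a b).

Lemma adjU_sym x y : adjU E x y -> adjU E y x.
Proof. unfold adjU; tauto. Qed.

Lemma conn_refl P x : conn P x x.
Proof. apply rt_refl. Qed.

Lemma conn_step P x y : P x -> P y -> adjU E x y -> conn P x y.
Proof. intros; apply rt_step; auto. Qed.

Lemma conn_trans P x y z : conn P x y -> conn P y z -> conn P x z.
Proof. apply rt_trans. Qed.

Lemma conn_sym P x y : conn P x y -> conn P y x.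
Proof.
  intros H; induction H as [x y [H1 [H2 H3]]| |x y z _ IH1 _ IH2].
  - apply rt_step. auto using adjU_sym.
  - apply rt_refl.
  - eapply rt_trans; eauto.
Qed.

Lemma conn_mono P Q x y : (forall v, P v -> Q v) -> conn P x y -> conn Q x y.
Proof.
  intros HPQ H; induction H as [x y [H1 [H2 H3]]| |x y z _ IH1 _ IH2].
  - apply rt_step. auto.
  - apply rt_refl.
  - eapply rt_trans; eauto.
Qed.

Lemma conn_invariant P (I : V -> Prop) x y :
  conn P x y -> I x -> (forall a b, P a -> P b -> adjU E a b -> I a -> I b) -> I y.
Proof.
  intros H Hx HI. apply clos_rt_rtn1 in H. induction H as [|y z [H1 [H2 H3]] _ IH]; auto.
  apply (HI y z); auto.
Qed.

Lemma conn_crossing P (I : V -> Prop) x y :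
  conn P x y -> I x -> ~ I y ->
  exists u v, P u /\ P v /\ adjU E u v /\ I u /\ ~ I v.
Proof.
  intros H Hx Hy. apply NNPP. intros N. apply Hy.
  apply (conn_invariant P I x y H Hx). intros a b Ha Hb Hab HI.
  apply NNPP. intros Hn. apply N. exists a, b. auto.
Qed.

Lemma conn_mem P x y : P x -> conn P x y -> P y.
Proof. intros Hx H. apply (conn_invariant P P x y H Hx); auto. Qed.

Lemma adj_chain_app x l1 l2 :
  adj_chain E x (l1 ++ l2) <-> adj_chain E x l1 /\ adj_chain E (last l1 x) l2.
Proof.
  revert x; induction l1 as [|y l1 IH]; intros x.
  - simpl; tauto.
  - rewrite last_cons. simpl app.
    change (adj_chain E x (y :: l1 ++ l2)) with (adjU E x y /\ adj_chain E y (l1 ++ l2)).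
    change (adj_chain E x (y :: l1)) with (adjU E x y /\ adj_chain E y l1).
    rewrite IH. tauto.
Qed.

Lemma conn_simple_path P x y :
  P x -> conn P x y ->
  exists l, NoDup (x :: l) /\ adj_chain E x l /\ last l x = y /\
            (forall v, In v (x :: l) -> P v).
Proof.
  intros Hx H. apply clos_rt_rtn1 in H.
  induction H as [|y z [H1 [H2 H3]] _ [l [N [C [L IP]]]]].
  - exists []. repeat split; auto.
    + constructor; [intros []|constructor].
    + simpl. intros v [<-|[]]; auto.
  - destruct (classic (In z (x :: l))) as [[<-|Hz]|Hz].
    + exists []. repeat split; auto.
      * constructor; [intros []|constructor].
      * simpl. intros v [<-|[]]; auto.
    + destruct (in_split _ _ Hz) as [l1 [l2 ->]].
      replace (l1 ++ z :: l2) with ((l1 ++ [z]) ++ l2) in * by (rewrite <- app_assoc; auto).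
      exists (l1 ++ [z]). repeat split.
      * rewrite app_comm_cons in N. apply NoDup_app_remove_r in N; auto.
      * apply adj_chain_app in C. tauto.
      * apply last_last.
      * intros v Hv. apply IP. rewrite app_comm_cons. apply in_or_app; auto.
    + exists (l ++ [z]). repeat split.
      * rewrite app_comm_cons. apply NoDup_app; auto.
        -- constructor; [intros []|constructor].
        -- intros v Hv [<-|[]]; auto.
      * apply adj_chain_app. rewrite L. simpl. auto.
      * apply last_last.
      * intros v. rewrite app_comm_cons, in_app_iff. simpl. intros [Hv|[<-|[]]]; auto.
Qed.

Lemma conn_chain P x l :
  (forall v, In v (x :: l) -> P v) -> adj_chain E x l -> conn P x (last l x).
Proof.
  revert x; induction l as [|y l IH]; intros x HP C; [apply conn_refl|].
  destruct C as [C1 C2].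
  rewrite last_cons. apply conn_trans with y.
  - apply conn_step; auto; apply HP; simpl; auto.
  - apply IH; auto. intros v Hv. apply HP; right; auto.
Qed.

End Connectivity.

Lemma conn_graph_mono {V : Type} (E E' : V -> V -> Prop) (P : V -> Prop) x y :
  (forall a b, P a -> P b -> adjU E a b -> adjU E' a b) -> conn E P x y -> conn E' P x y.
Proof.
  intros HPQ H; induction H as [x y [H1 [H2 H3]]| |x y z _ IH1 _ IH2].
  - apply rt_step. auto.
  - apply rt_refl.
  - eapply rt_trans; eauto.
Qed.

(** A connection uses only finitely many vertices. This is what turns connectedness into finiteness
    of families of cuts: a cut separating [x] from [y] must cut an edge inside the list. *)
Lemma conn_within_list {V : Type} (E : V -> V -> Prop) (P : V -> Prop) x y :
  P x -> conn E P x y ->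
  exists l, In x l /\ In y l /\ (forall v, In v l -> P v /\ conn E (fun u => In u l) x v).
Proof.
  intros Hx H. apply clos_rt_rtn1 in H.
  induction H as [|y z [H1 [H2 H3]] _ [l [I1 [I2 IP]]]].
  - exists [x]. simpl. repeat split; auto.
    + destruct H as [<-|[]]; auto.
    + destruct H as [<-|[]]. apply conn_refl.
  - exists (z :: l). split; [right; auto|]. split; [left; auto|].
    assert (Hm : forall v, conn E (fun u => In u l) x v -> conn E (fun u => In u (z :: l)) x v).
    { intros v. apply conn_mono. intros u Hu; right; auto. }
    intros v [<-|Hv].
    + split; auto. apply conn_trans with y.
      * apply Hm, IP; auto.
      * apply conn_step; simpl; auto.
    + split; [apply IP; auto|apply Hm, IP; auto].
Qed.

Lemma is_aut_inv {V : Type} (E : V -> V -> Prop) g :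
  is_aut E g -> exists h, is_aut E h /\ (forall x, h (g x) = x) /\ (forall y, g (h y) = y).
Proof.
  intros [[h [hg gh]] HE]. exists h. repeat split; auto.
  - exists g. auto.
  - intros H. apply HE. rewrite !gh; auto.
  - intros H. apply HE in H. rewrite !gh in H; auto.
Qed.

(** * Nested minimal edge cuts *)

Section CutDefs.
Context {V : Type} (E : V -> V -> Prop).
Implicit Types (C D Z : V -> bool).

(** Each undirected edge of the cut occurs once, as a pair leading from the true to the false side,
    so [cardf] of this set is the size of the cut. *)
Definition bd C (p : V * V) : Prop :=
  adjU E (fst p) (snd p) /\ C (fst p) = true /\ C (snd p) = false.

Definition cneg C : V -> bool := fun v => negb (C v).
Definition cand C D : V -> bool := fun v => C v && D v.
Definition cor C D : V -> bool := fun v => C v || D v.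

Definition sides_connected C : Prop :=
  induced_connected E (fun v => C v = true) /\ induced_connected E (fun v => C v = false).

Definition infcut C : Prop :=
  ~ finite_set (fun v => C v = true) /\ ~ finite_set (fun v => C v = false) /\
  finite_set (bd C).

Definition crosses C D : Prop :=
  (exists v, C v = true /\ D v = true) /\ (exists v, C v = true /\ D v = false) /\
  (exists v, C v = false /\ D v = true) /\ (exists v, C v = false /\ D v = false).

End CutDefs.

Lemma crosses_neg {V : Type} (C D : V -> bool) : crosses C D <-> crosses C (cneg D).
Proof.
  unfold crosses, cneg.
  split; intros [[a Ha] [[b Hb] [[c Hc] [e He]]]];
  (split; [exists b|split; [exists a|split; [exists e|exists c]]]);
  rewrite ?negb_true_iff, ?negb_false_iff in *; tauto.
Qed.


(** Induction on the size of the cut, deleting the edge between [x] and [y]; the digraph is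
    quantified inside because it shrinks. Deletion keeps both sides connected, since this edge
    crosses the cut. If [x] and [y] stay joined, a finite connecting set contains another crossing
    edge, for which there are finitely many choices, and the cut has lost one edge. *)
Lemma finite_tight_cuts {V : Type} (n : nat) : forall (E : V -> V -> Prop) x y,
  finite_set (fun C : V -> bool =>
    (adjU E x y /\ C x = true /\ C y = false) /\ card_is (bd E C) n /\ sides_connected E C).
Proof.
  induction n as [|n IH]; intros E x y.
  { exists []. intros C [[H1 [H2 H3]] [[l [_ [Hl Hin]]] _]].
    destruct l; [|discriminate]. apply (Hin (x, y)). repeat split; auto. }
  set (E' := fun a b => E a b /\ ~ (a = x /\ b = y) /\ ~ (a = y /\ b = x)).
  assert (Hadj : forall a b, adjU E' a b <->
                 adjU E a b /\ ~ (a = x /\ b = y) /\ ~ (a = y /\ b = x)).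
  { intros a b. unfold adjU, E'. intuition. }
  assert (Hsc : forall C, C x = true -> C y = false -> sides_connected E C -> sides_connected E' C).
  { intros C Cx Cy [S1 S2]. split; intros a b Ha Hb.
    - apply conn_graph_mono with E; [|apply S1; auto].
      intros c d Hc Hd Hcd. apply Hadj. repeat split; auto; intros [-> ->]; congruence.
    - apply conn_graph_mono with E; [|apply S2; auto].
      intros c d Hc Hd Hcd. apply Hadj. repeat split; auto; intros [-> ->]; congruence. }
  destruct (classic (conn E' (fun _ => True) x y)) as [Hxy|Hxy].
  - destruct (conn_within_list E' _ x y I Hxy) as [l [Hx [Hy Hl]]].
    apply finite_sub with (fun C => exists p, In p (list_prod l l) /\
      ((adjU E' (fst p) (snd p) /\ C (fst p) = true /\ C (snd p) = false) /\
       card_is (bd E' C) n /\ sides_connected E' C)).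
    2:{ apply finite_bigor. intros p _. apply IH. }
    intros C [[H1 [H2 H3]] [[m [Nm [Lm Hm]]] HS]].
    destruct (conn_crossing E' (fun u => In u l) (fun v => C v = true) x y) as
      [u [v [Hu [Hv [Huv [Cu Cv]]]]]]; auto.
    { apply Hl; auto. }
    { congruence. }
    exists (u, v). apply not_true_is_false in Cv. split; [apply in_prod; auto|].
    split; [simpl; auto|]. split; [|auto].
    assert (Hin : In (x, y) m) by (apply Hm; repeat split; auto).
    destruct (in_split _ _ Hin) as [m1 [m2 ->]].
    exists (m1 ++ m2). split; [eapply NoDup_remove_1; eauto|]. split.
    + rewrite length_app in *. simpl in Lm. lia.
    + intros [a b]. destruct (classic ((a, b) = (x, y))) as [Heq|Hne].
      * rewrite Heq. split; intros Hc.
        -- exfalso. eapply NoDup_remove_2; eauto.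
        -- exfalso. destruct Hc as [Hc _]. apply Hadj in Hc. simpl in Hc. tauto.
      * assert (Hi : In (a, b) (m1 ++ m2) <-> In (a, b) (m1 ++ (x, y) :: m2)).
        { rewrite !in_app_iff. simpl. intuition congruence. }
        rewrite Hi, Hm. unfold bd; simpl. rewrite Hadj.
        split; [|tauto]. intros [Ha [Hb Hc]]. repeat split; auto.
        -- intros [-> ->]; auto.
        -- intros [-> ->]; congruence.
  (* Here the deleted edge was a bridge, and connectedness of both sides leaves only the component
     of [x] as the true side. *)
  - exists [fun v => holds (conn E' (fun _ => True) x v)].
    intros C [[H1 [H2 H3]] [_ HS]]. left. apply functional_extensionality. intros v.
    destruct (Hsc C H2 H3 HS) as [S1 S2]. destruct (C v) eqn:Cv.
    + apply holds_true. apply conn_mono with (2 := S1 x v H2 Cv). auto.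
    + apply holds_false. intros N. apply Hxy. apply conn_trans with v; auto.
      apply conn_mono with (2 := S2 v y Cv H3). auto.
Qed.

Section Cuts.
Context {V : Type} (E : V -> V -> Prop).
Hypothesis Hconn : connected E.
Implicit Types (C D Z : V -> bool).

Lemma bd_neg C : finite_set (bd E C) ->
  finite_set (bd E (cneg C)) /\ cardf (bd E (cneg C)) = cardf (bd E C).
Proof.
  intros F.
  assert (Hsw : forall p, bd E C p <-> bd E (cneg C) (snd p, fst p)).
  { intros [a b]. unfold bd, cneg; simpl.
    rewrite negb_true_iff, negb_false_iff. unfold adjU. tauto. }
  split.
  - destruct F as [l Hl]. exists (map (fun p => (snd p, fst p)) l).
    intros [a b] H. apply in_map_iff. exists (b, a). split; auto.
    apply Hl. apply Hsw. auto.
  - symmetry. apply cardf_bij with (f := fun p => (snd p, fst p)) (h := fun p => (snd p, fst p)); auto;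
    intros []; auto.
Qed.

Lemma infcut_neg C : infcut E C -> infcut E (cneg C).
Proof.
  intros [H1 [H2 H3]]. split; [|split].
  - intros F. apply H2. apply finite_sub with (2 := F). unfold cneg. intros v ->; auto.
  - intros F. apply H1. apply finite_sub with (2 := F). unfold cneg. intros v ->; auto.
  - apply bd_neg; auto.
Qed.

Hypothesis Hcut : exists C, infcut E C.

Definition mincut C : Prop :=
  infcut E C /\ forall D, infcut E D -> cardf (bd E C) <= cardf (bd E D).

Lemma mincut_exists : exists C, mincut C.
Proof.
  destruct (least_nat (fun n => exists C, infcut E C /\ cardf (bd E C) = n)) as [n [[C [HC Hn]] Hm]].
  { destruct Hcut as [C HC]. eauto. }
  exists C. split; auto. intros D HD. rewrite Hn. apply Hm. eauto.
Qed.

Lemma mincut_neg C : mincut C -> mincut (cneg C).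
Proof.
  intros [H1 H2]. split; [apply infcut_neg; auto|].
  rewrite (proj2 (bd_neg C (proj2 (proj2 H1)))). auto.
Qed.

(** Suppose the side falls into two nonempty pieces without edges between them. One is infinite and
    would itself be a cut; its boundary lies strictly inside that of [C], because the other piece
    also has an edge leaving [C]. [Key] is symmetric in the pieces and makes both finite. *)
Lemma mincut_true_connected C : mincut C -> induced_connected E (fun v => C v = true).
Proof.
  intros [[I1 [I2 F]] Hmin] x y Cx Cy. apply NNPP. intros N.
  set (X := fun v => C v && holds (conn E (fun u => C u = true) x v)).
  set (Y := fun v => C v && negb (holds (conn E (fun u => C u = true) x v))).
  assert (HX : forall v, X v = true <-> C v = true /\ conn E (fun u => C u = true) x v).
  { intros v. unfold X. rewrite andb_true_iff, holds_true. tauto. }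
  assert (HY : forall v, Y v = true <-> C v = true /\ ~ conn E (fun u => C u = true) x v).
  { intros v. unfold Y. rewrite andb_true_iff, negb_true_iff, holds_false. tauto. }
  assert (Xx : X x = true) by (apply HX; split; auto; apply conn_refl).
  assert (Yy : Y y = true) by (apply HY; auto).
  assert (Hno : forall u v, X u = true -> Y v = true -> adjU E u v -> False).
  { intros u v Hu Hv Huv. apply HX in Hu. apply HY in Hv. apply (proj2 Hv).
    apply conn_trans with u; [tauto|]. apply conn_step; tauto. }
  assert (Hpart : forall v, C v = true -> X v = true \/ Y v = true).
  { intros v Hv. rewrite HX, HY. tauto. }
  assert (Key : forall X Y : V -> bool,
    (forall v, X v = true -> C v = true) -> (forall v, Y v = true -> C v = true) ->
    (forall v, X v = true -> Y v = true -> False) ->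
    (forall u v, X u = true -> Y v = true -> adjU E u v -> False) ->
    (forall v, C v = true -> X v = true \/ Y v = true) ->
    (exists v, Y v = true) -> finite_set (fun v => X v = true)).
  { clear - Hmin I1 I2 F Hconn. intros X Y XC YC XY Hno Hpart [v Hv]. apply NNPP. intros IX.
    assert (Hb : forall p, bd E X p -> bd E C p).
    { intros [a b] [Hab [Ha Hb]]; simpl in *. repeat split; simpl; auto.
      destruct (C b) eqn:Cb; auto. destruct (Hpart b Cb) as [Hc|Hc]; [congruence|].
      exfalso; eauto. }
    assert (IC : infcut E X).
    { split; [auto|split].
      - intros Fx. apply I2. apply finite_sub with (2 := Fx). intros w Hw.
        destruct (X w) eqn:Xw; auto. apply XC in Xw. congruence.
      - apply finite_sub with (2 := F). auto. }
    assert (Hex : exists a b, adjU E a b /\ Y a = true /\ Y b <> true).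
    { assert (exists w, C w = false) as [w Hw].
      { apply NNPP. intros N. apply I2. exists []. intros w Hw. exfalso; eauto. }
      destruct (conn_crossing E (fun _ => True) (fun v => Y v = true) v w) as
        [a [b [_ [_ [Hab [Ha Hb']]]]]]; auto.
      - apply Hconn; auto.
      - intros Yw. apply YC in Yw. congruence.
      - eauto. }
    destruct Hex as [a [b [Hab [Ha Hb']]]].
    assert (Cb : C b = false).
    { destruct (C b) eqn:Cb; auto. destruct (Hpart b Cb) as [Hc|Hc]; [|tauto].
      exfalso. apply (Hno b a); auto. apply adjU_sym; auto. }
    assert (cardf (bd E X) < cardf (bd E C)).
    { apply cardf_lt with (a, b); auto.
      - repeat split; simpl; auto.
      - intros [_ [Xa _]]. simpl in Xa. eauto. }
    specialize (Hmin X IC). lia. }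
  apply I1. apply finite_sub with (fun v => X v = true \/ Y v = true); auto.
  apply finite_or.
  - apply Key with Y; auto; try (intros v); [..|exists y; auto].
    + rewrite HX; tauto.
    + rewrite HY; tauto.
    + rewrite HX, HY; tauto.
  - apply Key with X; auto; try (intros v); [..|exists x; auto].
    + rewrite HY; tauto.
    + rewrite HX; tauto.
    + rewrite HX, HY; tauto.
    + intros w Hv Hw Hvw. apply (Hno w v); auto. apply adjU_sym; auto.
    + intros Hv. apply Hpart in Hv. tauto.
Qed.

Lemma mincut_sides_connected C : mincut C -> sides_connected E C.
Proof.
  intros H. split; [apply mincut_true_connected; auto|].
  intros x y Cx Cy. apply conn_mono with (fun v => cneg C v = true).
  - unfold cneg. intros v. apply negb_true_iff.
  - apply (mincut_true_connected _ (mincut_neg _ H)); unfold cneg; rewrite ?Cx, ?Cy; auto.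
Qed.

Lemma finite_mincuts_through x y :
  finite_set (fun C => mincut C /\ adjU E x y /\ C x = true /\ C y = false).
Proof.
  destruct mincut_exists as [C0 H0].
  apply finite_sub with (2 := finite_tight_cuts (cardf (bd E C0)) E x y).
  intros C [HC H]. split; auto. split; [|apply mincut_sides_connected; auto].
  replace (cardf (bd E C0)) with (cardf (bd E C)).
  - apply cardf_card. apply HC.
  - destruct H0 as [I0 M0], HC as [I1 M1]. apply Nat.le_antisymm; auto.
Qed.

Lemma finite_mincuts_within (l : list V) :
  finite_set (fun C => mincut C /\ exists u v, In u l /\ In v l /\ adjU E u v /\
                         C u = true /\ C v = false).
Proof.
  apply finite_sub with (fun C => exists p, In p (list_prod l l) /\
    (mincut C /\ adjU E (fst p) (snd p) /\ C (fst p) = true /\ C (snd p) = false)).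
  - intros C [HC [u [v [Hu [Hv H]]]]]. exists (u, v). split; [apply in_prod; auto|]. simpl. auto.
  - apply finite_bigor. intros p _. apply finite_mincuts_through.
Qed.

Lemma finite_connected_hull (l : list V) :
  exists m, (forall v, In v l -> In v m) /\ induced_connected E (fun v => In v m).
Proof.
  induction l as [|x l [m [Hm Hc]]].
  - exists []. split; auto. intros ? ? [].
  - destruct m as [|o m].
    + exists [x]. split.
      * intros v [<-|Hv]; [left; auto|exfalso; apply (Hm v Hv)].
      * intros a b [<-|[]] [<-|[]]. apply conn_refl.
    + destruct (conn_within_list E (fun _ => True) o x I) as [p [H1 [H2 H3]]].
      { apply Hconn; auto. }
      exists ((o :: m) ++ p). split.
      * intros v [<-|Hv]; apply in_or_app; auto.
      * assert (Ho : forall v, In v ((o :: m) ++ p) -> conn E (fun v => In v ((o :: m) ++ p)) o v).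
        { intros v Hv. apply in_app_or in Hv. destruct Hv as [Hv|Hv].
          - apply conn_mono with (fun v => In v (o :: m)); [intros; apply in_or_app; auto|].
            apply Hc; simpl; auto.
          - apply conn_mono with (fun v => In v p); [intros; apply in_or_app; auto|].
            apply H3; auto. }
        intros a b Ha Hb. apply conn_trans with o; auto. apply conn_sym; auto.
Qed.

(** Each side of a crossing minimal cut [Z] is connected and meets both sides of [C], so it contains
    an end of a boundary edge of [C]. Hence [Z] splits a finite connected set [m] around that
    boundary and cuts an edge inside [m]. *)
Lemma finite_crossing C : mincut C -> finite_set (fun Z => mincut Z /\ crosses Z C).
Proof.
  intros HC. destruct (proj2 (proj2 (proj1 HC))) as [lb Hlb].
  destruct (finite_connected_hull (map fst lb ++ map snd lb)) as [m [Hm Hmc]].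
  apply finite_sub with (2 := finite_mincuts_within m).
  intros Z [HZ Hcr]. split; auto. apply NNPP. intros N.
  assert (Hmono : forall u v, In u m -> In v m -> Z u = true -> Z v = true).
  { intros u v Hu Hv Zu.
    apply (conn_invariant E (fun v => In v m) (fun v => Z v = true) u v); auto.
    - apply Hmc; auto.
    - intros a b Ha Hb Hab Za. destruct (Z b) eqn:Zb; auto. exfalso. apply N.
      exists a, b. auto 6. }
  assert (Hcol : forall b, exists a c, In a m /\ In c m /\ Z a = b /\ Z c = b).
  { destruct (mincut_sides_connected Z HZ) as [S1 S2].
    destruct Hcr as [[p [P1 P2]] [[q [Q1 Q2]] [[r [R1 R2]] [s [T1 T2]]]]].
    assert (Hb : forall x y (b : bool), conn E (fun v => Z v = b) x y -> C x = true -> C y = false ->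
      exists a c, In a m /\ In c m /\ Z a = b /\ Z c = b).
    { intros x y b Hxy Cx Cy.
      destruct (conn_crossing E _ (fun v => C v = true) x y Hxy Cx) as
        [a [c [Ha [Hc [Hac [Ca Cc]]]]]]; [congruence|].
      apply not_true_is_false in Cc.
      assert (Hin : In (a, c) lb) by (apply Hlb; repeat split; auto).
      exists a, c. repeat split; auto; apply Hm, in_or_app.
      - left. apply (in_map fst) in Hin; auto.
      - right. apply (in_map snd) in Hin; auto. }
    intros [|].
    - apply (Hb p q true); auto. apply S1; auto.
    - apply (Hb r s false); auto. apply S2; auto. }
  destruct (Hcol true) as [a [_ [Ha [_ [Za _]]]]], (Hcol false) as [c [_ [Hc [_ [Zc _]]]]].
  specialize (Hmono a c Ha Hc Za). congruence.
Qed.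

Definition crossing_number C : nat := cardf (fun Z => mincut Z /\ crosses Z C).

Lemma crossing_number_neg C : mincut C -> crossing_number (cneg C) = crossing_number C.
Proof.
  intros HC. symmetry. apply cardf_ext.
  - intros Z. rewrite (@crosses_neg V Z C). tauto.
  - apply finite_crossing; auto.
Qed.

(** Submodularity twice. Edge boundaries of the intersection and the union sum to at most those of
    [C] and [D]; both corners being infinite, minimality makes both new cuts minimal. A cut crossing
    one of the new cuts crosses [C] or [D], and one crossing both crosses both, so crossing numbers
    are submodular too. *)
Lemma corner_decreases C D :
  mincut C -> mincut D -> crosses C D ->
  ~ finite_set (fun v => C v = true /\ D v = true) ->
  ~ finite_set (fun v => C v = false /\ D v = false) ->
  mincut (cand C D) /\ mincut (cor C D) /\
  crossing_number (cand C D) + crossing_number (cor C D) < crossing_number C + crossing_number D.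
Proof.
  intros [[C1 [C2 CF]] CM] [[D1 [D2 DF]] DM] Hcr I1 I2.
  destruct (cardf_sum_le (bd E (cand C D)) (bd E (cor C D)) (bd E C) (bd E D)) as [Hle _]; auto.
  { intros [a b] [Hab [Ha Hb]]. unfold cand, bd in *; simpl in *.
    destruct (C a), (C b), (D a), (D b); simpl in *; try discriminate; auto. }
  { intros [a b] [Hab [Ha Hb]]. unfold cor, bd in *; simpl in *.
    destruct (C a), (C b), (D a), (D b); simpl in *; try discriminate; auto. }
  { intros [a b] [Hab [Ha Hb]] [_ [Ha' Hb']]. unfold cand, cor, bd in *; simpl in *.
    destruct (C a), (C b), (D a), (D b); simpl in *; try discriminate; auto. }
  assert (IA : infcut E (cand C D)).
  { split; [|split].
    - intros F. apply I1. apply finite_sub with (2 := F). unfold cand.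
      intros v [-> ->]; auto.
    - intros F. apply C2. apply finite_sub with (2 := F). unfold cand.
      intros v ->; auto.
    - apply finite_sub with (2 := finite_or _ _ CF DF).
      intros [a b] [Hab [Ha Hb]]. unfold cand, bd in *; simpl in *.
      destruct (C a), (C b), (D a), (D b); simpl in *; try discriminate; auto. }
  assert (IO : infcut E (cor C D)).
  { split; [|split].
    - intros F. apply C1. apply finite_sub with (2 := F). unfold cor.
      intros v ->; auto.
    - intros F. apply I2. apply finite_sub with (2 := F). unfold cor.
      intros v [-> ->]; auto.
    - apply finite_sub with (2 := finite_or _ _ CF DF).
      intros [a b] [Hab [Ha Hb]]. unfold cor, bd in *; simpl in *.
      destruct (C a), (C b), (D a), (D b); simpl in *; try discriminate; auto. }
  assert (MA : mincut (cand C D)).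
  { split; auto. intros Z HZ. pose proof (CM _ IO). pose proof (DM _ HZ). lia. }
  assert (MO : mincut (cor C D)).
  { split; auto. intros Z HZ. pose proof (CM _ IA). pose proof (DM _ HZ). lia. }
  assert (MC : mincut C) by (split; [split|]; auto).
  assert (MD : mincut D) by (split; [split|]; auto).
  split; auto. split; auto.
  destruct (Hcr) as [[p [P1 P2]] [[q [Q1 Q2]] [[r [R1 R2]] [s [S1 S2]]]]].
  apply cardf_sum_le.
  - apply finite_crossing; auto.
  - apply finite_crossing; auto.
  - intros Z [HZ Hx]. apply NNPP. intros N.
    destruct Hx as [[a [A1 A2]] [[b [B1 B2]] [[c [E1 E2]] [d [F1 F2]]]]].
    unfold cand in *. apply andb_true_iff in A2, E2.
    assert (NC : ~ crosses Z C) by tauto. assert (ND : ~ crosses Z D) by tauto. clear N.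
    assert (KC : (forall v, Z v = true -> C v = true) \/ (forall v, Z v = false -> C v = true)).
    { apply NNPP. intros N. apply NC. apply not_or_and in N. destruct N as [N1 N2].
      apply not_all_ex_not in N1, N2. destruct N1 as [u Hu], N2 as [w Hw].
      apply imply_to_and in Hu, Hw. rewrite !not_true_iff_false in *.
      split; [exists a; tauto|split; [exists u; tauto|split; [exists c; tauto|exists w; tauto]]]. }
    assert (KD : (forall v, Z v = true -> D v = true) \/ (forall v, Z v = false -> D v = true)).
    { apply NNPP. intros N. apply ND. apply not_or_and in N. destruct N as [N1 N2].
      apply not_all_ex_not in N1, N2. destruct N1 as [u Hu], N2 as [w Hw].
      apply imply_to_and in Hu, Hw. rewrite !not_true_iff_false in *.
      split; [exists a; tauto|split; [exists u; tauto|split; [exists c; tauto|exists w; tauto]]]. }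
    destruct KC as [KC|KC], KD as [KD|KD].
    + rewrite (KC b B1), (KD b B1) in B2. discriminate.
    + destruct (Z s) eqn:Zs; [rewrite (KC s Zs) in S1|rewrite (KD s Zs) in S2]; discriminate.
    + destruct (Z s) eqn:Zs; [rewrite (KD s Zs) in S2|rewrite (KC s Zs) in S1]; discriminate.
    + rewrite (KC d F1), (KD d F1) in F2. discriminate.
  - intros Z [HZ Hx]. apply NNPP. intros N.
    destruct Hx as [[a [A1 A2]] [[b [B1 B2]] [[c [E1 E2]] [d [F1 F2]]]]].
    unfold cor in *. apply orb_false_iff in B2, F2.
    assert (NC : ~ crosses Z C) by tauto. assert (ND : ~ crosses Z D) by tauto. clear N.
    assert (KC : (forall v, Z v = true -> C v = false) \/ (forall v, Z v = false -> C v = false)).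
    { apply NNPP. intros N. apply NC. apply not_or_and in N. destruct N as [N1 N2].
      apply not_all_ex_not in N1, N2. destruct N1 as [u Hu], N2 as [w Hw].
      apply imply_to_and in Hu, Hw. rewrite !not_false_iff_true in *.
      split; [exists u; tauto|split; [exists b; tauto|split; [exists w; tauto|exists d; tauto]]]. }
    assert (KD : (forall v, Z v = true -> D v = false) \/ (forall v, Z v = false -> D v = false)).
    { apply NNPP. intros N. apply ND. apply not_or_and in N. destruct N as [N1 N2].
      apply not_all_ex_not in N1, N2. destruct N1 as [u Hu], N2 as [w Hw].
      apply imply_to_and in Hu, Hw. rewrite !not_false_iff_true in *.
      split; [exists u; tauto|split; [exists b; tauto|split; [exists w; tauto|exists d; tauto]]]. }
    destruct KC as [KC|KC], KD as [KD|KD].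
    + rewrite (KC a A1), (KD a A1) in A2. discriminate.
    + destruct (Z p) eqn:Zp; [rewrite (KC p Zp) in P1|rewrite (KD p Zp) in P2]; discriminate.
    + destruct (Z p) eqn:Zp; [rewrite (KD p Zp) in P2|rewrite (KC p Zp) in P1]; discriminate.
    + rewrite (KC c E1), (KD c E1) in E2. discriminate.
  - intros Z [HZ Hx] [_ Hy].
    destruct Hx as [[a [A1 A2]] [[b [B1 B2]] [[c [E1 E2]] [d [F1 F2]]]]].
    destruct Hy as [[a' [A1' A2']] [[b' [B1' B2']] [[c' [E1' E2']] [d' [F1' F2']]]]].
    unfold cand, cor in *. apply andb_true_iff in A2, E2. apply orb_false_iff in B2', F2'.
    assert (HCx : crosses Z C).
    { split; [exists a|split; [exists b'|split; [exists c|exists d']]]; tauto. }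
    assert (HDx : crosses Z D).
    { split; [exists a|split; [exists b'|split; [exists c|exists d']]]; tauto. }
    auto.
  (* Strictness: [C] itself crosses [D], but is nested with the intersection and with the union. *)
  - exists C. split; [right; auto|]. unfold cand, cor. split; intros [_ Hx].
    + destruct Hx as [_ [_ [[v [V1 V2]] _]]]. rewrite V1 in V2. discriminate.
    + destruct Hx as [_ [[v [V1 V2]] _]]. rewrite V1 in V2. discriminate.
Qed.

Definition optcut C : Prop :=
  mincut C /\ forall D, mincut D -> crossing_number C <= crossing_number D.

Lemma optcut_exists : exists C, optcut C.
Proof.
  destruct (least_nat (fun n => exists C, mincut C /\ crossing_number C = n)) as [n [[C [HC Hn]] Hm]].
  { destruct mincut_exists as [C HC]. eauto. }
  exists C. split; auto. intros D HD. rewrite Hn. apply Hm. eauto.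
Qed.

Lemma optcut_neg C : optcut C -> optcut (cneg C).
Proof.
  intros [H1 H2]. split; [apply mincut_neg; auto|].
  rewrite crossing_number_neg; auto.
Qed.

(** Two adjacent corners cannot both be finite, for they make up a side of [C] or [D]. So some pair
    of opposite corners is infinite, and [corner_decreases] contradicts optimality; the mixed pair
    is reached by replacing [D] by its complement. *)
Lemma optcut_nested C D : optcut C -> optcut D -> ~ crosses C D.
Proof.
  assert (Key : forall C D, optcut C -> optcut D -> crosses C D ->
    ~ finite_set (fun v => C v = true /\ D v = true) ->
    ~ finite_set (fun v => C v = false /\ D v = false) -> False).
  { clear C D. intros C D [MC OC] [MD OD] Hx H1 H2.
    destruct (corner_decreases C D MC MD Hx H1 H2) as [MA [MO Hlt]].
    pose proof (OC _ MA). pose proof (OD _ MO). lia. }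
  intros HC HD Hx.
  assert (Hf : forall (A B : V -> Prop) (b : bool) (Z : V -> bool),
    (forall v, Z v = b -> A v \/ B v) -> ~ finite_set (fun v => Z v = b) ->
    ~ (finite_set A /\ finite_set B)).
  { intros A B b Z H N [FA FB]. apply N. apply finite_sub with (2 := finite_or _ _ FA FB). auto. }
  destruct HC as [[[C1 [C2 CF]] CM] CO], HD as [[[D1 [D2 DF]] DM] DO].
  assert (HC : optcut C) by (split; [split; [split|]|]; auto).
  assert (HD : optcut D) by (split; [split; [split|]|]; auto).
  pose proof (Hf (fun v => C v = true /\ D v = true) (fun v => C v = true /\ D v = false) true C
    ltac:(intros v Hv; cbv beta; rewrite Hv; destruct (D v); auto) C1) as K1.
  pose proof (Hf (fun v => C v = false /\ D v = true) (fun v => C v = false /\ D v = false) false C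
    ltac:(intros v Hv; cbv beta; rewrite Hv; destruct (D v); auto) C2) as K2.
  pose proof (Hf (fun v => C v = true /\ D v = true) (fun v => C v = false /\ D v = true) true D
    ltac:(intros v Hv; cbv beta; rewrite Hv; destruct (C v); auto) D1) as K3.
  pose proof (Hf (fun v => C v = true /\ D v = false) (fun v => C v = false /\ D v = false) false D
    ltac:(intros v Hv; cbv beta; rewrite Hv; destruct (C v); auto) D2) as K4.
  pose proof (Key C D HC HD Hx) as K5.
  pose proof (Key C (cneg D) HC (optcut_neg _ HD) (proj1 (@crosses_neg V C D) Hx)) as K6.
  assert (K7 : finite_set (fun v => C v = true /\ cneg D v = true) ->
               finite_set (fun v => C v = true /\ D v = false)).
  { apply finite_sub. unfold cneg. intros v [-> ->]; auto. }
  assert (K8 : finite_set (fun v => C v = false /\ cneg D v = false) ->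
               finite_set (fun v => C v = false /\ D v = true)).
  { apply finite_sub. unfold cneg. intros v [-> ->]; auto. }
  destruct (classic (finite_set (fun v => C v = true /\ D v = true))) as [A|A];
  [|destruct (classic (finite_set (fun v => C v = false /\ D v = false))) as [A'|A']].
  - destruct (classic (finite_set (fun v => C v = false /\ D v = true))) as [B|B].
    + apply K3; auto.
    + apply K6; auto.
  - destruct (classic (finite_set (fun v => C v = false /\ D v = true))) as [B|B].
    + apply K2; auto.
    + apply K6; auto.
  - apply K5; auto.
Qed.

Lemma aut_adjU g x y : is_aut E g -> (adjU E x y <-> adjU E (g x) (g y)).
Proof. intros [_ H]. unfold adjU. rewrite (H x y), (H y x). tauto. Qed.

Lemma bd_aut C g : is_aut E g -> finite_set (bd E C) ->
  finite_set (bd E (fun v => C (g v))) /\ cardf (bd E (fun v => C (g v))) = cardf (bd E C).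
Proof.
  intros Hg F. destruct (is_aut_inv E g Hg) as [h [Hh [hg gh]]].
  assert (Hb : forall p, bd E C p <-> bd E (fun v => C (g v)) (h (fst p), h (snd p))).
  { intros [a b]. unfold bd; simpl. rewrite !gh, <- (aut_adjU h a b Hh). tauto. }
  split.
  - destruct F as [l Hl]. exists (map (fun p => (h (fst p), h (snd p))) l).
    intros [a b] H. apply in_map_iff. exists (g a, g b). simpl. rewrite !hg. split; auto.
    apply Hl, Hb. simpl. rewrite !hg. auto.
  - symmetry. apply cardf_bij with (f := fun p => (h (fst p), h (snd p)))
                        (h := fun p => (g (fst p), g (snd p))); auto; intros []; simpl;
      rewrite ?hg, ?gh; auto.
Qed.

Lemma infcut_aut C g : is_aut E g -> infcut E C -> infcut E (fun v => C (g v)).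
Proof.
  intros Hg [H1 [H2 H3]]. destruct (is_aut_inv E g Hg) as [h [Hh [hg gh]]].
  assert (Hf : forall b, finite_set (fun v => C (g v) = b) -> finite_set (fun v => C v = b)).
  { intros b [l Hl]. exists (map g l). intros w Hw. apply in_map_iff. exists (h w).
    split; auto. apply Hl. rewrite gh; auto. }
  split; [|split]; auto. apply bd_aut; auto.
Qed.

Lemma mincut_aut C g : is_aut E g -> mincut C -> mincut (fun v => C (g v)).
Proof.
  intros Hg [HI HM]. split; [apply infcut_aut; auto|].
  intros D HD. rewrite (proj2 (bd_aut C g Hg (proj2 (proj2 HI)))). auto.
Qed.

Lemma mincut_aut_iff C g : is_aut E g -> (mincut C <-> mincut (fun v => C (g v))).
Proof.
  intros Hg. split; [apply mincut_aut; auto|]. intros H.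
  destruct (is_aut_inv E g Hg) as [h [Hh [hg gh]]].
  apply (mincut_aut _ h Hh) in H.
  replace C with (fun v => C (g (h v))); auto.
  apply functional_extensionality. intros v. rewrite gh; auto.
Qed.

Lemma optcut_aut C g : is_aut E g -> optcut C -> optcut (fun v => C (g v)).
Proof.
  intros Hg [HM HO]. split; [apply mincut_aut; auto|]. intros D HD.
  replace (crossing_number (fun v => C (g v))) with (crossing_number C); auto.
  destruct (is_aut_inv E g Hg) as [h [Hh [hg gh]]].
  apply cardf_bij with (f := fun Z v => Z (g v)) (h := fun Z v => Z (h v)).
  - apply finite_crossing; auto.
  - intros Z. apply functional_extensionality. intros v. rewrite gh; auto.
  - intros Z. apply functional_extensionality. intros v. rewrite hg; auto.
  - intros Z. rewrite <- (mincut_aut_iff Z g Hg).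
    assert (Hx : crosses Z C <-> crosses (fun v => Z (g v)) (fun v => C (g v))); [|tauto].
    unfold crosses. split; intros [[a Ha] [[b Hb] [[c Hc] [e He]]]].
    + split; [exists (h a)|split; [exists (h b)|split; [exists (h c)|exists (h e)]]]; rewrite gh; auto.
    + split; [exists (g a)|split; [exists (g b)|split; [exists (g c)|exists (g e)]]]; auto.
Qed.

(** A cut and its complement both count, so every undirected cut contributes two. *)
Definition cut_dist (u v : V) : nat := cardf (fun C => optcut C /\ C u <> C v).

Lemma finite_separating u v : finite_set (fun C => optcut C /\ C u <> C v).
Proof.
  destruct (conn_within_list E (fun _ => True) u v I) as [l [Hu [Hv Hl]]].
  { apply Hconn; auto. }
  apply finite_sub with (2 := finite_mincuts_within l).
  intros C [[HC _] Hne]. split; auto.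
  assert (Hc : conn E (fun x => In x l) u v) by (apply Hl; auto).
  destruct (C u) eqn:Cu.
  - destruct (conn_crossing E _ (fun x => C x = true) u v Hc Cu) as [a [b [Ha [Hb [Hab [Ca Cb]]]]]].
    { congruence. }
    exists a, b. apply not_true_is_false in Cb. auto 6.
  - destruct (conn_crossing E _ (fun x => C x = true) v u (conn_sym _ _ _ _ Hc)) as
      [a [b [Ha [Hb [Hab [Ca Cb]]]]]].
    { destruct (C v); congruence. }
    { congruence. }
    exists a, b. apply not_true_is_false in Cb. auto 6.
Qed.

Lemma cut_dist_refl u : cut_dist u u = 0.
Proof. unfold cut_dist. rewrite (cardf_list []); auto. constructor. intros C. simpl. tauto. Qed.

Lemma cut_dist_sym u v : cut_dist u v = cut_dist v u.
Proof.
  apply cardf_ext; [|apply finite_separating].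
  intros C. split; intros [H1 H2]; auto.
Qed.

Lemma optcut_no_two_splits C D u v w x :
  optcut C -> optcut D -> C u = C v -> C w = C x -> C u <> C w ->
  D u = D w -> D v = D x -> D u <> D v -> False.
Proof.
  intros HC HD C1 C2 C3 D1 D2 D3. apply (optcut_nested C D HC HD).
  assert (H : forall b b', exists y, C y = b /\ D y = b'); [|repeat split; apply H].
  intros b b'.
  destruct (C u) eqn:Cu, (D u) eqn:Du, (C w) eqn:Cw, (D v) eqn:Dv, b, b'; try congruence;
  first [exists u; split; congruence | exists v; split; congruence |
         exists w; split; congruence | exists x; split; congruence].
Qed.

(** A cut that counts more on the left than on the right has [u], [w] on one side and [v], [x] on
    the other. *)
Lemma cut_dist_no_split u v w x :
  (forall C, optcut C -> C u = C w -> C v = C x -> C u = C v) ->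
  cut_dist u v + cut_dist w x <= cut_dist u w + cut_dist v x.
Proof.
  intros N1. apply cardf_sum_le; try apply finite_separating;
  intros C; intros; specialize (N1 C);
  destruct (C u), (C v), (C w), (C x); intuition congruence.
Qed.

(** Nested cuts cannot realise two different splits of four points into pairs. So the split of [u],
    [w] from [v], [x] or the split of [u], [x] from [v], [w] does not occur, and the absent one
    selects the bound. *)
Lemma cut_dist_four_point u v w x :
  cut_dist u v + cut_dist w x <=
  Nat.max (cut_dist u w + cut_dist v x) (cut_dist u x + cut_dist v w).
Proof.
  destruct (classic (exists C, optcut C /\ C u = C w /\ C v = C x /\ C u <> C v))
    as [[C [HC [C1 [C2 C3]]]]|N1].
  - apply Nat.le_trans with (cut_dist u x + cut_dist v w); [|lia].
    rewrite (cut_dist_sym w x). apply cut_dist_no_split.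
    intros D HD D1 D2. apply NNPP. intros D3.
    apply (optcut_no_two_splits C D u w x v); auto; congruence.
  - apply Nat.le_trans with (cut_dist u w + cut_dist v x); [|lia].
    apply cut_dist_no_split. intros C HC C1 C2. apply NNPP. intros C3. eauto 10.
Qed.

Lemma cut_dist_aut g u v : is_aut E g -> cut_dist (g u) (g v) = cut_dist u v.
Proof.
  intros Hg. destruct (is_aut_inv E g Hg) as [h [Hh [hg gh]]].
  apply cardf_bij with (f := fun Z v => Z (g v)) (h := fun Z v => Z (h v)).
  - apply finite_separating.
  - intros Z. apply functional_extensionality. intros w. rewrite gh; auto.
  - intros Z. apply functional_extensionality. intros w. rewrite hg; auto.
  - intros Z. split; intros [HZ Hn]; split; auto.
    + apply optcut_aut; auto.
    + apply (optcut_aut _ h Hh) in HZ.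
      replace Z with (fun w => Z (g (h w))); auto.
      apply functional_extensionality. intros w. rewrite gh; auto.
Qed.

(** The inequality says that, in the tree, the edge runs along part of the segment from [x0] to [y0]
    in the same direction. Then some optimal cut separates [x], [x0] from [y], [y0]; finitely many
    cuts separate [x0] from [y0], and each has a finite boundary. *)
Lemma cut_dist_finite_parallel x0 y0 :
  finite_set (fun p => adjU E (fst p) (snd p) /\
    cut_dist (fst p) x0 + cut_dist (snd p) y0 < cut_dist (fst p) y0 + cut_dist (snd p) x0).
Proof.
  destruct (finite_separating x0 y0) as [L HL].
  apply finite_sub with (fun p => exists C, In C L /\ (optcut C /\ (bd E C p \/ bd E (cneg C) p))).
  - intros [x y] [Hxy Hlt]; simpl in *.
    destruct (classic (exists C, optcut C /\ C x = C x0 /\ C y = C y0 /\ C x <> C y))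
      as [[C [HC [C1 [C2 C3]]]]|N].
    + exists C. split; [apply HL; split; [auto|congruence]|]. split; auto. unfold bd, cneg. simpl.
      destruct (C x), (C y); try congruence; simpl; auto.
    + exfalso. assert (Hle : cut_dist x y0 + cut_dist x0 y <= cut_dist x x0 + cut_dist y0 y).
      { apply cut_dist_no_split. intros C HC C1 C2. apply NNPP. intros C3.
        apply N. exists C. split; [auto|]. split; [auto|]. split; congruence. }
      rewrite (cut_dist_sym x0 y), (cut_dist_sym y0 y) in Hle. lia.
  - apply finite_bigor. intros C _.
    destruct (classic (optcut C)) as [HC|HC]; [|exists []; tauto].
    apply finite_sub with (fun p => bd E C p \/ bd E (cneg C) p); [tauto|].
    apply finite_or; [apply HC|apply (optcut_neg C HC)].
Qed.

(** Prolong a boundary edge of an optimal cut by one edge within each side; the sides are connected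
    and infinite, so this is possible. By nestedness no cut counts more on the left, and the chosen
    cut counts only on the right. Once all edges have distance [k], this forces the distance of [v']
    and [w'] above [k]. *)
Lemma cut_dist_separated : exists v w v' w',
  adjU E v w /\ adjU E v v' /\ adjU E w w' /\ 0 < cut_dist v w /\
  cut_dist v v' + cut_dist w w' < cut_dist v w + cut_dist v' w'.
Proof.
  destruct optcut_exists as [C HC].
  pose proof HC as [[[I1 [I2 F]] M] O].
  destruct (mincut_sides_connected C (proj1 HC)) as [S1 S2].
  assert (exists a, C a = true) as [a Ha].
  { apply NNPP. intros N. apply I1. exists []. intros w Hw. exfalso; eauto. }
  assert (exists b, C b = false) as [b Hb].
  { apply NNPP. intros N. apply I2. exists []. intros w Hw. exfalso; eauto. }
  destruct (conn_crossing E (fun _ => True) (fun v => C v = true) a b) as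
    [v [w [_ [_ [Hvw [Cv Cw]]]]]]; auto; [apply Hconn; auto|congruence|].
  apply not_true_is_false in Cw.
  assert (Hnb : forall (c : bool) u, C u = c -> induced_connected E (fun v => C v = c) ->
    ~ finite_set (fun v => C v = c) -> exists u', C u' = c /\ adjU E u u').
  { intros c u Cu S I. assert (exists z, C z = c /\ z <> u) as [z [Cz Hz]].
    { apply NNPP. intros N. apply I. exists [u]. intros z Cz. left.
      apply NNPP. intros Hz. eauto. }
    destruct (conn_crossing E _ (fun x => x = u) u z (S u z Cu Cz)) as
      [p [q [Hp [Hq [Hpq [-> _]]]]]]; auto. eauto. }
  destruct (Hnb true v Cv S1 I1) as [v' [Cv' Hv']].
  destruct (Hnb false w Cw S2 I2) as [w' [Cw' Hw']].
  assert (No : forall D, optcut D -> D v = D w -> D v' = D w' -> D v = D v').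
  { intros D HD D1 D2. apply NNPP. intros D3.
    apply (optcut_no_two_splits C D v v' w w'); auto; congruence. }
  assert (No' : forall D, optcut D -> D v = D w' -> D v' = D w -> D v = D v').
  { intros D HD D1 D2. apply NNPP. intros D3.
    apply (optcut_no_two_splits C D v v' w' w); auto; congruence. }
  exists v, w, v', w'. repeat split; auto.
  - apply cardf_pos with C; [apply finite_separating|]. split; auto; congruence.
  - apply cardf_sum_le; try apply finite_separating;
    try (intros D; intros; specialize (No D); specialize (No' D);
         destruct (D v), (D w), (D v'), (D w'); intuition congruence).
    exists C. rewrite Cv, Cw, Cv', Cw'. intuition congruence.
Qed.

End Cuts.

(** * Ends *)

Section Ends.
Context {V : Type} (E : V -> V -> Prop).
Implicit Types (r s t : nat -> V) (F L l : list V).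

Lemma ray_leaves_list r F : ray E r -> exists N, forall j, N <= j -> ~ In (r j) F.
Proof.
  intros [Hinj _]. induction F as [|x F [N HN]].
  - exists 0. auto.
  - destruct (classic (exists n, r n = x)) as [[n Hn]|Hx].
    + exists (N + S n). intros j Hj [Hx|Hx].
      * rewrite <- Hn in Hx. apply Hinj in Hx. lia.
      * apply (HN j); auto; lia.
    + exists N. intros j Hj [Hx'|Hx']; [eauto|apply (HN j); auto].
Qed.

Lemma ray_segment s n k : ray E s ->
  adj_chain E (s n) (map s (seq (S n) k)) /\ last (map s (seq (S n) k)) (s n) = s (n + k).
Proof.
  intros [_ Hs]. revert n. induction k as [|k IH]; intros n.
  - simpl. rewrite Nat.add_0_r. auto.
  - destruct (IH (S n)) as [H1 H2]. cbn [seq map]. split.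
    + split; auto.
    + rewrite last_cons, H2. f_equal; lia.
Qed.

(** Inseparability by finite sets. The work below is to turn it into a third ray that meets both
    infinitely often. *)
Definition linked r s : Prop :=
  forall F, exists n m, ~ In (r n) F /\ conn E (fun v => ~ In v F) (r n) (s m).

(** A stage of the third ray: it stops on [s], and the rest of [s] is still free to be followed. *)
Definition ray_prefix s (x0 : V) L n : Prop :=
  NoDup (x0 :: L) /\ adj_chain E x0 L /\ last L x0 = s n /\
  forall j, n < j -> ~ In (s j) (x0 :: L).

(** Follow [s] a little further and cross to [t] by a link that avoids [F]: the prefix, the used
    part of [s], and the part of [t] before it leaves the prefix for good. A shortest such link
    meets [s] only where it starts and [t] only where it ends, so the new walk is a path and the
    tail of [t] is free. *)
Lemma ray_prefix_switch s t x0 L n :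
  ray E s -> ray E t -> (forall i j, s i <> t j) -> linked s t ->
  ray_prefix s x0 L n -> exists L' m, L' <> [] /\ ray_prefix t x0 (L ++ L') m.
Proof.
  intros Rs Rt Hdis Hlink [N0 [C0 [La0 Hav]]].
  destruct (ray_leaves_list t (x0 :: L) Rt) as [M HM].
  set (F := (x0 :: L) ++ map s (seq 0 (S n)) ++ map t (seq 0 M)).
  set (good := fun k => exists i j l, length l = k /\ NoDup (s i :: l) /\ adj_chain E (s i) l /\
     last l (s i) = t j /\ forall v, In v (s i :: l) -> ~ In v F).
  destruct (least_nat good) as [k [[i [j [l [Hlen [Nl [Cl [Ll Fl]]]]]]] Hmin]].
  { destruct (Hlink F) as [i [j [Hi Hc]]].
    destruct (conn_simple_path E _ _ _ Hi Hc) as [l [H1 [H2 [H3 H4]]]].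
    exists (length l), i, j, l. auto. }
  assert (Hi : n < i).
  { destruct (le_lt_dec i n) as [H|H]; auto. exfalso. apply (Fl (s i)); [left; auto|].
    unfold F. rewrite !in_app_iff. right; left. apply in_map, in_seq. lia. }
  assert (Hj : M <= j).
  { destruct (le_lt_dec M j) as [H|H]; auto. exfalso. apply (Fl (t j)).
    - rewrite <- Ll. apply last_in.
    - unfold F. rewrite !in_app_iff. right; right. apply in_map, in_seq. lia. }
  assert (Hs : forall a, ~ In (s a) l).
  { intros a Ha. destruct (in_split _ _ Ha) as [l1 [l2 ->]].
    assert (Hg : good (length l2)).
    { exists a, j, l2. split; auto. split; [|split; [|split]].
      - inversion Nl as [|? ? _ Nl2]; subst. apply NoDup_app_remove_l in Nl2. auto.
      - apply adj_chain_app in Cl. apply Cl.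
      - rewrite <- Ll. symmetry. apply last_app_cons.
      - intros v Hv. apply Fl. right. apply in_or_app; right; auto. }
    apply Hmin in Hg. rewrite length_app in Hlen. simpl in Hlen. lia. }
  assert (Ht : forall a, In (t a) l -> a = j).
  { intros a Ha. destruct (in_split _ _ Ha) as [l1 [l2 ->]].
    assert (Hg : good (length (l1 ++ [t a]))).
    { replace (l1 ++ t a :: l2) with ((l1 ++ [t a]) ++ l2) in * by (rewrite <- app_assoc; auto).
      exists i, a, (l1 ++ [t a]). split; auto. split; [|split; [|split]].
      - rewrite app_comm_cons in Nl. apply NoDup_app_remove_r in Nl. auto.
      - apply adj_chain_app in Cl. apply Cl.
      - apply last_last.
      - intros v Hv. apply Fl. rewrite app_comm_cons. apply in_or_app; auto. }
    apply Hmin in Hg. rewrite length_app in Hlen, Hg. simpl in *.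
    destruct l2; [|simpl in *; lia].
    rewrite last_last in Ll. apply Rt in Ll. auto. }
  destruct (ray_segment s n (i - n) Rs) as [G1 G2].
  replace (n + (i - n)) with i in G2 by lia.
  exists (map s (seq (S n) (i - n)) ++ l), j. split.
  { replace (i - n) with (S (i - S n)) by lia. simpl. discriminate. }
  split; [|split; [|split]].
  - rewrite app_comm_cons. apply NoDup_app; auto; [apply NoDup_app|].
    + apply FinFun.Injective_map_NoDup; [|apply seq_NoDup]. intros a b Hab. apply Rs; auto.
    + inversion Nl; auto.
    + intros v Hv Hv'. apply in_map_iff in Hv. destruct Hv as [a [<- _]]. apply (Hs a); auto.
    + intros v Hv Hv'. apply in_app_or in Hv'. destruct Hv' as [Hv'|Hv'].
      * apply in_map_iff in Hv'. destruct Hv' as [a [<- Ha]]. apply in_seq in Ha.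
        apply (Hav a); auto; lia.
      * apply (Fl v); [right; auto|]. apply in_or_app; left; auto.
  - apply adj_chain_app. split; auto. rewrite La0. apply adj_chain_app. split; auto.
    rewrite G2. auto.
  - rewrite app_assoc. destruct l as [|y l].
    + exfalso. apply (Hdis i j). auto.
    + rewrite last_cons in Ll. rewrite <- Ll. apply last_app_cons.
  - intros a Ha Hin. rewrite app_comm_cons, !in_app_iff in Hin. destruct Hin as [Hin|[Hin|Hin]].
    + apply (HM a); auto; lia.
    + apply in_map_iff in Hin. destruct Hin as [b [Hb _]]. apply (Hdis b a); auto.
    + apply Ht in Hin. lia.
Qed.

Lemma nth_last L (x0 d : V) : nth (length L) (x0 :: L) d = last L x0.
Proof.
  revert x0. induction L as [|y L IH]; intros x0; auto.
  rewrite last_cons, <- IH. auto.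
Qed.

Lemma adj_chain_nth L x0 d i :
  adj_chain E x0 L -> i < length L -> adjU E (nth i (x0 :: L) d) (nth (S i) (x0 :: L) d).
Proof.
  revert x0 i. induction L as [|y L IH]; intros x0 i C Hi; [simpl in Hi; lia|].
  destruct C as [C1 C2]. destruct i as [|i]; auto.
  apply (IH y i C2). simpl in Hi; lia.
Qed.

(** The third ray is the limit of prefixes that switch to [t] and back to [s] at each stage. *)
Lemma linked_disjoint_rays_equiv s t :
  ray E s -> ray E t -> (forall i j, s i <> t j) -> linked s t -> linked t s ->
  equiv_rays E s t.
Proof.
  intros Rs Rt Hdis Hst Hts.
  set (x0 := s 0).
  set (St := {p : list V * nat | ray_prefix s x0 (fst p) (snd p)}).
  assert (Hnext : forall a : St, exists b : St, exists L1 L2 m,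
    fst (proj1_sig b) = fst (proj1_sig a) ++ L1 ++ L2 /\ L1 <> [] /\ L2 <> [] /\
    last (fst (proj1_sig a) ++ L1) x0 = t m).
  { intros [[L n] H]. simpl in *.
    destruct (ray_prefix_switch s t x0 L n Rs Rt Hdis Hst H) as [L1 [m [H1 H2]]].
    destruct (ray_prefix_switch t s x0 (L ++ L1) m Rt Rs (fun i j e => Hdis j i (eq_sym e)) Hts H2)
      as [L2 [n' [H3 H4]]].
    rewrite <- app_assoc in H4.
    exists (exist (fun p => ray_prefix s x0 (fst p) (snd p)) (L ++ L1 ++ L2, n') H4).
    exists L1, L2, m. simpl. split; [auto|]. split; [auto|]. split; [auto|]. apply H2. }
  destruct (choice_fun _ Hnext) as [next Hn].
  assert (H0 : ray_prefix s x0 [] 0).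
  { split; [constructor; [intros []|constructor]|]. split; [exact I|]. split; auto.
    intros j Hj [H|[]]. apply Rs in H. lia. }
  set (st := fun k => Nat.iter k next
        (exist (fun p => ray_prefix s x0 (fst p) (snd p)) ([], 0) H0)).
  set (Ls := fun k => fst (proj1_sig (st k))).
  assert (Hstep : forall k, exists L1 L2 m, Ls (S k) = Ls k ++ L1 ++ L2 /\ L1 <> [] /\ L2 <> [] /\
    last (Ls k ++ L1) x0 = t m) by (intros k; apply Hn).
  assert (Hinv : forall k, exists n, ray_prefix s x0 (Ls k) n).
  { intros k. exists (snd (proj1_sig (st k))). apply (proj2_sig (st k)). }
  assert (Hpre : forall k i, exists L', Ls (k + i) = Ls k ++ L').
  { intros k i. induction i as [|i [L' IH]].
    - exists []. rewrite Nat.add_0_r, app_nil_r. auto.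
    - rewrite Nat.add_succ_r. destruct (Hstep (k + i)) as [L1 [L2 [m [H1 _]]]].
      exists (L' ++ L1 ++ L2). rewrite H1, IH, <- !app_assoc. auto. }
  assert (Hlen : forall k, k <= length (Ls k)).
  { induction k as [|k IH]; [lia|]. destruct (Hstep k) as [L1 [L2 [m [H1 [H2 _]]]]].
    rewrite H1, !length_app. destruct L1; [congruence|]. simpl. lia. }
  (* Stage [p] has at least [p] steps, so the default is never reached; later stages agree because
     they only append. *)
  set (r := fun p => nth p (x0 :: Ls p) x0).
  assert (Hr : forall k p, p <= length (Ls k) -> r p = nth p (x0 :: Ls k) x0).
  { intros k p Hp. unfold r. destruct (le_lt_dec p k) as [H|H].
    - destruct (Hpre p (k - p)) as [L' HL]. replace (p + (k - p)) with k in HL by lia.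
      rewrite HL, app_comm_cons, app_nth1; auto. simpl. pose proof (Hlen p). lia.
    - destruct (Hpre k (p - k)) as [L' HL]. replace (k + (p - k)) with p in HL by lia.
      rewrite HL, app_comm_cons, app_nth1; auto. simpl. lia. }
  exists r. split; [split|split].
  - intros p q Hpq. set (k := Nat.max p q).
    assert (p <= length (Ls k) /\ q <= length (Ls k)) as [Hp Hq] by (pose proof (Hlen k); lia).
    rewrite (Hr k p Hp), (Hr k q Hq) in Hpq.
    destruct (Hinv k) as [n [Nd _]].
    apply (proj1 (NoDup_nth _ x0) Nd p q); simpl; auto; lia.
  - intros p. assert (p < length (Ls (S p))) as Hp by (pose proof (Hlen (S p)); lia).
    rewrite (Hr (S p) p), (Hr (S p) (S p)) by lia.
    destruct (Hinv (S p)) as [n [_ [C _]]]. apply adj_chain_nth; auto.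
  - intros N. destruct (Hinv N) as [n [_ [_ [La _]]]].
    exists (length (Ls N)), n. split; [apply Hlen|].
    rewrite (Hr N) by auto. rewrite nth_last. auto.
  - intros N. destruct (Hstep N) as [L1 [L2 [m [H1 [_ [_ H3]]]]]].
    exists (length (Ls N ++ L1)), m. split; [rewrite length_app; pose proof (Hlen N); lia|].
    rewrite (Hr (S N)).
    + rewrite <- H3, H1, app_assoc, app_comm_cons, app_nth1 by (simpl; lia). apply nth_last.
    + rewrite H1, !length_app. lia.
Qed.

Lemma linked_sym r s : linked r s -> linked s r.
Proof.
  intros H F. destruct (H F) as [n [m [H1 H2]]]. exists m, n. split.
  - apply (conn_mem E (fun v => ~ In v F) (r n)); auto.
  - apply conn_sym; auto.
Qed.

(** If [r] meets [s] infinitely often, [r] itself is the third ray. Otherwise a tail of [r] is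
    disjoint from [s], and it is still linked: the dropped vertices are added to the finite set to
    be avoided. *)
Lemma linked_rays_equiv r s : ray E r -> ray E s -> linked r s -> equiv_rays E r s.
Proof.
  intros Rr Rs Hl. destruct (classic (meets_inf r s)) as [Hm|Hm].
  { exists r. split; auto. split; auto. intros N. exists N, N. auto. }
  apply not_all_ex_not in Hm. destruct Hm as [N HN].
  set (r' := fun n => r (N + n)).
  assert (Rr' : ray E r').
  { split.
    - intros n m H. apply Rr in H. lia.
    - intros n. unfold r'. rewrite Nat.add_succ_r. apply Rr. }
  assert (Hl' : linked r' s).
  { intros F. destruct (Hl (F ++ map r (seq 0 N))) as [n [m [H1 H2]]].
    assert (Hn : N <= n).
    { destruct (le_lt_dec N n); auto. exfalso. apply H1, in_or_app. right.
      apply in_map, in_seq. lia. }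
    exists (n - N), m. unfold r'. replace (N + (n - N)) with n by lia. split.
    - intros Hi. apply H1, in_or_app; auto.
    - apply conn_mono with (2 := H2). intros v Hv Hi. apply Hv, in_or_app; auto. }
  destruct (linked_disjoint_rays_equiv r' s Rr' Rs) as [q [Rq [Q1 Q2]]]; auto.
  - intros i j Hij. apply HN. exists (N + i), j. split; [lia|auto].
  - apply linked_sym; auto.
  - exists q. split; auto. split; auto. intros M. destruct (Q1 M) as [n [m [H1 H2]]].
    exists n, (N + m). auto.
Qed.

Lemma finite_neighbours v : locally_finite E -> finite_set (adjU E v).
Proof. intros H. apply finite_or; apply H. Qed.

(** Inequivalent rays are separated by a finite vertex set [F]. The vertices reachable from [r]
    outside [F] form one side; edges can leave it only into [F], and local finiteness bounds their
    number. *)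
Lemma many_ends_infcut :
  locally_finite E -> more_than_one_end E -> exists C, infcut E C.
Proof.
  intros Hlf [r [s [Rr [Rs Hne]]]].
  assert (Hnl : ~ linked r s) by (intros H; apply Hne; apply linked_rays_equiv; auto).
  apply not_all_ex_not in Hnl. destruct Hnl as [F HF].
  set (I0 := fun v => exists n, ~ In (r n) F /\ conn E (fun u => ~ In u F) (r n) v).
  exists (fun v => holds (I0 v)). split; [|split].
  - intros [l Hl]. destruct (ray_leaves_list r (l ++ F) Rr) as [N HN].
    apply (HN N); auto. apply in_or_app. left. apply Hl, holds_true.
    exists N. split; [|apply conn_refl]. intros Hi. apply (HN N); auto. apply in_or_app; auto.
  - intros [l Hl]. destruct (ray_leaves_list s l Rs) as [N HN].
    apply (HN N); auto. apply Hl, holds_false. intros [n [H1 H2]]. apply HF; eauto.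
  - apply finite_sub with (fun p => exists b, In b F /\ (snd p = b /\ adjU E b (fst p))).
    + intros [a b] [Hab [Ha Hb]]. simpl in *. exists b. apply adjU_sym in Hab. split; auto.
      apply (proj1 (holds_true _)) in Ha. apply (proj1 (holds_false _)) in Hb. destruct Ha as [n [H1 H2]].
      apply NNPP. intros Hn. apply Hb. exists n. split; auto. apply conn_trans with a; auto.
      apply conn_step; auto.
      * apply (conn_mem E (fun u => ~ In u F) (r n)); auto.
      * apply adjU_sym; auto.
    + apply finite_bigor. intros b _. destruct (finite_neighbours b Hlf) as [l Hl].
      exists (map (fun a => (a, b)) l). intros [x y] [H1 H2]. simpl in *. subst.
      apply in_map_iff. exists x; auto.
Qed.

End Ends.

(** * Homogeneity for lists of pairs *)

(** Partial isomorphisms as lists of pairs: the condition is symmetric, so inversion is exchange of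
    components, and extension is adding a pair. *)
Definition piso {V : Type} (E : V -> V -> Prop) (M : list (V * V)) : Prop :=
  forall p q, In p M -> In q M ->
    (fst p = fst q <-> snd p = snd q) /\ (E (fst p) (fst q) <-> E (snd p) (snd q)).

Lemma conn_hom_piso {V : Type} (E : V -> V -> Prop) M :
  conn_hom E -> piso E M -> induced_connected E (fun v => In v (map fst M)) ->
  exists g, is_aut E g /\ forall p, In p M -> g (fst p) = snd p.
Proof.
  intros Hch HM Hc.
  destruct (choice_fun (fun v w => (exists w', In (v, w') M) -> In (v, w) M)) as [f Hf].
  { intros v. destruct (classic (exists w', In (v, w') M)) as [[w Hw]|N]; [exists w; auto|].
    exists v. tauto. }
  assert (Hfp : forall p, In p M -> f (fst p) = snd p).
  { intros [v w] Hp. assert (Hvw : In (v, f v) M) by (apply Hf; eauto).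
    simpl. apply (proj1 (HM (v, f v) (v, w) Hvw Hp)). auto. }
  destruct (Hch (map fst M) f Hc) as [g [Hg Hgf]].
  - intros x y Hx Hy Hxy. apply in_map_iff in Hx, Hy.
    destruct Hx as [p [<- Hp]], Hy as [q [<- Hq]]. rewrite !Hfp in Hxy by auto.
    apply (HM p q Hp Hq); auto.
  - intros x y Hx Hy. apply in_map_iff in Hx, Hy.
    destruct Hx as [p [<- Hp]], Hy as [q [<- Hq]]. rewrite !Hfp by auto. apply (HM p q); auto.
  - exists g. split; auto. intros p Hp. rewrite Hgf; auto. apply in_map; auto.
Qed.

Lemma induced_connected_single {V : Type} (E : V -> V -> Prop) x :
  induced_connected E (fun v => In v [x]).
Proof. intros a b [<-|[]] [<-|[]]. apply rt_refl. Qed.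

Lemma induced_connected_cons {V : Type} (E : V -> V -> Prop) x y l :
  induced_connected E (fun v => In v l) -> In y l -> adjU E x y ->
  induced_connected E (fun v => In v (x :: l)).
Proof.
  intros H Hy Hxy.
  assert (Hl : forall a, In a l -> conn E (fun v => In v (x :: l)) y a).
  { intros a Ha. apply conn_mono with (2 := H y a Hy Ha). intros; right; auto. }
  assert (Hx : conn E (fun v => In v (x :: l)) x y) by (apply conn_step; simpl; auto).
  intros a b Ha Hb. apply conn_trans with y.
  - destruct Ha as [<-|Ha]; auto. apply conn_sym; auto.
  - destruct Hb as [<-|Hb]; auto. apply conn_sym; auto.
Qed.

(** * The reachability relation *)

Section Reachability.
Context {V : Type} (E : V -> V -> Prop).

(** Induction principle for the class of an arc: consecutive arcs of an alternating walk share their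
    tail or their head. *)
Lemma Arel_closure (P : V -> V -> Prop) x0 y0 x y :
  Arel E (x0, y0) (x, y) -> P x0 y0 ->
  (forall a b b', E a b -> E a b' -> P a b -> P a b') ->
  (forall a b a', E a b -> E a' b -> P a b -> P a' b) -> P x y.
Proof.
  intros [b [u [w [l [Hw [H1 H2]]]]]] H0 Ht Hh.
  assert (Hs : P (fst (step_arc b u w)) (snd (step_arc b u w))) by (rewrite H1; auto).
  clear H1 H0. revert b u w Hw H2 Hs.
  induction l as [|z l IH]; intros b u w Hw H2 Hs.
  - simpl in H2. injection H2 as H2. rewrite H2 in Hs. auto.
  - destruct Hw as [Huw Hw]. apply (IH (negb b) w z Hw H2).
    destruct Hw as [Hwz _]. destruct b; simpl in *.
    + apply Hh with u; auto.
    + apply Ht with u; auto.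
Qed.

Lemma alt_walk_extend l : forall b u w x y,
  alt_walk E b u (w :: l) -> last_arc b u (w :: l) = Some (x, y) ->
  (forall y', E x y' -> exists l', alt_walk E b u (w :: l') /\
                          last_arc b u (w :: l') = Some (x, y')) /\
  (forall x', E x' y -> exists l', alt_walk E b u (w :: l') /\
                          last_arc b u (w :: l') = Some (x', y)).
Proof.
  induction l as [|z l IH]; intros b u w x y Hw Hl.
  - simpl in Hl. destruct Hw as [Hw _]. destruct b; simpl in *; injection Hl as <- <-; split.
    + intros y' H. exists [u; y']. simpl. auto.
    + intros x' H. exists [x']. simpl. auto.
    + intros y' H. exists [y']. simpl. auto.
    + intros x' H. exists [u; x']. simpl. auto.
  - destruct Hw as [Huw Hw]. destruct (IH (negb b) w z x y Hw Hl) as [H1 H2]. split.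
    + intros y' H. destruct (H1 y' H) as [l' [W L]]. exists (z :: l'). split; [split|]; auto.
    + intros x' H. destruct (H2 x' H) as [l' [W L]]. exists (z :: l'). split; [split|]; auto.
Qed.

Lemma Arel_refl x y : E x y -> Arel E (x, y) (x, y).
Proof. intros H. exists true, x, y, []. simpl. auto. Qed.

Lemma Arel_tail e x y y' : Arel E e (x, y) -> E x y' -> Arel E e (x, y').
Proof.
  intros [b [u [w [l [H1 [H2 H3]]]]]] H.
  destruct (alt_walk_extend l b u w x y H1 H3) as [Ha _].
  destruct (Ha y' H) as [l' [W L]]. exists b, u, w, l'. auto.
Qed.

Lemma Arel_head e x y x' : Arel E e (x, y) -> E x' y -> Arel E e (x', y).
Proof.
  intros [b [u [w [l [H1 [H2 H3]]]]]] H.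
  destruct (alt_walk_extend l b u w x y H1 H3) as [_ Ha].
  destruct (Ha x' H) as [l' [W L]]. exists b, u, w, l'. auto.
Qed.

Lemma Arel_arc x0 y0 x y : Arel E (x0, y0) (x, y) -> E x0 y0 /\ E x y.
Proof.
  intros H. assert (H0 : E x0 y0).
  { destruct H as [b [u [w [l [[H1 _] [H2 _]]]]]]. destruct b; injection H2 as <- <-; auto. }
  split; auto. apply (Arel_closure E x0 y0 x y H); auto.
Qed.

Lemma Arel_trans e x1 y1 e' : Arel E e (x1, y1) -> Arel E (x1, y1) e' -> Arel E e e'.
Proof.
  destruct e' as [x2 y2]. intros H1 H2.
  apply (Arel_closure (fun x y => Arel E e (x, y)) x1 y1); auto.
  - intros a b b' _ Hb. intros; eapply Arel_tail; eauto.
  - intros a b b' _ Hb. intros; eapply Arel_head; eauto.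
Qed.

Lemma Arel_sym x0 y0 x y : Arel E (x0, y0) (x, y) -> Arel E (x, y) (x0, y0).
Proof.
  intros H. destruct (Arel_arc _ _ _ _ H) as [H0 _].
  apply (Arel_closure (fun a b => Arel E (a, b) (x0, y0)) x0 y0 x y H).
  - apply Arel_refl; auto.
  - intros a b b' Hb Hb' Hr. apply Arel_trans with a b; auto.
    apply Arel_tail with b'; auto. apply Arel_refl; auto.
  - intros a b a' Ha Ha' Hr. apply Arel_trans with a b; auto.
    apply Arel_head with a'; auto. apply Arel_refl; auto.
Qed.

End Reachability.

(** * Digraphs with a tree-like metric *)

(** The four-point condition of subsets of trees; the triangle inequality is the case of two equal
    points. Distinct vertices may have distance 0. *)
Definition tree_like {V : Type} (E : V -> V -> Prop) (d : V -> V -> nat) : Prop :=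
  (forall u, d u u = 0) /\ (forall u v, d u v = d v u) /\
  (forall u v w x, d u v + d w x <= Nat.max (d u w + d v x) (d u x + d v w)).

Fixpoint steps {V : Type} (E : V -> V -> Prop) (n : nat) (x y : V) : Prop :=
  match n with
  | 0 => x = y
  | S n => exists z, steps E n x z /\ E z y
  end.

Lemma steps_app {V : Type} (E : V -> V -> Prop) m n x y z :
  steps E m x y -> steps E n y z -> steps E (m + n) x z.
Proof.
  intros H. revert z. induction n as [|n IH]; intros z Hz; simpl in *.
  - subst. rewrite Nat.add_0_r. auto.
  - destruct Hz as [w [Hw Hz]]. rewrite Nat.add_succ_r. exists w. auto.
Qed.

Lemma steps_split {V : Type} (E : V -> V -> Prop) m n x z :
  steps E (m + n) x z -> exists y, steps E m x y /\ steps E n y z.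
Proof.
  revert z. induction n as [|n IH]; intros z Hz.
  - rewrite Nat.add_0_r in Hz. exists z. simpl. auto.
  - rewrite Nat.add_succ_r in Hz. destruct Hz as [w [Hw Hz]].
    destruct (IH w Hw) as [y [H1 H2]]. exists y. split; auto. exists w; auto.
Qed.

Lemma dpath_steps {V : Type} (E : V -> V -> Prop) l : forall x d i j,
  dpath E x l -> i <= j -> j <= length l -> steps E (j - i) (nth i (x :: l) d) (nth j (x :: l) d).
Proof.
  assert (H0 : forall l x d j, dpath E x l -> j <= length l -> steps E j x (nth j (x :: l) d)).
  { clear l. induction l as [|y l IH]; intros x d j H Hj.
    - simpl in Hj. replace j with 0 by lia. simpl. auto.
    - destruct j as [|j]; [simpl; auto|]. destruct H as [H1 H2].
      change (S j) with (1 + j). apply steps_app with y; [exists x; simpl; auto|].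
      apply (IH y d j H2). simpl in Hj. lia. }
  induction l as [|y l IH]; intros x d i j H Hij Hj.
  - simpl in Hj. replace i with 0 by lia. replace j with 0 by lia. simpl. auto.
  - destruct i as [|i].
    + rewrite Nat.sub_0_r. apply H0; auto.
    + destruct j as [|j]; [lia|]. apply (IH y d i j); simpl in *; try lia. apply H.
Qed.

Section Metric.
Context {V : Type} (E : V -> V -> Prop) (d : V -> V -> nat) (k delta : nat).
Hypothesis Hd : tree_like E d.
Hypothesis Hk0 : 0 < k.
Hypothesis Hk : forall x y, E x y -> d x y = k.
Hypothesis Hdelta0 : 0 < delta.
Hypothesis Hdelta : forall x y z, E x y -> E y z -> d x z = k + delta.

Lemma tl_refl u : d u u = 0. Proof. apply Hd. Qed.
Lemma tl_sym u v : d u v = d v u. Proof. apply Hd. Qed.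
Lemma tl_four u v w x : d u v + d w x <= Nat.max (d u w + d v x) (d u x + d v w).
Proof. apply Hd. Qed.
Lemma tl_triangle u v w : d u w <= d u v + d v w.
Proof.
  pose proof (tl_four u w v v). rewrite tl_refl, (tl_sym w v) in H. lia.
Qed.

(** Let [w], [z], [y] be the last three vertices. Among the three sums of the four-point condition
    for [x], [w], [z], [y], the sum of d(x, w) and d(z, y) is strictly smallest, so the other two
    are equal, and one of them contains the unknown distance. *)
Lemma steps_dist n : forall x y, steps E (S n) x y -> d x y = k + n * delta.
Proof.
  induction n as [n IH] using lt_wf_ind. intros x y [z [Hz Hzy]].
  destruct n as [|n].
  { simpl in Hz. subst z. rewrite (Hk _ _ Hzy). lia. }
  pose proof (IH n ltac:(lia) x z Hz) as Dz.
  destruct Hz as [w [Hw Hwz]].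
  pose proof (Hdelta _ _ _ Hwz Hzy). pose proof (Hk _ _ Hwz). pose proof (Hk _ _ Hzy).
  destruct n as [|n].
  { simpl in Hw. subst w. lia. }
  pose proof (IH n ltac:(lia) x w Hw) as Dw.
  pose proof (tl_four x z w y). pose proof (tl_four x y w z).
  rewrite (tl_sym y w), (tl_sym z w), ?(tl_sym y z) in *. simpl in *. lia.
Qed.

Lemma steps_acyclic n x : ~ steps E (S n) x x.
Proof. intros H. apply steps_dist in H. rewrite tl_refl in H. lia. Qed.

(** Adjacency gives distance [k], and [k + (n - 1) * delta] equals [k] only for one step. *)
Lemma steps_chordless n x y : steps E n x y -> adjU E x y -> n = 1.
Proof.
  intros H Hxy.
  assert (D : d x y = k) by (destruct Hxy; [|rewrite tl_sym]; auto).
  destruct n as [|n].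
  - simpl in H. subst y. rewrite tl_refl in D. lia.
  - apply steps_dist in H. assert (n * delta = 0) by lia.
    apply Nat.mul_eq_0 in H0. lia.
Qed.

Lemma steps_det n m x y : steps E n x y -> steps E m x y -> n = m.
Proof.
  intros H1 H2. destruct n as [|n], m as [|m]; auto.
  - simpl in H1. subst. exfalso. eapply steps_acyclic; eauto.
  - simpl in H2. subst. exfalso. eapply steps_acyclic; eauto.
  - apply steps_dist in H1, H2. nia.
Qed.

(** The values [sigma] and [2 * k - sigma] balance in the four-point condition. When the head b of
    an arc (a, b) is replaced by b', the sum of d(b', x0) and [k] is at most the larger of [k + k]
    and [sigma + (2 * k - sigma)], so the bound [k] reproduces itself, and likewise the others. *)
Lemma class_bounded sigma x0 y0 x y :
  sigma <= 2 * k ->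
  (forall v w w', E v w -> E v w' -> d w w' <= sigma) ->
  (forall v w w', E w v -> E w' v -> d w w' <= 2 * k - sigma) ->
  Arel E (x0, y0) (x, y) ->
  d x x0 <= 2 * k - sigma /\ d x y0 <= k /\ d y x0 <= k /\ d y y0 <= sigma.
Proof.
  intros Hs H1 H2 HA. destruct (Arel_arc E _ _ _ _ HA) as [H0 _].
  apply (Arel_closure E (fun x y => d x x0 <= 2 * k - sigma /\ d x y0 <= k /\
           d y x0 <= k /\ d y y0 <= sigma) x0 y0 x y HA).
  - rewrite !tl_refl, (tl_sym y0 x0), (Hk _ _ H0). lia.
  - intros a b b' Hb Hb' [A1 [A2 [A3 A4]]].
    pose proof (Hk _ _ Hb). pose proof (Hk _ _ Hb'). pose proof (H1 _ _ _ Hb Hb').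
    pose proof (tl_four b' x0 a b). pose proof (tl_four b' y0 a b).
    rewrite (tl_sym x0 b), (tl_sym y0 b), (tl_sym b' a), (tl_sym b' b),
      (tl_sym x0 a), (tl_sym y0 a) in *. lia.
  - intros a b a' Ha Ha' [A1 [A2 [A3 A4]]].
    pose proof (Hk _ _ Ha). pose proof (Hk _ _ Ha'). pose proof (H2 _ _ _ Ha Ha').
    pose proof (tl_four a' x0 a b). pose proof (tl_four a' y0 a b).
    rewrite (tl_sym x0 b), (tl_sym y0 b), (tl_sym a' a),
      (tl_sym x0 a), (tl_sym y0 a) in *. lia.
Qed.

(* Non-backtracking alternating walks leaving [r] through an arc into [r];
   the flag records whether the last step followed its arc. *)
Inductive nbwalk (r : V) : bool -> V -> V -> Prop :=
| nbwalk_start w : E w r -> nbwalk r false r w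
| nbwalk_fwd u v w : nbwalk r false u v -> E v w -> w <> u -> nbwalk r true v w
| nbwalk_bwd u v w : nbwalk r true u v -> E w v -> w <> u -> nbwalk r false v w.

(** Passing to an arc with the same tail or head prolongs the walk, replaces its last step, or
    undoes it. *)
Lemma nbwalk_class x0 r x y :
  Arel E (x0, r) (x, y) -> nbwalk r false y x \/ nbwalk r true x y.
Proof.
  intros HA. destruct (Arel_arc E _ _ _ _ HA) as [H0 _].
  apply (Arel_closure E (fun x y => nbwalk r false y x \/ nbwalk r true x y) x0 r x y HA).
  - left. apply nbwalk_start; auto.
  - intros a b b' Hb Hb' [H|H].
    + destruct (classic (b' = b)) as [->|Hne]; auto. right. eapply nbwalk_fwd; eauto.
    + inversion H as [|u v w Hu Hvw Hne|]; subst.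
      destruct (classic (b' = u)) as [->|Hne']; auto. right. eapply nbwalk_fwd; eauto.
  - intros a b a' Ha Ha' [H|H].
    + inversion H as [w Hw| |u v w Hu Hvw Hne]; subst.
      * left. apply nbwalk_start; auto.
      * destruct (classic (a' = u)) as [->|Hne']; auto. left. eapply nbwalk_bwd; eauto.
    + destruct (classic (a' = a)) as [->|Hne]; auto. left. eapply nbwalk_bwd; eauto.
Qed.

Section Siblings.
Variables ap am : nat.
Hypothesis Hap : forall v w w', E v w -> E v w' -> w <> w' -> d w w' = ap.
Hypothesis Ham : forall v w w', E w v -> E w' v -> w <> w' -> d w w' = am.
Hypothesis Hin : forall v, exists u, E u v.
Hypothesis Hout : forall v, exists w, E v w.

Lemma ap_le : (exists v w w', E v w /\ E v w' /\ w <> w') -> ap <= k + delta.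
Proof.
  intros [v [w [w' [H1 [H2 H3]]]]]. destruct (Hin v) as [u Hu].
  rewrite <- (Hap v w w' H1 H2 H3).
  pose proof (tl_four w w' u v). rewrite (tl_sym w u), (tl_sym w' u), (tl_sym w v), (tl_sym w' v) in *.
  rewrite (Hk _ _ H1), (Hk _ _ H2), (Hk _ _ Hu), (Hdelta _ _ _ Hu H1), (Hdelta _ _ _ Hu H2) in *. lia.
Qed.

Lemma am_le : (exists v w w', E w v /\ E w' v /\ w <> w') -> am <= k + delta.
Proof.
  intros [v [w [w' [H1 [H2 H3]]]]]. destruct (Hout v) as [u Hu].
  rewrite <- (Ham v w w' H1 H2 H3).
  pose proof (tl_four w w' u v). rewrite (tl_sym u v) in *.
  rewrite (Hk _ _ H1), (Hk _ _ H2), (Hk _ _ Hu), (Hdelta _ _ _ H1 Hu), (Hdelta _ _ _ H2 Hu) in *. lia.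
Qed.

Lemma delta_le : (exists v : V, True) -> delta <= k.
Proof.
  intros [v _]. destruct (Hin v) as [u Hu], (Hout v) as [w Hw].
  pose proof (tl_triangle u v w). rewrite (Hdelta _ _ _ Hu Hw), (Hk _ _ Hu), (Hk _ _ Hw) in *. lia.
Qed.

(** Since [2 * k < ap + am], the overlaps of an arc with its two neighbours in the walk do not cover
    it. The middle inequality expresses this surplus as seen from [z]: it decides which sum in the
    four-point condition is largest and so passes to the next step. The bounds by [k + delta] are
    what the first step, into [r] backwards, requires. *)
Lemma nbwalk_dist r z : E r z -> 2 * k < ap + am -> ap <= k + delta -> am <= k + delta ->
  delta <= k ->
  forall b u v, nbwalk r b u v ->
    0 < d z v /\ d z u + k < d z v + (if b then am else ap) /\ (if b then E u v else E v u).
Proof.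
  intros Hz Hlt Hp Hm Hdk b u v H.
  induction H as [w Hw|u v w _ [P [I A]] Hvw Hne|u v w _ [P [I A]] Hvw Hne].
  - rewrite (tl_sym z w), (tl_sym z r), (Hdelta _ _ _ Hw Hz), (Hk _ _ Hz).
    split; [lia|]. split; [lia|auto].
  - pose proof (Hap _ _ _ A Hvw (fun e => Hne (eq_sym e))).
    pose proof (tl_four z w u v). pose proof (tl_four z v u w). pose proof (tl_four z u v w).
    rewrite (tl_sym w u), (tl_sym w v), (tl_sym u v), (Hk _ _ Hvw), (Hk _ _ A) in *.
    split; [|split]; auto; lia.
  - pose proof (Ham _ _ _ A Hvw (fun e => Hne (eq_sym e))).
    pose proof (tl_four z w u v). pose proof (tl_four z v u w). pose proof (tl_four z u v w).
    rewrite (tl_sym w u), (tl_sym v w), (tl_sym v u), (Hk _ _ Hvw), (Hk _ _ A) in *.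
    split; [|split]; auto; lia.
Qed.

(** The arc from [r] to [z] continues the base arc. If [class_bounded] applies, [y] is within [k] of
    [x0], whereas [y = z] would lie at [k + delta] and [x = z] would put [y] three directed steps
    from [x0]. The parameter [sigma] is 0 without out-siblings, [2 * k] without in-siblings, and
    [ap] if [ap + am <= 2 * k]. In the remaining case a non-backtracking walk from [r] stays away
    from [z]. *)
Lemma class_avoids x0 r z x y :
  E r z -> Arel E (x0, r) (x, y) -> x <> z /\ y <> z.
Proof.
  intros Hz HA. destruct (Arel_arc E _ _ _ _ HA) as [H0 Hxy].
  assert (Hbd : forall sigma, sigma <= 2 * k ->
    (forall v w w', E v w -> E v w' -> d w w' <= sigma) ->
    (forall v w w', E w v -> E w' v -> d w w' <= 2 * k - sigma) -> x <> z /\ y <> z).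
  { intros sigma Hs H1 H2.
    destruct (class_bounded sigma x0 r x y Hs H1 H2 HA) as [_ [_ [B _]]].
    rewrite tl_sym in B. split; intros ->.
    - assert (St : steps E 3 x0 y).
      { exists z. split; auto. exists r. split; auto. exists x0. simpl. auto. }
      apply steps_dist in St. lia.
    - rewrite (Hdelta _ _ _ H0 Hz) in B. lia. }
  assert (T2 : forall v w w', adjU E v w -> adjU E v w' -> d w w' <= 2 * k).
  { assert (K : forall v w, adjU E v w -> d v w = k).
    { intros v w [H|H]; [|rewrite tl_sym]; auto. }
    intros v w w' H1 H2. pose proof (tl_triangle w v w').
    rewrite (tl_sym w v), (K _ _ H1), (K _ _ H2) in *. lia. }
  destruct (classic (exists v w w', E v w /\ E v w' /\ w <> w')) as [Sp|Np].
  2:{ apply (Hbd 0); [lia| |].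
      - intros v w w' H1 H2. destruct (classic (w = w')) as [->|Hne]; [rewrite tl_refl; auto|].
        exfalso; eauto 8.
      - intros v w w' H1 H2. rewrite Nat.sub_0_r. apply T2 with v; right; auto. }
  destruct (classic (exists v w w', E w v /\ E w' v /\ w <> w')) as [Sm|Nm].
  2:{ apply (Hbd (2 * k)); [lia| |].
      - intros v w w' H1 H2. apply T2 with v; left; auto.
      - intros v w w' H1 H2. destruct (classic (w = w')) as [->|Hne]; [rewrite tl_refl; lia|].
        exfalso; eauto 8. }
  pose proof (ap_le Sp) as Lp. pose proof (am_le Sm) as Lm.
  pose proof (delta_le (ex_intro _ x I)) as Ld.
  destruct (le_lt_dec (ap + am) (2 * k)) as [Hle|Hlt].
  { apply (Hbd ap); [lia| |].
    - intros v w w' H1 H2. destruct (classic (w = w')) as [->|Hne]; [rewrite tl_refl; lia|].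
      rewrite (Hap v w w'); auto.
    - intros v w w' H1 H2. destruct (classic (w = w')) as [->|Hne]; [rewrite tl_refl; lia|].
      rewrite (Ham v w w'); auto. lia. }
  pose proof (nbwalk_dist r z Hz Hlt Lp Lm Ld) as ND.
  assert (Hnz : forall b u v, nbwalk r b u v -> v <> z).
  { intros b u v H ->. apply ND in H. rewrite tl_refl in H. lia. }
  assert (Hrz : r <> z).
  { intros ->. pose proof (Hk _ _ Hz). rewrite tl_refl in *. lia. }
  destruct (nbwalk_class x0 r x y HA) as [H|H].
  - split; [eapply Hnz; eauto|]. inversion H; subst; auto. eapply Hnz; eauto.
  - split; [|eapply Hnz; eauto]. inversion H; subst; auto. eapply Hnz; eauto.
Qed.

End Siblings.
End Metric.

(** * The tree metric of a homogeneous digraph *)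

Section Homogeneous.
Context {V : Type} (E : V -> V -> Prop).
Hypothesis HD : is_digraph E.
Hypothesis Hconn : connected E.
Hypothesis Hlf : locally_finite E.
Hypothesis Htf : triangle_free E.
Hypothesis Hch : conn_hom E.

Lemma vertex_transitive x y : exists g, is_aut E g /\ g x = y.
Proof.
  destruct (conn_hom_piso E [(x, y)] Hch) as [g [Hg H]].
  - intros p q [<-|[]] [<-|[]]. simpl. pose proof (proj1 HD x). pose proof (proj1 HD y). tauto.
  - apply induced_connected_single.
  - exists g. split; auto. apply (H (x, y)). left; auto.
Qed.

Lemma arc_transitive x y x' y' : E x y -> E x' y' -> exists g, is_aut E g /\ g x = x' /\ g y = y'.
Proof.
  intros H H'. destruct HD as [Irr Anti].
  destruct (conn_hom_piso E [(x, x'); (y, y')] Hch) as [g [Hg HM]].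
  - assert (x <> y) by (intros ->; eapply Irr; eauto).
    assert (x' <> y') by (intros ->; eapply Irr; eauto).
    pose proof (Anti _ _ H). pose proof (Anti _ _ H').
    pose proof (Irr x). pose proof (Irr y). pose proof (Irr x'). pose proof (Irr y').
    intros p q [<-|[<-|[]]] [<-|[<-|[]]]; simpl; intuition congruence.
  - apply induced_connected_cons with y.
    + apply induced_connected_single.
    + left; auto.
    + left; auto.
  - exists g. split; auto. split; [apply (HM (x, x'))|apply (HM (y, y'))]; simpl; auto.
Qed.

(** The ends are non-adjacent by triangle-freeness, so the three vertices induce just the path; by
    antisymmetry the two equivalences settle its orientation. *)
Lemma two_path_transitive v u w v' u' w' :
  adjU E v u -> adjU E v w -> u <> w -> adjU E v' u' -> adjU E v' w' -> u' <> w' ->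
  (E v u <-> E v' u') -> (E v w <-> E v' w') ->
  exists g, is_aut E g /\ g v = v' /\ g u = u' /\ g w = w'.
Proof.
  intros A1 A2 N A1' A2' N' O1 O2. destruct HD as [Irr Anti].
  assert (Nv : forall a b, adjU E a b -> a <> b) by (intros a b [H|H] ->; eapply Irr; eauto).
  assert (Na : ~ adjU E u w) by (intros H; apply (Htf v u w); auto).
  assert (Na' : ~ adjU E u' w') by (intros H; apply (Htf v' u' w'); auto).
  assert (O1' : E u v <-> E u' v').
  { pose proof (Anti u v). pose proof (Anti u' v'). unfold adjU in *. tauto. }
  assert (O2' : E w v <-> E w' v').
  { pose proof (Anti w v). pose proof (Anti w' v'). unfold adjU in *. tauto. }
  destruct (conn_hom_piso E [(u, u'); (w, w'); (v, v')] Hch) as [g [Hg HM]].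
  - pose proof (Nv _ _ A1). pose proof (Nv _ _ A2). pose proof (Nv _ _ A1'). pose proof (Nv _ _ A2').
    pose proof (Irr u). pose proof (Irr v). pose proof (Irr w).
    pose proof (Irr u'). pose proof (Irr v'). pose proof (Irr w').
    apply not_or_and in Na, Na'.
    intros p q [<-|[<-|[<-|[]]]] [<-|[<-|[<-|[]]]]; simpl; clear Anti Nv Irr Hch Htf Hlf Hconn;
      (split; [split; intros; solve [auto | exfalso; congruence]|]); tauto.
  - apply induced_connected_cons with v; [|simpl; auto|apply adjU_sym; auto].
    apply induced_connected_cons with v; [|simpl; auto|apply adjU_sym; auto].
    apply induced_connected_single.
  - exists g. split; auto.
    split; [apply (HM (v, v'))|split; [apply (HM (u, u'))|apply (HM (w, w'))]]; simpl; auto.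
Qed.

Hypothesis Hends : more_than_one_end E.

Lemma arc_exists : exists x y, E x y.
Proof.
  destruct Hends as [r [_ [[_ Hr] _]]]. destruct (Hr 0); eauto.
Qed.

Lemma out_neighbour v : exists w, E v w.
Proof.
  destruct arc_exists as [x [y Hxy]]. destruct (vertex_transitive x v) as [g [[_ Hg] <-]].
  exists (g y). apply (proj1 (Hg x y)); auto.
Qed.

Lemma in_neighbour v : exists u, E u v.
Proof.
  destruct arc_exists as [x [y Hxy]]. destruct (vertex_transitive y v) as [g [[_ Hg] <-]].
  exists (g x). apply (proj1 (Hg x y)); auto.
Qed.

Lemma infcut_exists : exists C, infcut E C.
Proof. apply many_ends_infcut; auto. Qed.

Definition finite_parallel (d : V -> V -> nat) : Prop :=
  forall x0 y0, finite_set (fun p => E (fst p) (snd p) /\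
    d (fst p) x0 + d (snd p) y0 < d (fst p) y0 + d (snd p) x0).

Theorem tree_metric_exists : exists (d : V -> V -> nat) (k delta ap am : nat),
  tree_like E d /\ finite_parallel d /\ 0 < k /\ 0 < delta /\
  (forall x y, E x y -> d x y = k) /\
  (forall x y z, E x y -> E y z -> d x z = k + delta) /\
  (forall v w w', E v w -> E v w' -> w <> w' -> d w w' = ap) /\
  (forall v w w', E w v -> E w' v -> w <> w' -> d w w' = am).
Proof.
  pose proof infcut_exists as Hcut. set (d := cut_dist E).
  assert (Hd : tree_like E d).
  { split; [|split].
    - intros u. apply cut_dist_refl.
    - intros u v. apply cut_dist_sym; auto.
    - intros u v w x. apply cut_dist_four_point; auto. }
  assert (Haut : forall g u v, is_aut E g -> d (g u) (g v) = d u v).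
  { intros g u v Hg. apply cut_dist_aut; auto. }
  assert (Hsym : forall u v, d u v = d v u) by apply Hd.
  assert (H4 : forall u v w x, d u v + d w x <= Nat.max (d u w + d v x) (d u x + d v w)) by apply Hd.
  destruct arc_exists as [x0 [y0 H0]].
  set (k := d x0 y0).
  assert (Hk : forall x y, E x y -> d x y = k).
  { intros x y H. destruct (arc_transitive x0 y0 x y H0 H) as [g [Hg [<- <-]]].
    apply Haut; auto. }
  assert (HkU : forall x y, adjU E x y -> d x y = k).
  { intros x y [H|H]; [|rewrite Hsym]; auto. }
  destruct (cut_dist_separated E Hconn Hcut) as [v [w [v' [w' [A1 [A2 [A3 [K0 Hlt]]]]]]]].
  fold d in K0, Hlt. rewrite (HkU _ _ A1) in K0.
  rewrite (HkU _ _ A1), (HkU _ _ A2), (HkU _ _ A3) in Hlt.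
  destruct (out_neighbour y0) as [z0 Hz0].
  assert (HDD : forall x y z, E x y -> E y z -> d x z = d x0 z0).
  { intros x y z Hx Hz.
    assert (N : forall a b c, E a b -> E b c -> a <> c).
    { intros a b c Ha Hb ->. apply (proj2 HD _ _ Ha Hb). }
    destruct (two_path_transitive y0 x0 z0 y x z) as [g [Hg [_ [<- <-]]]]; eauto.
    - right; auto.
    - left; auto.
    - right; auto.
    - left; auto.
    - pose proof (proj2 HD _ _ H0). pose proof (proj2 HD _ _ Hx). tauto.
    - tauto. }
  assert (Hbig : k < d x0 z0).
  { destruct (le_lt_dec (d x0 z0) k) as [Hle|]; auto. exfalso.
    (* Two arcs with a common head or tail [b]: a further arc at [b] forms a directed two-path with
       each of them, and the four-point condition bounds the remaining distance by [k]. *)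
    assert (H2 : forall a b c, adjU E a b -> adjU E b c -> d a c <= k).
    { intros a b c Hab Hbc. destruct Hab as [Hab|Hab], Hbc as [Hbc|Hbc].
      - rewrite (HDD a b c); auto.
      - destruct (out_neighbour b) as [e He]. pose proof (H4 a c e b).
        rewrite (Hsym e b), (Hk _ _ He), (Hk _ _ Hab), (Hk _ _ Hbc),
          (HDD _ _ _ Hab He), (HDD _ _ _ Hbc He) in *. lia.
      - destruct (in_neighbour b) as [e He]. pose proof (H4 a c e b).
        rewrite (Hsym a e), (Hsym c e), (Hsym a b), (Hsym c b), (Hk _ _ He), (Hk _ _ Hab), (Hk _ _ Hbc),
          (HDD _ _ _ He Hab), (HDD _ _ _ He Hbc) in *. lia.
      - rewrite Hsym, (HDD c b a); auto. }
    (* The invariant includes the neighbours of the current vertex: the distance from [z] to the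
       next vertex [c] is bounded through the two preceding ones. The result contradicts the pair
       [v'], [w'] of [cut_dist_separated]. *)
    assert (Hall : forall z x, d z x <= k).
    { intros z x. cut (d z x <= k /\ forall y, adjU E x y -> d z y <= k); [tauto|].
      apply (conn_invariant E (fun _ => True)
        (fun x => d z x <= k /\ forall y, adjU E x y -> d z y <= k) z x).
      - apply Hconn; auto.
      - split; [rewrite (proj1 Hd); lia|]. intros y Hy. rewrite (HkU _ _ Hy). auto.
      - intros a b _ _ Hab [I1 I2]. split; auto. intros c Hc.
        pose proof (H4 z c a b). rewrite (HkU _ _ Hab), (Hsym c b), (HkU _ _ Hc) in *.
        pose proof (I2 b Hab). pose proof (H2 _ _ _ Hab Hc). rewrite (Hsym c a) in *. lia. }
    specialize (Hall v' w'). lia. }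
  assert (Hap : exists ap, forall v w w', E v w -> E v w' -> w <> w' -> d w w' = ap).
  { destruct (classic (exists v w w', E v w /\ E v w' /\ w <> w')) as [[a [b [c [H1 [H2 H3]]]]]|N].
    - exists (d b c). intros a' b' c' H1' H2' H3'.
      destruct (two_path_transitive a b c a' b' c') as [g [Hg [_ [<- <-]]]]; try (left; auto); auto;
      tauto.
    - exists 0. intros a b c H1 H2 H3. exfalso; eauto 8. }
  assert (Ham : exists am, forall v w w', E w v -> E w' v -> w <> w' -> d w w' = am).
  { destruct (classic (exists v w w', E w v /\ E w' v /\ w <> w')) as [[a [b [c [H1 [H2 H3]]]]]|N].
    - exists (d b c). intros a' b' c' H1' H2' H3'.
      destruct (two_path_transitive a b c a' b' c') as [g [Hg [_ [<- <-]]]]; try (right; auto); auto;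
      [pose proof (proj2 HD _ _ H1); pose proof (proj2 HD _ _ H1'); tauto|
       pose proof (proj2 HD _ _ H2); pose proof (proj2 HD _ _ H2'); tauto].
    - exists 0. intros a b c H1 H2 H3. exfalso; eauto 8. }
  destruct Hap as [ap Hap], Ham as [am Ham].
  exists d, k, (d x0 z0 - k), ap, am. split; auto. split.
  { intros a b. apply finite_sub with (2 := cut_dist_finite_parallel E Hconn Hcut a b).
    intros p [Hp Hl]. split; auto. left; auto. }
  split; auto. split; [lia|]. split; auto. split; auto.
  intros x y z Hx Hz. rewrite (HDD x y z Hx Hz). lia.
Qed.

Theorem highly_arc_transitive_of_homogeneous : highly_arc_transitive E.
Proof.
  destruct tree_metric_exists as [d [k [delta [ap [am [Hd [_ [Hk0 [Hd0 [Hk [Hdelta _]]]]]]]]]]].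
  intros n x l x' l' Hl Hl' P P'.
  (* Along a directed path, positions determine equality and adjacency: there is no repetition and
     no chord. So matching positions of two paths of equal length is a partial isomorphism. *)
  assert (HE : forall x l i j, dpath E x l -> i <= length l -> j <= length l ->
    (nth i (x :: l) x = nth j (x :: l) x <-> i = j) /\
    (E (nth i (x :: l) x) (nth j (x :: l) x) <-> j = S i)).
  { clear - Hd Hk0 Hd0 Hk Hdelta HD. intros x l i j P Hi Hj.
    assert (Hij : forall i j, i <= j -> j <= length l ->
      steps E (j - i) (nth i (x :: l) x) (nth j (x :: l) x)).
    { intros i' j' H1 H2. apply dpath_steps; auto. }
    split; split.
    - intros He. destruct (lt_eq_lt_dec i j) as [[H|H]|H]; auto; exfalso.
      + specialize (Hij i j ltac:(lia) Hj). rewrite He in Hij.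
        replace (j - i) with (S (j - i - 1)) in Hij by lia.
        eapply (steps_acyclic E d k delta); eauto.
      + specialize (Hij j i ltac:(lia) Hi). rewrite He in Hij.
        replace (i - j) with (S (i - j - 1)) in Hij by lia.
        eapply (steps_acyclic E d k delta); eauto.
    - intros ->; auto.
    - intros He. destruct (le_lt_dec i j) as [H|H].
      + specialize (Hij i j H Hj). apply (steps_chordless E d k delta) in Hij; auto; [lia|left; auto].
      + specialize (Hij j i ltac:(lia) Hi).
        assert (Hc : steps E (S (i - j)) (nth j (x :: l) x) (nth j (x :: l) x)).
        { exists (nth i (x :: l) x). auto. }
        exfalso. eapply (steps_acyclic E d k delta); eauto.
    - intros ->. specialize (Hij i (S i) ltac:(lia) Hj). replace (S i - i) with 1 in Hij by lia.
      destruct Hij as [z [Hz Hzy]]. unfold steps in Hz. rewrite Hz. auto. }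
  destruct (conn_hom_piso E (combine (x :: l) (x' :: l')) Hch) as [g [Hg HM]].
  - assert (Hin : forall p, In p (combine (x :: l) (x' :: l')) ->
      exists i, i <= length l /\ fst p = nth i (x :: l) x /\ snd p = nth i (x' :: l') x').
    { intros p Hp. destruct (In_nth _ _ (x, x') Hp) as [i [Hi Hn]].
      rewrite combine_nth in Hn by (simpl; lia). rewrite length_combine in Hi. simpl length in Hi.
      exists i. rewrite <- Hn. simpl fst. simpl snd. split; [lia|auto]. }
    intros p q Hp Hq. destruct (Hin p Hp) as [i [Hi [-> ->]]], (Hin q Hq) as [j [Hj [-> ->]]].
    destruct (HE x l i j P Hi Hj) as [-> ->].
    destruct (HE x' l' i j P' ltac:(lia) ltac:(lia)) as [-> ->]. tauto.
  - assert (Hm : map fst (combine (x :: l) (x' :: l')) = x :: l).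
    { assert (Hlen : length (x :: l) = length (x' :: l')) by (simpl; lia). revert Hlen.
      generalize (x' :: l') as b. generalize (x :: l) as a. clear.
      induction a as [|y a IH]; intros [|y' b] Hlen; try discriminate; auto.
      simpl. f_equal. apply IH. simpl in Hlen. lia. }
    rewrite Hm. clear - P. revert x P. induction l as [|y l IH]; intros x P.
    + apply induced_connected_single.
    + destruct P as [P1 P2]. apply induced_connected_cons with y; [apply IH; auto| |].
      * left; auto.
      * left; auto.
  - exists g. split; auto. split; [apply (HM (x, x')); left; auto|].
    assert (HM' : forall p, In p (combine l l') -> g (fst p) = snd p).
    { intros p Hp. apply HM. right; auto. }
    clear - HM' Hl Hl'. subst n. revert l' Hl' HM'. induction l as [|y l IH]; intros [|y' l'] Hl' HM';
      try discriminate; auto.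
    simpl. f_equal.
    + apply (HM' (y, y')). left; auto.
    + apply IH; [simpl in Hl'; lia|]. intros p Hp. apply HM'. right; auto.
Qed.

Lemma class_bipartite x0 y0 v w u : Arel E (x0, y0) (v, w) -> ~ Arel E (x0, y0) (w, u).
Proof.
  destruct tree_metric_exists as
    [d [k [delta [ap [am [Hd [_ [Hk0 [Hd0 [Hk [Hdelta [Hap Ham]]]]]]]]]]]].
  intros H1 H2. assert (H : Arel E (v, w) (w, u)).
  { apply Arel_trans with x0 y0; auto. apply Arel_sym; auto. }
  destruct (class_avoids E d k delta Hd Hk0 Hk Hd0 Hdelta ap am Hap Ham in_neighbour out_neighbour
    v w u w u) as [_ N]; auto.
  apply (Arel_arc E _ _ _ _ H2).
Qed.

Lemma reachability_not_universal : ~ A_universal E.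
Proof.
  intros HU. destruct arc_exists as [x [y Hxy]]. destruct (out_neighbour y) as [z Hz].
  apply (class_bipartite x y x y z).
  - apply Arel_refl; auto.
  - apply HU; auto.
Qed.

(** If [v] is a tail or [w] is a head of the class, an alternating walk is prolonged. The remaining
    case, an arc from a head to a tail, is a continuation excluded by [class_avoids]. *)
Lemma class_induced x0 y0 v w :
  Delta_vertex E (x0, y0) v -> Delta_vertex E (x0, y0) w -> E v w -> Arel E (x0, y0) (v, w).
Proof.
  destruct tree_metric_exists as
    [d [k [delta [ap [am [Hd [_ [Hk0 [Hd0 [Hk [Hdelta [Hap Ham]]]]]]]]]]]].
  intros [a [Ha|Ha]] Hw Hvw; [eapply Arel_tail; eauto|].
  destruct Hw as [b [Hb|Hb]]; [|eapply Arel_head; eauto].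
  exfalso. assert (H : Arel E (a, v) (w, b)).
  { apply Arel_trans with x0 y0; auto. apply Arel_sym; auto. }
  destruct (class_avoids E d k delta Hd Hk0 Hk Hd0 Hdelta ap am Hap Ham in_neighbour out_neighbour
    a v w w b) as [N _]; auto.
Qed.

End Homogeneous.

(** * Arc reversal, cycles and diamonds *)

Definition flip_arcs {V : Type} (E : V -> V -> Prop) (x y : V) : Prop := E y x.

Lemma flip_adjU {V : Type} (E : V -> V -> Prop) x y : adjU (flip_arcs E) x y <-> adjU E x y.
Proof. unfold adjU, flip_arcs. tauto. Qed.

Lemma flip_conn {V : Type} (E : V -> V -> Prop) P x y : conn (flip_arcs E) P x y <-> conn E P x y.
Proof. split; apply conn_graph_mono; intros a b _ _; apply flip_adjU. Qed.

Lemma flip_steps {V : Type} (E : V -> V -> Prop) n x y : steps (flip_arcs E) n x y <-> steps E n y x.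
Proof.
  assert (H : forall (E : V -> V -> Prop) n x y, steps (flip_arcs E) n x y -> steps E n y x).
  { clear. intros E n. induction n as [|n IH]; intros x y Hs; [simpl in *; auto|].
    destruct Hs as [z [Hz Hzy]]. change (S n) with (1 + n).
    apply steps_app with z; [exists y; simpl; auto|auto]. }
  split; [apply H|]. intros Hs. apply (H (flip_arcs E)). exact Hs.
Qed.

Lemma flip_ray {V : Type} (E : V -> V -> Prop) r : ray E r -> ray (flip_arcs E) r.
Proof. intros [H1 H2]. split; auto. intros n. apply flip_adjU; auto. Qed.

Lemma flip_equiv_rays {V : Type} (E : V -> V -> Prop) r s :
  equiv_rays (flip_arcs E) r s -> equiv_rays E r s.
Proof.
  intros [q [[H1 H2] Hq]]. exists q. split; auto. split; auto.
  intros n. apply flip_adjU; auto.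
Qed.

Lemma cycle_neighbours {V : Type} (E : V -> V -> Prop) x l m :
  NoDup (x :: l) -> 2 <= length l -> adj_chain E x l -> adjU E (last l x) x -> In m (x :: l) ->
  exists a b, In a (x :: l) /\ In b (x :: l) /\ a <> b /\ adjU E a m /\ adjU E m b.
Proof.
  intros N L C Cl Hm. destruct Hm as [<-|Hm].
  - destruct l as [|b l]; [simpl in L; lia|]. exists (last (b :: l) x), b.
    split; [apply last_in|]. split; [simpl; auto|]. split; [|split; [auto|apply C]].
    rewrite last_cons. apply NoDup_cons_iff in N. destruct N as [_ N].
    destruct l as [|c l]; [simpl in L; lia|].
    rewrite last_cons. intros Heq. apply NoDup_cons_iff in N. apply (proj1 N).
    rewrite <- Heq. apply last_in.
  - destruct (in_split _ _ Hm) as [l1 [l2 ->]].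
    apply adj_chain_app in C. destruct C as [C1 [C2 C3]].
    assert (Hin : In (last l1 x) (x :: l1)) by apply last_in.
    assert (Hsub : forall v, In v (x :: l1) -> In v (x :: l1 ++ m :: l2)).
    { intros v [<-|Hv]; [left; auto|right; apply in_or_app; auto]. }
    destruct l2 as [|z l2].
    + exists (last l1 x), x. split; [auto|]. split; [left; auto|]. split; [|split; auto].
      * destruct l1 as [|y l1]; [simpl in L; lia|]. rewrite last_cons. intros Heq.
        apply NoDup_cons_iff in N. apply (proj1 N). rewrite <- Heq.
        apply in_or_app. left. apply last_in.
      * rewrite last_app_cons in Cl. auto.
    + exists (last l1 x), z. split; [auto|]. split.
      { right. apply in_or_app. right. right. left. auto. }
      split; [|split; [auto|apply C3]].
      intros Heq. rewrite Heq in Hin. rewrite app_comm_cons in N.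
      assert (Hd : forall v, In v (x :: l1) -> In v (m :: z :: l2) -> False).
      { intros v Hv Hv'. clear - N Hv Hv'. revert N Hv. generalize (x :: l1) as A.
        induction A as [|a A IH]; intros N Hv; [destruct Hv|].
        inversion N as [|? ? Ha N']; subst. destruct Hv as [->|Hv].
        - apply Ha. apply in_or_app; auto.
        - apply IH; auto. }
      apply (Hd z); auto. simpl; auto.
Qed.

Lemma max_on_list {T : Type} (h : T -> nat) (l : list T) (x : T) :
  exists m, In m (x :: l) /\ forall v, In v (x :: l) -> h v <= h m.
Proof.
  revert x. induction l as [|y l IH]; intros x.
  - exists x. split; [left; auto|]. intros v [<-|[]]; auto.
  - destruct (IH y) as [m [Hm H]]. destruct (le_lt_dec (h m) (h x)).
    + exists x. split; [left; auto|]. intros v [<-|Hv]; auto. specialize (H v Hv). lia.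
    + exists m. split; [right; auto|]. intros v [<-|Hv]; [lia|auto].
Qed.

(** Asking for equal lengths is no loss under the tree metric: by [steps_det] the length of a
    directed path is determined by its ends. *)
Definition has_diamond {V : Type} (E : V -> V -> Prop) : Prop :=
  exists u y y' n z, E u y /\ E u y' /\ y <> y' /\ steps E n y z /\ steps E n y' z.

(** Follow both paths from [u] to where they first differ; they join again in [m]. *)
Lemma diamond_of_two_paths {V : Type} (E : V -> V -> Prop) n : forall u a b m,
  steps E n u a -> steps E n u b -> a <> b -> E a m -> E b m -> has_diamond E.
Proof.
  induction n as [|n IH]; intros u a b m Ha Hb Hne Ham Hbm; [simpl in *; congruence|].
  destruct (steps_split E 1 n u a Ha) as [y [[? [<- Hy]] Hya]].
  destruct (steps_split E 1 n u b Hb) as [y' [[? [<- Hy']] Hyb]].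
  destruct (classic (y = y')) as [<-|Hyy]; [apply (IH y a b m); auto|].
  exists u, y, y', (S n), m. repeat split; auto; simpl; eauto.
Qed.

Lemma has_diamond_flip {V : Type} (E : V -> V -> Prop) :
  has_diamond (flip_arcs E) -> has_diamond E.
Proof.
  intros [u [y [y' [n [z [H1 [H2 [H3 [H4 H5]]]]]]]]].
  apply flip_steps in H4, H5. apply (diamond_of_two_paths E n z y y' u); auto.
Qed.

(** * Descendants without diamonds *)

(** Take a deepest vertex of a cycle. Depth below [u] is well defined and grows by one along arcs,
    so both cycle neighbours are in-neighbours of equal depth, and two paths from [u] meet. *)
Lemma descendants_tree {V : Type} (E : V -> V -> Prop) u :
  (forall n m v, steps E n u v -> steps E m u v -> n = m) -> ~ has_diamond E ->
  induced_tree E (fun v => exists n, steps E n u v).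
Proof.
  intros Hdet Hnd. split.
  - assert (Hu : forall n v, steps E n u v -> conn E (fun v => exists n, steps E n u v) u v).
    { induction n as [|n IH]; intros v Hv.
      - simpl in Hv. subst. apply conn_refl.
      - pose proof Hv as Hv'. destruct Hv as [w [Hw Hwv]].
        apply conn_trans with w; auto. apply conn_step; eauto. left; auto. }
    intros x y [n Hx] [m Hy]. apply conn_trans with u; eauto. apply conn_sym; eauto.
  - intros x l N L HP C Cl.
    (* [h] is the depth below [u], with the junk value 0 off the descendants. *)
    destruct (choice_fun (fun v n => (exists n, steps E n u v) -> steps E n u v)) as [h Hh].
    { intros v. destruct (classic (exists n, steps E n u v)) as [[n Hn]|Hn]; [exists n; auto|].
      exists 0. tauto. }
    destruct (max_on_list h l x) as [m [Hm Hmax]].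
    destruct (cycle_neighbours E x l m N L C Cl Hm) as [a [b [Ha [Hb [Hab [Am Mb]]]]]].
    assert (Hlow : forall c, In c (x :: l) -> adjU E c m -> E c m /\ h m = S (h c)).
    { intros c Hc [Hcm|Hcm].
      - split; auto. apply (Hdet (h m) (S (h c)) m); [apply Hh; auto|]. exists c. auto.
      - assert (h c = S (h m)).
        { apply (Hdet _ _ c); [apply Hh; auto|]. exists m. auto. }
        specialize (Hmax c Hc). lia. }
    destruct (Hlow a Ha Am) as [Ea Sa], (Hlow b Hb (adjU_sym _ _ _ Mb)) as [Eb Sb].
    apply Hnd. apply (diamond_of_two_paths E (h a) u a b m); auto.
    replace (h a) with (h b) by lia. apply Hh; auto.
Qed.

(** * Digraphs with diamonds have at most two ends *)

Section Parallel.
Context {V : Type} (E : V -> V -> Prop) (d : V -> V -> nat) (k delta : nat).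
Hypothesis Hd : tree_like E d.
Hypothesis Hk0 : 0 < k.
Hypothesis Hk : forall x y, E x y -> d x y = k.
Hypothesis Hdelta0 : 0 < delta.
Hypothesis Hdelta : forall x y z, E x y -> E y z -> d x z = k + delta.

(* In the underlying tree, the segments of the two arcs share their middle part. *)
Definition par (x y x' y' : V) : Prop :=
  d x x' + delta <= k /\ d y y' + delta <= k /\ d x y' <= k /\ d x' y <= k.

Lemma par_sym x y x' y' : par x y x' y' -> par x' y' x y.
Proof.
  pose proof (tl_sym E d Hd) as Sy. unfold par.
  rewrite (Sy x x'), (Sy y y'). tauto.
Qed.

Lemma par_trans x y x' y' x'' y'' :
  E x' y' -> par x y x' y' -> par x' y' x'' y'' -> par x y x'' y''.
Proof.
  intros He [A1 [A2 [A3 A4]]] [B1 [B2 [B3 B4]]]. apply Hk in He.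
  pose proof (tl_sym E d Hd) as Sy. pose proof (tl_four E d Hd) as F4.
  pose proof (F4 x x'' x' y'). pose proof (F4 y y'' x' y'). pose proof (F4 x y'' x' y').
  pose proof (F4 x'' y x' y').
  rewrite (Sy x'' x'), (Sy y'' y'), (Sy y'' x'), (Sy y x'), (Sy x'' y') in *.
  rewrite ?(Sy y'' x'), ?(Sy x'' x'), ?(Sy y'' y') in *.
  unfold par. rewrite ?(Sy x'' y'), ?(Sy x'' x') in *. lia.
Qed.

Hypothesis Hdk : delta <= k.

Lemma two_paths_par m j u z c e c' e' :
  steps E m u c -> E c e -> steps E j e z -> steps E m u c' -> E c' e' -> steps E j e' z ->
  par c e c' e'.
Proof.
  intros H1 H2 H3 H1' H2' H3'.
  pose proof (tl_sym E d Hd) as Sy. pose proof (tl_four E d Hd) as F4.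
  pose proof (tl_refl E d Hd) as R.
  pose proof (steps_dist E d k delta Hd Hk0 Hk Hdelta0 Hdelta) as SD.
  assert (Duz : d u z = k + (m + j) * delta).
  { apply SD. change (S (m + j)) with (1 + (m + j)). replace (1 + (m + j)) with (m + (1 + j)) by lia.
    apply steps_app with c; auto. apply steps_app with e; auto. exists c; simpl; auto. }
  assert (Dm : forall c e, steps E m u c -> E c e -> steps E j e z ->
    (m = 0 /\ u = c \/ d u c + delta = k + m * delta) /\
    (j = 0 /\ e = z \/ d e z + delta = k + j * delta) /\
    d c z = k + j * delta /\ d u e = k + m * delta).
  { clear - SD. intros c e H1 H2 H3. repeat split.
    - destruct m as [|m]; [left; auto|]. apply SD in H1. right. lia.
    - destruct j as [|j]; [left; auto|]. apply SD in H3. right. lia.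
    - apply SD. change (S j) with (1 + j). apply steps_app with e; auto. exists c; simpl; auto.
    - apply SD. exists c; auto. }
  destruct (Dm c e H1 H2 H3) as [A1 [A2 [A3 A4]]].
  destruct (Dm c' e' H1' H2' H3') as [B1 [B2 [B3 B4]]].
  rewrite Nat.mul_add_distr_r in Duz.
  pose proof (F4 c c' u z). pose proof (F4 e e' u z). pose proof (F4 c e' u z). pose proof (F4 c' e u z).
  rewrite (Sy c u), (Sy c' u), (Sy e u), (Sy e' u) in *.
  unfold par.
  assert (C1 : d c c' + delta <= k).
  { destruct A1 as [[-> <-]|A1].
    - destruct B1 as [[_ <-]|B1]; [rewrite R; lia|]. simpl in H1'. subst c'. rewrite R in *. lia.
    - destruct B1 as [[-> <-]|B1]; [simpl in H1; subst c; rewrite R in *; lia|]. lia. }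
  assert (C2 : d e e' + delta <= k).
  { destruct A2 as [[-> ->]|A2].
    - simpl in H3'. subst e'. rewrite R. lia.
    - destruct B2 as [[-> ->]|B2]; [simpl in H3; subst e; rewrite R; lia|]. lia. }
  assert (D1 : d u c <= k + m * delta /\ d u c' <= k + m * delta).
  { split; [destruct A1 as [[_ <-]|A1]|destruct B1 as [[_ <-]|B1]]; rewrite ?R; lia. }
  split; [auto|]. split; [auto|]. split.
  - assert (d u c + d e' z <= 2 * k + m * delta + j * delta).
    { destruct A1 as [[_ <-]|A1], B2 as [[_ ->]|B2]; rewrite ?R; lia. }
    lia.
  - assert (d u c' + d e z <= 2 * k + m * delta + j * delta).
    { destruct B1 as [[_ <-]|B1], A2 as [[_ ->]|A2]; rewrite ?R; lia. }
    lia.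
Qed.

Hypothesis Hsib : forall v w w', E v w -> E v w' -> d w w' + delta <= k.
Hypothesis Hout : forall v, exists w, E v w.
Hypothesis Hdia : forall u y y', E u y -> E u y' -> y <> y' ->
  exists n z, steps E n y z /\ steps E n y' z.

Lemma par_tail x y y' : E x y -> E x y' -> par x y x y'.
Proof.
  intros H H'. unfold par. rewrite (tl_refl E d Hd), (Hk _ _ H), (Hk _ _ H').
  pose proof (Hsib x y y' H H'). lia.
Qed.

Lemma steps_exist n x : exists y, steps E n x y.
Proof.
  induction n as [|n [y IH]]; [exists x; simpl; auto|].
  destruct (Hout y) as [z Hz]. exists z, y. auto.
Qed.

Definition out_par m x x' : Prop := forall a b a' b',
  steps E m x a -> E a b -> steps E m x' a' -> E a' b' -> par a b a' b'.

(** The two claims feed each other: depth [S m] below one vertex is depth [m] below two of its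
    out-neighbours, and siblings are compared through the paths on which they flow together. *)
Lemma out_par_siblings m :
  (forall x, out_par m x x) /\ (forall u y y', E u y -> E u y' -> out_par m y y').
Proof.
  induction m as [|m [_ IH]].
  - assert (H0 : forall x, out_par 0 x x).
    { intros x a b a' b' H1 H2 H3 H4. simpl in *. subst. apply par_tail; auto. }
    split; auto. intros u y y' Hy Hy' a b a' b' H1 H2 H3 H4. simpl in H1, H3. subst a a'.
    destruct (classic (y = y')) as [<-|Hne]; [apply par_tail; auto|].
    destruct (Hdia u y y' Hy Hy' Hne) as [n [z [Hz Hz']]].
    destruct n as [|n]; [simpl in *; congruence|].
    destruct (steps_split E 1 n y z Hz) as [c [[? [<- Hc]] Hcz]].
    destruct (steps_split E 1 n y' z Hz') as [c' [[? [<- Hc']] Hcz']].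
    apply par_trans with y c; auto; [apply par_tail; auto|].
    apply par_trans with y' c'; auto; [|apply par_tail; auto].
    apply (two_paths_par 1 n u z); auto; exists u; simpl; auto.
  - assert (H0 : forall x, out_par (S m) x x).
    { intros x a b a' b' H1 H2 H3 H4.
      destruct (steps_split E 1 m x a H1) as [y [[? [<- Hy]] Hya]].
      destruct (steps_split E 1 m x a' H3) as [y' [[? [<- Hy']] Hya']].
      apply (IH x y y'); auto. }
    split; auto. intros u y y' Hy Hy'. destruct (classic (y = y')) as [<-|Hne]; auto.
    destruct (Hdia u y y' Hy Hy' Hne) as [n [z [Hz Hz']]].
    (* If the siblings flow together by this depth, an arc below [z] is parallel to both given arcs.
       Otherwise the two confluent paths each have an arc at this depth, and these are parallel by
       [two_paths_par]. *)
    intros a b a' b' H1 H2 H3 H4. destruct (le_lt_dec n (S m)) as [Hn|Hn].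
    + destruct (steps_exist (S m - n) z) as [c Hc]. destruct (Hout c) as [e He].
      apply par_trans with c e; auto.
      * apply (H0 y); auto. replace (S m) with (n + (S m - n)) by lia. apply steps_app with z; auto.
      * apply (H0 y'); auto. replace (S m) with (n + (S m - n)) by lia. apply steps_app with z; auto.
    + replace n with (S m + (1 + (n - S m - 1))) in Hz, Hz' by lia.
      apply steps_split in Hz, Hz'. destruct Hz as [c [Hc Hcz]], Hz' as [c' [Hc' Hcz']].
      apply steps_split in Hcz, Hcz'.
      destruct Hcz as [e [[? [<- He]] Hez]], Hcz' as [e' [[? [<- He']] Hez']].
      apply par_trans with c e; auto; [apply (H0 y); auto|].
      apply par_trans with c' e'; auto; [|apply (H0 y'); auto].
      apply (two_paths_par (S (S m)) (n - S m - 1) u z); auto.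
      * change (S (S m)) with (1 + S m). apply steps_app with y; auto. exists u; simpl; auto.
      * change (S (S m)) with (1 + S m). apply steps_app with y'; auto. exists u; simpl; auto.
Qed.

End Parallel.

Section Levels.
Context {V : Type} (E : V -> V -> Prop) (d : V -> V -> nat) (k delta : nat).
Hypothesis Hd : tree_like E d.
Hypothesis Hfp : finite_parallel E d.
Hypothesis Hk0 : 0 < k.
Hypothesis Hk : forall x y, E x y -> d x y = k.
Hypothesis Hdelta0 : 0 < delta.
Hypothesis Hdelta : forall x y z, E x y -> E y z -> d x z = k + delta.
Hypothesis Hin : forall v, exists u, E u v.
Hypothesis Hout : forall v, exists w, E v w.
Hypothesis Hconn : connected E.

Let par := par d k delta.
Let out_par := out_par E d k delta.

Definition in_par m x x' : Prop := forall a b a' b',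
  steps E m a x -> E b a -> steps E m a' x' -> E b' a' -> par b a b' a'.

Hypothesis OPr : forall m x, out_par m x x.
Hypothesis IPr : forall m x, in_par m x x.

(** Being on the same level, expressed before any level function exists. All depths and heights are
    included so that the relation can pass along arcs in both directions. *)
Definition level_eq x x' : Prop := forall m, out_par m x x' /\ in_par m x x'.

Lemma steps_exist_out n x : exists y z, steps E n x y /\ E y z.
Proof.
  destruct (steps_exist E Hout n x) as [y Hy]. destruct (Hout y) as [z Hz]. eauto.
Qed.

Lemma steps_exist_in n x : exists y z, steps E n y x /\ E z y.
Proof.
  destruct (steps_exist (flip_arcs E) Hin n x) as [y Hy]. apply flip_steps in Hy.
  destruct (Hin y) as [z Hz]. eauto.
Qed.

Let ptrans := par_trans E d k delta Hd Hk0 Hk Hdelta0.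

Lemma level_eq_refl x : level_eq x x.
Proof. intros m. split; [apply OPr|apply IPr]. Qed.

Lemma level_eq_sym x x' : level_eq x x' -> level_eq x' x.
Proof.
  intros H m. destruct (H m) as [H1 H2]. split; intros a b a' b' ? ? ? ?.
  - apply (par_sym E d k delta Hd). apply H1; auto.
  - apply (par_sym E d k delta Hd). apply H2; auto.
Qed.

Lemma level_eq_trans x y z : level_eq x y -> level_eq y z -> level_eq x z.
Proof.
  intros H H' m. destruct (H m) as [H1 H2], (H' m) as [H1' H2']. split; intros a b a' b' ? ? ? ?.
  - destruct (steps_exist_out m y) as [c [e [Hc He]]]. apply ptrans with c e; [auto|apply H1; auto|apply H1'; auto].
  - destruct (steps_exist_in m y) as [c [e [Hc He]]]. apply ptrans with e c; [auto|apply H2; auto|apply H2'; auto].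
Qed.

(** Arcs below [y] are one step deeper below [x]. Arcs above [y] are first replaced, using [IPr], by
    arcs on a path through [x]. *)
Lemma level_eq_up x x' y y' : level_eq x x' -> E x y -> E x' y' -> level_eq y y'.
Proof.
  intros H Hy Hy' m. split; intros a b a' b' H1 H2 H3 H4.
  - apply (proj1 (H (S m))); auto; change (S m) with (1 + m).
    + apply steps_app with y; auto. exists x; simpl; auto.
    + apply steps_app with y'; auto. exists x'; simpl; auto.
  - destruct m as [|m].
    + simpl in *. subst. apply ptrans with x y; auto; [apply (IPr 0 y); simpl; auto|].
      apply ptrans with x' y'; auto; [|apply (IPr 0 y'); simpl; auto].
      apply (proj1 (H 0)); simpl; auto.
    + destruct (steps_exist_in m x) as [c [e [Hc He]]].
      destruct (steps_exist_in m x') as [c' [e' [Hc' He']]].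
      apply ptrans with e c; auto; [apply (IPr (S m) y); auto; exists x; auto|].
      apply ptrans with e' c'; auto; [|apply (IPr (S m) y'); auto; exists x'; auto].
      apply (proj2 (H m)); auto.
Qed.

Lemma level_eq_down x x' y y' : level_eq y y' -> E x y -> E x' y' -> level_eq x x'.
Proof.
  intros H Hy Hy' m. split; intros a b a' b' H1 H2 H3 H4.
  - destruct m as [|m].
    + simpl in *. subst. apply ptrans with a y; auto; [apply (OPr 0 a); simpl; auto|].
      apply ptrans with a' y'; auto; [|apply (OPr 0 a'); simpl; auto].
      apply (proj2 (H 0)); simpl; auto.
    + destruct (steps_exist_out m y) as [c [e [Hc He]]].
      destruct (steps_exist_out m y') as [c' [e' [Hc' He']]].
      apply ptrans with c e; auto.
      { apply (OPr (S m) x); auto. change (S m) with (1 + m).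
        apply steps_app with y; auto. exists x; simpl; auto. }
      apply ptrans with c' e'; auto; [apply (proj1 (H m)); auto|].
      apply (OPr (S m) x'); auto. change (S m) with (1 + m).
      apply steps_app with y'; auto. exists x'; simpl; auto.
  - apply (proj2 (H (S m))); auto.
    + exists x; auto.
    + exists x'; auto.
Qed.

Lemma level_eq_not_steps n x y : steps E (S n) x y -> ~ level_eq x y.
Proof.
  intros Hs H. destruct (Hout x) as [a Ha], (Hout y) as [b Hb].
  destruct (proj1 (H 0) x a y b) as [P _]; simpl; auto.
  rewrite (steps_dist E d k delta Hd Hk0 Hk Hdelta0 Hdelta n x y Hs) in P. lia.
Qed.

(** Each vertex of the level has an out-arc parallel to one fixed arc; parallel arcs overlap along
    the same direction, so the finiteness coming from cuts applies. *)
Lemma finite_level x : finite_set (level_eq x).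
Proof.
  destruct (Hout x) as [y Hy]. destruct (Hfp x y) as [l Hl].
  exists (map fst l). intros v Hv. destruct (Hout v) as [w Hw].
  apply in_map_iff. exists (v, w). split; auto. apply Hl. simpl. split; auto.
  destruct (proj1 (level_eq_sym _ _ Hv 0) v w x y) as [P1 [P2 [P3 P4]]]; simpl; auto.
  pose proof (tl_four E d Hd v w x y). rewrite (Hk _ _ Hw), (Hk _ _ Hy) in *. lia.
Qed.

(** A bi-infinite directed line [ref] through [o] represents the levels. Its vertices are pairwise
    inequivalent, since parallel arcs start less than [k] apart, and connectedness ties every vertex
    to one of them. *)
Theorem level_function : exists lev : V -> Z,
  (forall x y, E x y -> lev y = (lev x + 1)%Z) /\
  (forall z, finite_set (fun v => lev v = z)).
Proof.
  destruct (classic (exists o : V, True)) as [[o _]|N].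
  2:{ exists (fun _ => 0%Z). split.
      - intros x; exfalso; eauto.
      - intros z. exists []. intros w; exfalso; eauto. }
  destruct (choice_fun _ Hout) as [s Hs]. destruct (choice_fun _ Hin) as [p Hp].
  set (ref := fun z => if (0 <=? z)%Z then Nat.iter (Z.to_nat z) s o
                       else Nat.iter (Z.to_nat (- z)) p o).
  assert (Href : forall z, E (ref z) (ref (z + 1)%Z)).
  { intros z. unfold ref. destruct (Z.leb_spec 0 z) as [H|H].
    - destruct (Z.leb_spec 0 (z + 1)) as [H'|H']; [|lia].
      replace (Z.to_nat (z + 1)) with (S (Z.to_nat z)) by lia. simpl. apply Hs.
    - destruct (Z.leb_spec 0 (z + 1)) as [H'|H'].
      + replace (Z.to_nat (z + 1)) with 0 by lia. replace (Z.to_nat (- z)) with 1 by lia.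
        simpl. apply Hp.
      + replace (Z.to_nat (- z)) with (S (Z.to_nat (- (z + 1)))) by lia. simpl. apply Hp. }
  assert (Hst : forall n z, steps E n (ref z) (ref (z + Z.of_nat n)%Z)).
  { induction n as [|n IH]; intros z.
    - simpl. rewrite Z.add_0_r. auto.
    - exists (ref (z + Z.of_nat n)%Z). split; auto.
      replace (z + Z.of_nat (S n))%Z with (z + Z.of_nat n + 1)%Z by lia. auto. }
  assert (Huniq : forall z z', level_eq (ref z) (ref z') -> z = z').
  { assert (Hlt : forall z z', (z < z')%Z -> ~ level_eq (ref z) (ref z')).
    { intros z z' H. apply level_eq_not_steps with (n := Z.to_nat (z' - z - 1)).
      pose proof (Hst (S (Z.to_nat (z' - z - 1))) z) as St.
      replace (z + Z.of_nat (S (Z.to_nat (z' - z - 1))))%Z with z' in St by lia. auto. }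
    intros z z' H. destruct (Z.lt_trichotomy z z') as [L|[L|L]]; auto; exfalso.
    - apply (Hlt _ _ L); auto.
    - apply (Hlt _ _ L). apply level_eq_sym; auto. }
  assert (Hex : forall v, exists z, level_eq v (ref z)).
  { intros v. apply (conn_invariant E (fun _ => True) (fun v => exists z, level_eq v (ref z)) o v).
    - apply Hconn; auto.
    - exists 0%Z. apply level_eq_refl.
    - intros a b _ _ [Hab|Hab] [z Hz].
      + exists (z + 1)%Z. apply level_eq_up with a (ref z); auto.
      + exists (z - 1)%Z. apply level_eq_down with a (ref z); auto.
        replace z with (z - 1 + 1)%Z at 2 by lia. auto. }
  destruct (choice_fun _ Hex) as [lev Hlev]. exists lev. split.
  - intros x y Hxy. apply Huniq. apply level_eq_trans with y; [apply level_eq_sym; auto|].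
    apply level_eq_up with x (ref (lev x)); auto.
  - intros z. apply finite_sub with (2 := finite_level (ref z)).
    intros v <-. apply level_eq_sym; auto.
Qed.

End Levels.

Lemma list_lower_bound {T : Type} (f : T -> Z) (l : list T) :
  exists j, forall v, In v l -> (j <= f v)%Z.
Proof.
  induction l as [|x l [j Hj]]; [exists 0%Z; intros v []|].
  exists (Z.min j (f x)). intros v [<-|Hv]; [lia|]. specialize (Hj v Hv). lia.
Qed.

Section LevelRays.
Context {V : Type} (E : V -> V -> Prop) (lev : V -> Z).
Hypothesis Hlev : forall x y, E x y -> lev y = (lev x + 1)%Z.
Hypothesis Hconn : connected E.
Hypothesis Hdia : forall u y y', E u y -> E u y' -> y <> y' ->
  exists n z, steps E n y z /\ steps E n y' z.

Let above j := conn E (fun v => (j <= lev v)%Z).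

Lemma steps_above j n x y : steps E n x y -> (j <= lev x)%Z -> above j x y /\ (j <= lev y)%Z.
Proof.
  revert y. induction n as [|n IH]; intros y Hs Hj.
  - simpl in Hs. subst. split; auto. apply conn_refl.
  - destruct Hs as [z [Hz Hzy]]. destruct (IH z Hz Hj) as [I1 I2].
    pose proof (Hlev _ _ Hzy). split; [|lia]. apply conn_trans with z; auto.
    apply conn_step; auto; [lia|left; auto].
Qed.

(* Each passage of a walk through the lowest level is replaced by a detour
   through a common descendant. *)
Lemma above_succ j x y : above j x y -> (j + 1 <= lev x)%Z -> (j + 1 <= lev y)%Z -> above (j + 1) x y.
Proof.
  intros H Hx Hy.
  cut (((j + 1 <= lev y)%Z -> above (j + 1) x y) /\
       (lev y = j -> forall w, E y w -> above (j + 1) x w)); [tauto|].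
  apply (conn_invariant E (fun v => (j <= lev v)%Z)
    (fun y => ((j + 1 <= lev y)%Z -> above (j + 1) x y) /\
       (lev y = j -> forall w, E y w -> above (j + 1) x w)) x y H).
  - split; [intros; apply conn_refl|lia].
  - intros a b Ha Hb [Hab|Hab] [I1 I2]; pose proof (Hlev _ _ Hab) as L; split.
    + intros Hb1. destruct (Z.eq_dec (lev a) j) as [Ea|Ea]; [apply I2; auto|].
      apply conn_trans with a; [apply I1; lia|]. apply conn_step; [lia|lia|left; auto].
    + lia.
    + intros Hb1. apply conn_trans with a; [apply I1; lia|]. apply conn_step; [lia|lia|right; auto].
    + intros Eb w Hw. assert (Ha1 : above (j + 1) x a) by (apply I1; lia).
      destruct (classic (a = w)) as [<-|Hne]; auto.
      destruct (Hdia b a w Hab Hw Hne) as [n [z [Hz Hz']]].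
      pose proof (Hlev _ _ Hw). apply conn_trans with a; auto.
      apply conn_trans with z; [apply (steps_above (j + 1) n); auto; lia|].
      apply conn_sym. apply (steps_above (j + 1) n); auto; lia.
Qed.

(** A finite connecting set lies above some level; the floor is then raised one level at a time up
    to [j]. *)
Lemma above_connected j x y : (j <= lev x)%Z -> (j <= lev y)%Z -> above j x y.
Proof.
  intros Hx Hy.
  destruct (conn_within_list E (fun _ => True) x y I (Hconn x y I I)) as [l [Lx [Ly Hl]]].
  destruct (list_lower_bound lev l) as [i Hi].
  assert (H0 : above (Z.min i j) x y).
  { apply conn_mono with (fun u => In u l); [|apply Hl; auto].
    intros v Hv. specialize (Hi v Hv). lia. }
  assert (Hn : forall n, (Z.min i j + Z.of_nat n <= j)%Z -> above (Z.min i j + Z.of_nat n) x y).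
  { induction n as [|n IH]; intros Hle.
    - simpl. rewrite Z.add_0_r. auto.
    - replace (Z.min i j + Z.of_nat (S n))%Z with (Z.min i j + Z.of_nat n + 1)%Z in * by lia.
      apply above_succ; try lia. apply IH. lia. }
  specialize (Hn (Z.to_nat (j - Z.min i j))).
  replace (Z.min i j + Z.of_nat (Z.to_nat (j - Z.min i j)))%Z with j in Hn by lia.
  apply Hn; lia.
Qed.

Definition ascending (r : nat -> V) : Prop :=
  forall N, exists n0, forall n, n0 <= n -> (N <= lev (r n))%Z.

(** A finite set lies below some level, and everything above that level is connected, so no finite
    set separates the two rays. *)
Lemma ascending_rays_equiv r s :
  ray E r -> ray E s -> ascending r -> ascending s -> equiv_rays E r s.
Proof.
  intros Rr Rs Ar As. apply linked_rays_equiv; auto. intros F.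
  destruct (list_lower_bound (fun v => (- lev v)%Z) F) as [j Hj].
  destruct (Ar (1 - j)%Z) as [n Hn], (As (1 - j)%Z) as [m Hm].
  assert (Hav : forall v, (1 - j <= lev v)%Z -> ~ In v F).
  { intros v Hv Hi. specialize (Hj v Hi). lia. }
  exists n, m. split; auto.
  apply conn_mono with (1 := Hav). apply above_connected; auto.
Qed.

End LevelRays.

(** A band of levels is finite, so the ray leaves it for good, and moving one level at a time it
    cannot jump across. The band is chosen between the two bounds that a ray of neither kind would
    keep violating. *)
Lemma ray_ascends_or_descends {V : Type} (E : V -> V -> Prop) (lev : V -> Z) r :
  (forall x y, E x y -> lev y = (lev x + 1)%Z) ->
  (forall z, finite_set (fun v => lev v = z)) -> ray E r ->
  ascending lev r \/ ascending (fun v => (- lev v)%Z) r.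
Proof.
  intros Hlev Hfin Hr. apply NNPP. intros N. apply not_or_and in N. destruct N as [N1 N2].
  apply not_all_ex_not in N1, N2. destruct N1 as [b Hb], N2 as [a Ha].
  set (lo := Z.min (- a) b). set (hi := Z.max (- a) b).
  assert (Hband : finite_set (fun v => exists z, In z (map (fun i => (lo + Z.of_nat i)%Z)
             (seq 0 (Z.to_nat (hi - lo + 1)))) /\ lev v = z)).
  { apply finite_bigor. auto. }
  destruct Hband as [l Hl]. destruct (ray_leaves_list E r l Hr) as [n0 Hn0].
  assert (Hout : forall n, n0 <= n -> (lev (r n) < lo \/ hi < lev (r n))%Z).
  { intros n Hn. apply NNPP. intros N. apply (Hn0 n Hn). apply Hl. exists (lev (r n)). split; auto.
    apply in_map_iff. exists (Z.to_nat (lev (r n) - lo)). split; [lia|]. apply in_seq. lia. }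
  assert (Hstep : forall n, (lev (r (S n)) = lev (r n) + 1 \/ lev (r (S n)) = lev (r n) - 1)%Z).
  { intros n. destruct (proj2 Hr n) as [H|H]; apply Hlev in H; lia. }
  destruct (Hout n0 (le_n _)) as [H|H].
  - apply Ha. exists n0. intros n Hn.
    assert (Hlow : (lev (r n) < lo)%Z).
    { induction Hn as [|n Hn IH]; auto.
      specialize (Hstep n). specialize (Hout (S n) ltac:(lia)). lia. }
    lia.
  - apply Hb. exists n0. intros n Hn.
    assert (Hhigh : (hi < lev (r n))%Z).
    { induction Hn as [|n Hn IH]; auto.
      specialize (Hstep n). specialize (Hout (S n) ltac:(lia)). lia. }
    lia.
Qed.

Lemma steps_aut {V : Type} (E : V -> V -> Prop) g n x y :
  is_aut E g -> steps E n x y -> steps E n (g x) (g y).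
Proof.
  intros [_ Hg]. revert y. induction n as [|n IH]; intros y H; simpl in *; [congruence|].
  destruct H as [z [Hz Hzy]]. exists (g z). split; auto. apply (proj1 (Hg z y)); auto.
Qed.

Section DescendantTrees.
Context {V : Type} (E : V -> V -> Prop).
Hypothesis HD : is_digraph E.
Hypothesis Hconn : connected E.
Hypothesis Hlf : locally_finite E.
Hypothesis Htf : triangle_free E.
Hypothesis Hch : conn_hom E.
Hypothesis Hends : more_than_one_end E.

(** By homogeneity one diamond makes all siblings confluent, for arcs and for reversed arcs. This
    gives finite levels, every ray ascends or descends, and rays of the same kind are equivalent; of
    three rays two are of the same kind. *)
Lemma no_diamond : more_than_two_ends E -> ~ has_diamond E.
Proof.
  intros [r1 [r2 [r3 [R1 [R2 [R3 [N12 [N13 N23]]]]]]]] Hdm.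
  destruct (tree_metric_exists E HD Hconn Hlf Htf Hch Hends) as
    [d [k [delta [ap [am [Hd [Hfp [Hk0 [Hd0 [Hk [Hdelta [Hap Ham]]]]]]]]]]]].
  pose proof (in_neighbour E HD Hch Hends) as Hin.
  pose proof (out_neighbour E HD Hch Hends) as Hout.
  assert (Hmin : exists n, exists u y y' z, E u y /\ E u y' /\ y <> y' /\ steps E n y z /\ steps E n y' z).
  { destruct Hdm as [u [y [y' [n [z H]]]]]. exists n, u, y, y', z. auto. }
  (* Minimal length makes the last vertices [c], [c'] before [z] distinct, so the diamond also
     begins with two different arcs when read backwards. *)
  apply least_nat in Hmin. destruct Hmin as [n [[u [y [y' [z [Hy [Hy' [Hne [Hz Hz']]]]]]]] Hmin]].
  destruct n as [|n]; [simpl in *; congruence|].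
  pose proof (delta_le E d k delta Hd Hk0 Hk Hd0 Hdelta Hin Hout (ex_intro _ u I)) as Hdk.
  pose proof Hz as [c [Hc Hcz]]. pose proof Hz' as [c' [Hc' Hcz']].
  assert (Hcc : c <> c').
  { intros <-. specialize (Hmin n). enough (S n <= n) by lia. apply Hmin. exists u, y, y', c. auto. }
  (* The common distance of siblings is read off the diamond: its first arcs are parallel. Its last
     arcs serve in the same way for the reversed digraph. *)
  assert (Hap' : forall v w w', E v w -> E v w' -> d w w' + delta <= k).
  { intros v w w' Hw Hw'. destruct (classic (w = w')) as [<-|Hww]; [rewrite (tl_refl E d Hd); lia|].
    rewrite (Hap v w w'), <- (Hap u y y') by auto.
    apply (two_paths_par E d k delta Hd Hk0 Hk Hd0 Hdelta Hdk 0 (S n) u z u y u y'); simpl; auto. }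
  assert (Ham' : forall v w w', E w v -> E w' v -> d w w' + delta <= k).
  { intros v w w' Hw Hw'. destruct (classic (w = w')) as [<-|Hww]; [rewrite (tl_refl E d Hd); lia|].
    rewrite (Ham v w w'), <- (Ham z c c') by auto.
    apply (two_paths_par E d k delta Hd Hk0 Hk Hd0 Hdelta Hdk (S n) 0 u z c z c' z); auto;
      try (simpl; reflexivity).
    - apply (steps_app E 1 n u y c); auto. exists u; simpl; auto.
    - apply (steps_app E 1 n u y' c'); auto. exists u; simpl; auto. }
  assert (Hdia : forall u y y', E u y -> E u y' -> y <> y' ->
    exists n z, steps E n y z /\ steps E n y' z).
  { intros v w w' Hw Hw' Hww.
    destruct (two_path_transitive E HD Htf Hch u y y' v w w') as [g [Hg [_ [<- <-]]]];
      try (left; auto); auto; try tauto.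
    exists (S n), (g z). split; apply steps_aut; auto. }
  assert (HdiaT : forall u y y', flip_arcs E u y -> flip_arcs E u y' -> y <> y' ->
    exists n z, steps (flip_arcs E) n y z /\ steps (flip_arcs E) n y' z).
  { unfold flip_arcs at 1 2. intros v w w' Hw Hw' Hww.
    destruct (two_path_transitive E HD Htf Hch z c c' v w w') as [g [Hg [_ [<- <-]]]];
      try (right; auto); auto.
    - pose proof (proj2 HD _ _ Hw). pose proof (proj2 HD _ _ Hcz). tauto.
    - pose proof (proj2 HD _ _ Hw'). pose proof (proj2 HD _ _ Hcz'). tauto.
    - exists (1 + n), (g u). split; apply flip_steps; apply steps_aut; auto.
      + apply steps_app with y; auto. exists u; simpl; auto.
      + apply steps_app with y'; auto. exists u; simpl; auto. }
  assert (HdT : tree_like (flip_arcs E) d) by exact Hd.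
  assert (HkT : forall x y, flip_arcs E x y -> d x y = k).
  { intros x w H. rewrite (tl_sym E d Hd). auto. }
  assert (HdeltaT : forall x y z, flip_arcs E x y -> flip_arcs E y z -> d x z = k + delta).
  { intros x w v H1 H2. rewrite (tl_sym E d Hd). eauto. }
  destruct (level_function E d k delta Hd Hfp Hk0 Hk Hd0 Hdelta Hin Hout Hconn) as [lev [Hlev Hfin]].
  { intros m. apply (out_par_siblings E d k delta Hd Hk0 Hk Hd0 Hdelta Hdk Hap' Hout Hdia m). }
  { intros m x a b a' b' H1 H2 H3 H4.
    destruct (out_par_siblings (flip_arcs E) d k delta HdT Hk0 HkT Hd0 HdeltaT Hdk Ham' Hin HdiaT m)
      as [P _].
    apply flip_steps in H1, H3.
    destruct (P x a b a' b' H1 H2 H3 H4) as [P1 [P2 [P3 P4]]]. unfold par.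
    rewrite (tl_sym E d Hd b a'), (tl_sym E d Hd b' a). tauto. }
  assert (HlevT : forall x y, flip_arcs E x y -> (- lev y = - lev x + 1)%Z).
  { intros x w H. apply Hlev in H. lia. }
  assert (HconnT : connected (flip_arcs E)).
  { intros x w _ _. apply flip_conn. apply Hconn; auto. }
  pose proof (ascending_rays_equiv E lev Hlev Hconn Hdia) as Up.
  assert (Down : forall r s, ray E r -> ray E s -> ascending (fun v => (- lev v)%Z) r ->
    ascending (fun v => (- lev v)%Z) s -> equiv_rays E r s).
  { intros r s Rr Rs Ar As. apply flip_equiv_rays.
    apply (ascending_rays_equiv (flip_arcs E) (fun v => (- lev v)%Z) HlevT HconnT HdiaT); auto;
      apply flip_ray; auto. }
  pose proof (ray_ascends_or_descends E lev) as AD.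
  destruct (AD r1 Hlev Hfin R1), (AD r2 Hlev Hfin R2), (AD r3 Hlev Hfin R3); auto.
Qed.

Lemma desc_iff_steps u v : desc E u v <-> exists n, steps E n u v.
Proof.
  split.
  - intros [l [Hl <-]]. exists (length l - 0).
    pose proof (dpath_steps E l u u 0 (length l) Hl ltac:(lia) (le_n _)) as H.
    rewrite nth_last in H. exact H.
  - intros [n Hn]. revert v Hn. induction n as [|n IH]; intros v Hn.
    + exists []. simpl in *. auto.
    + destruct Hn as [w [Hw Hwv]]. destruct (IH w Hw) as [l [Hl Hlast]].
      exists (l ++ [v]). split; [|apply last_last]. clear - Hl Hlast Hwv.
      revert u Hl Hlast. induction l as [|x l IH]; intros u Hl Hlast.
      * simpl in *. subst. auto.
      * destruct Hl as [H1 H2]. rewrite last_cons in Hlast. split; auto.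
Qed.

Theorem descendants_and_ancestors_trees :
  more_than_two_ends E -> forall u, induced_tree E (desc E u) /\ induced_tree E (anc E u).
Proof.
  intros H2 u. pose proof (no_diamond H2) as Hnd.
  destruct (tree_metric_exists E HD Hconn Hlf Htf Hch Hends) as
    [d [k [delta [ap [am [Hd [Hfp [Hk0 [Hd0 [Hk [Hdelta [Hap Ham]]]]]]]]]]]].
  pose proof (steps_det E d k delta Hd Hk0 Hk Hd0 Hdelta) as Hdet.
  assert (Ht : forall E' P Q, (forall x y, adjU E' x y <-> adjU E x y) -> (forall v : V, P v <-> Q v) ->
    induced_tree E' P -> induced_tree E Q).
  { clear. intros E' P Q HE HPQ [H1 H2]. split.
    - intros x y Hx Hy. apply HPQ in Hx, Hy. apply conn_mono with P; [intros; apply HPQ; auto|].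
      apply conn_graph_mono with E'; [intros; apply HE; auto|]. apply H1; auto.
    - intros x l N L HP C Cl. apply (H2 x l); auto.
      + intros v Hv. apply HPQ; auto.
      + clear - C HE. revert x C. induction l as [|y l IH]; intros x C; simpl in *; auto.
        split; [apply HE|apply IH]; tauto.
      + apply HE; auto. }
  split.
  - apply (Ht E (fun v => exists n, steps E n u v)).
    + tauto.
    + intros v. symmetry. apply desc_iff_steps.
    + apply descendants_tree; auto. intros n m v. apply Hdet.
  - apply (Ht (flip_arcs E) (fun v => exists n, steps (flip_arcs E) n u v)).
    + intros. apply flip_adjU.
    + intros v. assert (Ha : anc E u v <-> desc E v u) by (unfold anc, desc; tauto).
      rewrite Ha, desc_iff_steps. split; intros [n Hn]; exists n; apply flip_steps; auto.
    + apply descendants_tree.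
      * intros n m v H3 H4. apply flip_steps in H3, H4. eapply Hdet; eauto.
      * intros H. apply Hnd, has_diamond_flip, H.
Qed.

End DescendantTrees.

Lemma cardf_two {T : Type} (P : T -> Prop) :
  finite_set P -> 2 <= cardf P -> exists x y, x <> y /\ P x /\ P y.
Proof.
  intros F H. destruct (cardf_card P F) as [l [N [L Hl]]].
  destruct l as [|x [|y l]]; simpl in L; try lia.
  exists x, y. split; [|split; apply Hl; simpl; auto].
  intros ->. apply NoDup_cons_iff in N. apply (proj1 N). left; auto.
Qed.

Lemma cardf_diff {T : Type} (P Q : T -> Prop) :
  finite_set P -> (forall x, Q x -> P x) -> cardf P = cardf Q + cardf (fun x => P x /\ ~ Q x).
Proof.
  intros F H. assert (Fq : finite_set Q) by (apply finite_sub with (2 := F); auto).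
  assert (Fd : finite_set (fun x => P x /\ ~ Q x)) by (apply finite_sub with (2 := F); tauto).
  assert (Fz : finite_set (fun _ : T => False)) by (exists []; auto).
  destruct (cardf_sum_le P (fun _ => False) Q (fun x => P x /\ ~ Q x)) as [H1 _]; auto; try tauto.
  { intros x Hx. destruct (classic (Q x)); tauto. }
  destruct (cardf_sum_le Q (fun x => P x /\ ~ Q x) P (fun _ => False)) as [H2 _]; auto; try tauto.
  assert (cardf (fun _ : T => False) = 0).
  { rewrite (cardf_list []); auto; [constructor|simpl; tauto]. }
  lia.
Qed.

Lemma cardf_single {T : Type} (x : T) : cardf (fun y => y = x) = 1.
Proof.
  rewrite (cardf_list [x]); auto.
  - constructor; [intros []|constructor].
  - intros y. simpl. split; [intros [<-|[]]; auto|intros ->; auto].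
Qed.

Lemma finite_single {T : Type} (x : T) : finite_set (fun y => y = x).
Proof. exists [x]. intros w ->. left; auto. Qed.

(** * Homogeneous bipartite graphs *)

Section Bipartite.
Context {W : Type} (R : W -> W -> Prop) (col : W -> bool).
Hypothesis Hcol : forall x y, R x y -> col x = true /\ col y = false.
Hypothesis Hconn : connected R.
Hypothesis Hlf : locally_finite R.
Hypothesis Hhom : forall M, piso R M -> (forall p, In p M -> col (fst p) = col (snd p)) ->
  induced_connected R (fun v => In v (map fst M)) ->
  exists g, is_aut R g /\ forall p, In p M -> g (fst p) = snd p.

Lemma adj_col x y : adjU R x y -> col x <> col y.
Proof. intros [H|H]; apply Hcol in H; destruct H; congruence. Qed.

Lemma adj_R x y : col x = true -> (adjU R x y <-> R x y).
Proof.
  intros Hx. split; [|left; auto]. intros [H|H]; auto. apply Hcol in H. destruct H; congruence.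
Qed.

Lemma piso_bipartite M :
  (forall p, In p M -> col (fst p) = col (snd p)) ->
  (forall p q, In p M -> In q M -> (fst p = fst q <-> snd p = snd q)) ->
  (forall p q, In p M -> In q M -> (adjU R (fst p) (fst q) <-> adjU R (snd p) (snd q))) ->
  piso R M.
Proof.
  intros Hc He Ha p q Hp Hq. split; auto.
  assert (HR : forall a b, R a b <-> adjU R a b /\ col a = true).
  { intros a b. split.
    - intros H. split; [left; auto|apply Hcol in H; tauto].
    - intros [H Ca]. apply adj_R; auto. }
  rewrite !HR, (Ha p q Hp Hq), (Hc p Hp). tauto.
Qed.

Lemma hom_extend M :
  (forall p, In p M -> col (fst p) = col (snd p)) ->
  (forall p q, In p M -> In q M -> (fst p = fst q <-> snd p = snd q)) ->
  (forall p q, In p M -> In q M -> (adjU R (fst p) (fst q) <-> adjU R (snd p) (snd q))) ->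
  induced_connected R (fun v => In v (map fst M)) ->
  exists g, is_aut R g /\ forall p, In p M -> g (fst p) = snd p.
Proof. intros H1 H2 H3 H4. apply Hhom; auto. apply piso_bipartite; auto. Qed.

Lemma aut_adj g x y : is_aut R g -> (adjU R x y <-> adjU R (g x) (g y)).
Proof. intros Hg. apply aut_adjU; auto. Qed.

Lemma side_transitive x x' : col x = col x' -> exists g, is_aut R g /\ g x = x'.
Proof.
  intros H. destruct (hom_extend [(x, x')]) as [g [Hg HM]].
  - intros p [<-|[]]; auto.
  - intros p q [<-|[]] [<-|[]]. simpl. tauto.
  - intros p q [<-|[]] [<-|[]]. simpl.
    split; intros Ha; exfalso; apply (adj_col _ _ Ha); auto.
  - apply induced_connected_single.
  - exists g. split; auto. apply (HM (x, x')). left; auto.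
Qed.

Lemma swap_extend u u' L :
  ~ In u L -> ~ In u' L -> col u = col u' ->
  (forall t, In t L -> (adjU R u t <-> adjU R u' t)) ->
  induced_connected R (fun v => In v (u :: u' :: L)) ->
  exists g, is_aut R g /\ g u = u' /\ g u' = u /\ forall t, In t L -> g t = t.
Proof.
  intros N N' Hc Ha Hic.
  assert (Nu : forall a b, (a = u \/ a = u') -> (b = u \/ b = u') -> ~ adjU R a b).
  { intros a b H1 H2 H3. apply (adj_col a b H3). destruct H1, H2; subst; congruence. }
  assert (Ha' : forall t, In t L -> (adjU R t u <-> adjU R t u')).
  { intros t Ht. specialize (Ha t Ht). unfold adjU in *. tauto. }
  destruct (hom_extend ((u, u') :: (u', u) :: map (fun t => (t, t)) L)) as [g [Hg HM]].
  - intros p [<-|[<-|Hp]]; simpl; auto. apply in_map_iff in Hp. destruct Hp as [t [<- _]]. auto.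
  - intros p q Hp Hq.
    destruct Hp as [<-|[<-|Hp]], Hq as [<-|[<-|Hq]]; simpl;
      try (apply in_map_iff in Hp; destruct Hp as [t [<- Ht]]; simpl);
      try (apply in_map_iff in Hq; destruct Hq as [s [<- Hs]]; simpl); intuition congruence.
  - pose proof (Nu u u ltac:(auto) ltac:(auto)). pose proof (Nu u u' ltac:(auto) ltac:(auto)).
    pose proof (Nu u' u ltac:(auto) ltac:(auto)). pose proof (Nu u' u' ltac:(auto) ltac:(auto)).
    intros p q Hp Hq.
    destruct Hp as [<-|[<-|Hp]], Hq as [<-|[<-|Hq]]; simpl;
      try (apply in_map_iff in Hp; destruct Hp as [t [<- Ht]]; simpl);
      try (apply in_map_iff in Hq; destruct Hq as [s [<- Hs]]; simpl);
      try (pose proof (Ha s Hs)); try (pose proof (Ha' t Ht)); tauto.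
  - simpl. rewrite map_map. simpl. rewrite map_id. exact Hic.
  - exists g. split; auto. split; [apply (HM (u, u')); simpl; auto|].
    split; [apply (HM (u', u)); simpl; auto|].
    intros t Ht. apply (HM (t, t)). right; right. apply in_map_iff. exists t; auto.
Qed.

Lemma finite_adj v : finite_set (adjU R v).
Proof. apply finite_neighbours; auto. Qed.

Lemma degree_const x x' : col x = col x' -> cardf (adjU R x) = cardf (adjU R x').
Proof.
  intros H. destruct (side_transitive x x' H) as [g [Hg <-]].
  destruct (is_aut_inv R g Hg) as [h [_ [hg gh]]].
  apply cardf_bij with g h; auto; [apply finite_adj|]. intros y. apply aut_adj; auto.
Qed.

Definition common x x' (y : W) : Prop := adjU R x y /\ adjU R x' y.

Lemma finite_common x x' : finite_set (common x x').
Proof. apply finite_sub with (2 := finite_adj x). unfold common. tauto. Qed.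

(** [x], [y], [x'] form an induced path, which homogeneity carries to the other one. The witnesses
    [y], [y1] are what makes the two pairs connected. *)
Lemma common_const x x' y x1 x1' y1 :
  col x = col x1 -> x <> x' -> common x x' y -> x1 <> x1' -> common x1 x1' y1 ->
  cardf (common x x') = cardf (common x1 x1').
Proof.
  intros Hc N [A1 A2] N1 [B1 B2].
  assert (Cy : col y = col y1).
  { pose proof (adj_col _ _ A1). pose proof (adj_col _ _ B1).
    destruct (col x), (col y), (col x1), (col y1); congruence. }
  assert (Cx' : col x' = col x1').
  { pose proof (adj_col _ _ A2). pose proof (adj_col _ _ B2).
    destruct (col x'), (col y), (col x1'), (col y1); congruence. }
  assert (Cxx : col x = col x').
  { pose proof (adj_col _ _ A2). pose proof (adj_col _ _ A1).
    destruct (col x), (col y), (col x'); congruence. }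
  assert (Ny : x <> y /\ x' <> y /\ x1 <> y1 /\ x1' <> y1).
  { repeat split; intros ->; eapply adj_col; eauto. }
  destruct Ny as [Ny1 [Ny2 [Ny3 Ny4]]].
  assert (Nl : forall z, ~ adjU R z z) by (intros z Hz; apply (adj_col _ _ Hz); auto).
  assert (Nx : ~ adjU R x x' /\ ~ adjU R x' x /\ ~ adjU R x1 x1' /\ ~ adjU R x1' x1).
  { repeat split; intros Hx; apply (adj_col _ _ Hx); congruence. }
  pose proof (adjU_sym _ _ _ A1). pose proof (adjU_sym _ _ _ A2).
  pose proof (adjU_sym _ _ _ B1). pose proof (adjU_sym _ _ _ B2).
  destruct (hom_extend [(x, x1); (x', x1'); (y, y1)]) as [g [Hg HM]].
  - intros p [<-|[<-|[<-|[]]]]; auto.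
  - intros p q [<-|[<-|[<-|[]]]] [<-|[<-|[<-|[]]]]; simpl; split; congruence.
  - pose proof (Nl x). pose proof (Nl x'). pose proof (Nl y).
    pose proof (Nl x1). pose proof (Nl x1'). pose proof (Nl y1). clear Nl.
    intros p q [<-|[<-|[<-|[]]]] [<-|[<-|[<-|[]]]]; simpl; tauto.
  - apply induced_connected_cons with y; [|simpl; auto|auto].
    apply induced_connected_cons with y; [|simpl; auto|auto].
    apply induced_connected_single.
  - assert (G1 : g x = x1) by (apply (HM (x, x1)); simpl; auto).
    assert (G2 : g x' = x1') by (apply (HM (x', x1')); simpl; auto).
    destruct (is_aut_inv R g Hg) as [h [_ [hg gh]]].
    apply cardf_bij with g h; auto; [apply finite_common|].
    intros t. unfold common. rewrite (aut_adj g x t Hg), (aut_adj g x' t Hg), G1, G2. tauto.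
Qed.

Lemma star_connected x L :
  (forall t, In t L -> adjU R x t) -> induced_connected R (fun v => In v (x :: L)).
Proof.
  intros H.
  assert (Hx : forall v, In v (x :: L) -> conn R (fun v => In v (x :: L)) x v).
  { intros v [<-|Hv]; [apply conn_refl|]. apply conn_step; simpl; auto. }
  intros a b Ha Hb. apply conn_trans with x; auto. apply conn_sym; auto.
Qed.

Lemma connected_perm (L L' : list W) :
  (forall v, In v L <-> In v L') -> induced_connected R (fun v => In v L) ->
  induced_connected R (fun v => In v L').
Proof.
  intros H Hc a b Ha Hb. apply H in Ha, Hb. apply conn_mono with (fun v => In v L).
  - intros v. apply H.
  - apply Hc; auto.
Qed.

(** [x] and its neighbours induce a star, and any two leaves of a star may be exchanged. *)
Lemma neighbour_swap x y w : adjU R x y -> adjU R x w ->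
  exists g, is_aut R g /\ g x = x /\ g y = w /\ g w = y /\
    forall t, adjU R x t -> t <> y -> t <> w -> g t = t.
Proof.
  intros Hy Hw.
  destruct (finite_enum _ (finite_adj x)) as [A [_ HA]].
  set (F := filter (fun t => holds (t <> y /\ t <> w)) A).
  assert (HF : forall t, In t F <-> adjU R x t /\ t <> y /\ t <> w).
  { intros t. unfold F. rewrite filter_In, HA, holds_true. tauto. }
  assert (Nx : forall z, ~ adjU R z z) by (intros z Hz; apply (adj_col _ _ Hz); auto).
  destruct (swap_extend y w (x :: F)) as [g [Hg [G1 [G2 G3]]]].
  - intros [->|H]; [apply (Nx y); auto|]. apply HF in H. tauto.
  - intros [->|H]; [apply (Nx w); auto|]. apply HF in H. tauto.
  - pose proof (adj_col _ _ Hy). pose proof (adj_col _ _ Hw). destruct (col x), (col y), (col w); congruence.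
  - intros t [<-|Ht].
    + split; intros; apply adjU_sym; auto.
    + apply HF in Ht. destruct Ht as [Ht _].
      pose proof (adj_col _ _ Hy). pose proof (adj_col _ _ Hw). pose proof (adj_col _ _ Ht).
      split; intros Hx; pose proof (adj_col _ _ Hx); destruct (col x), (col y), (col w), (col t); congruence.
  - apply connected_perm with (x :: y :: w :: F).
    + intros v. simpl. tauto.
    + apply star_connected. intros t [<-|[<-|Ht]]; auto. apply HF in Ht. tauto.
  - exists g. repeat split; auto.
    + apply Hg.
    + apply Hg.
    + apply Hg.
    + apply G3. left; auto.
    + intros t Ht N1 N2. apply G3. right. apply HF. auto.
Qed.

(** The stars at [x] and [x'] are held together by [y0]; two vertices with the same adjacency to
    both centres may be exchanged. *)
Lemma pair_swap x x' y0 y w : adjU R x y0 -> adjU R x' y0 -> col y = col y0 -> col w = col y0 ->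
  (adjU R x y <-> adjU R x w) -> (adjU R x' y <-> adjU R x' w) ->
  adjU R x y \/ adjU R x' y ->
  exists g, is_aut R g /\ g x = x /\ g x' = x' /\ g y = w /\ g w = y /\
    forall t, adjU R x t \/ adjU R x' t -> t <> y -> t <> w -> g t = t.
Proof.
  intros A1 A2 Cy Cw Sx Sx' Hor.
  destruct (finite_enum _ (finite_or _ _ (finite_adj x) (finite_adj x'))) as [A [_ HA]].
  set (F := filter (fun t => holds (t <> y /\ t <> w)) A).
  assert (HF : forall t, In t F <-> (adjU R x t \/ adjU R x' t) /\ t <> y /\ t <> w).
  { intros t. unfold F. rewrite filter_In, HA, holds_true. tauto. }
  assert (Cx : col x <> col y0) by (apply adj_col; auto).
  assert (Cx' : col x' <> col y0) by (apply adj_col; auto).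
  destruct (swap_extend y w (x :: x' :: F)) as [g [Hg [G1 [G2 G3]]]].
  - intros [->|[->|H]]; [congruence|congruence|]. apply HF in H. tauto.
  - intros [->|[->|H]]; [congruence|congruence|]. apply HF in H. tauto.
  - congruence.
  - intros t [<-|[<-|Ht]].
    + split; intros Hq; apply adjU_sym; apply Sx; apply adjU_sym; auto.
    + split; intros Hq; apply adjU_sym; apply Sx'; apply adjU_sym; auto.
    + apply HF in Ht. destruct Ht as [Ht _].
      assert (Ct : col t = col y0).
      { destruct Ht as [Ht|Ht]; pose proof (adj_col _ _ Ht);
        destruct (col x), (col x'), (col t), (col y0); congruence. }
      split; intros Hx; pose proof (adj_col _ _ Hx); congruence.
  - set (L := y :: w :: x :: x' :: F).
    assert (Hy0 : In y0 L).
    { unfold L. simpl. rewrite HF. destruct (classic (y0 = y)), (classic (y0 = w)); subst; auto.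
      intuition. }
    assert (Hx : conn R (fun v => In v L) y0 x).
    { apply conn_step; auto; [unfold L; simpl; auto|apply adjU_sym; auto]. }
    assert (Hx' : conn R (fun v => In v L) y0 x').
    { apply conn_step; auto; [unfold L; simpl; auto|apply adjU_sym; auto]. }
    assert (Hall : forall v, In v L -> conn R (fun v => In v L) y0 v).
    { intros v Hv.
      assert (Hn : adjU R x v \/ adjU R x' v \/ v = x \/ v = x').
      { unfold L in Hv. destruct Hv as [<-|[<-|[<-|[<-|Hv]]]]; try tauto.
        apply HF in Hv. tauto. }
      destruct Hn as [Hn|[Hn|[->| ->]]]; auto.
      - apply conn_trans with x; auto. apply conn_step; auto. unfold L; simpl; auto.
      - apply conn_trans with x'; auto. apply conn_step; auto. unfold L; simpl; auto 6. }
    intros a b Ha Hb. apply conn_trans with y0; auto. apply conn_sym; auto.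
  - exists g. split; [auto|]. split; [apply G3; simpl; auto|]. split; [apply G3; simpl; auto|].
    split; [auto|]. split; [auto|]. intros t Ht N1 N2. apply G3. simpl. right; right. apply HF. auto.
Qed.

Lemma common_col x x' y : common x x' y -> col x' = col x.
Proof.
  intros [H1 H2]. pose proof (adj_col _ _ H1). pose proof (adj_col _ _ H2).
  destruct (col x), (col x'), (col y); congruence.
Qed.

Lemma has_neighbour (u v w : W) : u <> v -> exists w', adjU R w w'.
Proof.
  intros N. assert (exists t, t <> w) as [t Ht].
  { destruct (classic (u = w)) as [<-|]; eauto. }
  destruct (conn_crossing R (fun _ => True) (fun x => x = w) w t) as [p [q [_ [_ [Hpq [-> _]]]]]]; auto.
  - apply Hconn; auto.
  - eauto.
Qed.

(** Along a walk from [x], every vertex of its side keeps the neighbourhood of [x], because the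
    hypothesis carries it across each two-path. *)
Lemma complete_structure s :
  (forall x x' y t, col x = s -> common x x' y -> adjU R x t -> adjU R x' t) ->
  forall x y, col x = s -> col y <> s -> adjU R x y.
Proof.
  intros H x y Cx Cy.
  cut ((col y = s -> forall t, adjU R x t <-> adjU R y t) /\ (col y <> s -> adjU R x y)); [tauto|].
  apply (conn_invariant R (fun _ => True)
    (fun y => (col y = s -> forall t, adjU R x t <-> adjU R y t) /\ (col y <> s -> adjU R x y)) x y).
  - apply Hconn; auto.
  - split; [tauto|congruence].
  - intros p q _ _ Hpq [I1 I2]. pose proof (adj_col _ _ Hpq). split; intros Cq.
    + assert (Cp : col p <> s) by congruence. specialize (I2 Cp).
      assert (Hxq : common x q p) by (split; auto; apply adjU_sym; auto).
      intros t. split; [apply (H x q p t); auto|].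
      apply (H q x p t); auto. split; [apply adjU_sym; auto|auto].
    + assert (Cp : col p = s) by (destruct (col p), (col q), s; congruence).
      apply I1; auto.
Qed.

Section Side.
Variables (s : bool) (a c : nat).
Hypothesis Ha : forall x, col x = s -> cardf (adjU R x) = a.
Hypothesis Hc : forall x x' y, col x = s -> x <> x' -> common x x' y -> cardf (common x x') = c.

(** [b] and [x'] share [y1], hence have exactly [c] common neighbours. Among the neighbours of [x]
    these are the common neighbours of [x] and [x'] except [y0], that is [c - 1]; one is left
    outside. *)
Lemma outer_unique x x' y0 y1 w b z z' :
  col x = s -> common x x' y0 -> common x x' y1 -> y0 <> y1 -> b <> x' -> x <> x' ->
  adjU R x w -> ~ adjU R x' w ->
  (forall t, adjU R x t -> (adjU R b t <-> (adjU R x' t /\ t <> y0) \/ t = w)) ->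
  common x' b z -> ~ adjU R x z -> common x' b z' -> ~ adjU R x z' -> z = z'.
Proof.
  intros Cx C0 C1 N01 Nb Nx Hw Nw Tr Z NZ Z' NZ'. apply NNPP. intros Nz.
  assert (Cx' : col x' = s) by (rewrite (common_col _ _ _ C0); auto).
  assert (Cb : common x' b y1).
  { split; [apply C1|]. apply Tr; [apply C1|]. left. split; [apply C1|auto]. }
  pose proof (Hc x' b y1 Cx' (fun e => Nb (eq_sym e)) Cb) as K1.
  pose proof (Hc x x' y0 Cx Nx C0) as K2.
  set (P := fun t => (common x x' t /\ t <> y0) \/ t = z).
  assert (FP : finite_set P).
  { apply finite_or; [|apply finite_single]. apply finite_sub with (2 := finite_common x x'). tauto. }
  assert (H1 : cardf (common x x') + cardf (fun t => t = z) <= cardf P + cardf (fun t => t = y0)).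
  { apply cardf_sum_le; auto; [apply finite_single| | |].
    - intros t Ht. unfold P. destruct (classic (t = y0)); tauto.
    - intros t ->. left. right. auto.
    - intros t Ht ->. exfalso. apply NZ. apply Ht. }
  rewrite !cardf_single in H1.
  assert (H2 : cardf P < cardf (common x' b)).
  { apply cardf_lt with z'; auto; [apply finite_common| |].
    - intros t [[[T1 T2] T3]| ->]; auto. split; auto. apply Tr; auto.
    - intros [[[T1 T2] T3]|T]; auto. }
  lia.
Qed.

(** Compare traces on the neighbourhood N of [x]. Let C be the trace of [x']. Vertices [b], [b']
    have trace C without [y0] plus [w], and [b1] has C without [y1] plus [w]. By [outer_unique] each
    shares one vertex outside N with [x']: [z] for [b] and [b1], but [z'] for [b']. An automorphism
    exchanging [b] and [b'] and fixing N, [x'], [b1] fixes [z], which is adjacent to [b] and not to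
    [b']. The two vertices [y0], [y1] need [2 <= c]; the two vertices [z], [z'] need
    [c + 2 <= a]. *)
Lemma no_middle x x' y : col x = s -> x <> x' -> common x x' y -> 2 <= c -> c + 2 <= a -> False.
Proof.
  intros Cx Nx Cy Hc2 Hca.
  pose proof (Hc x x' y Cx Nx Cy) as K.
  assert (Cx' : col x' = s) by (rewrite (common_col _ _ _ Cy); auto).
  destruct (cardf_two _ (finite_common x x')) as [y0 [y1 [N01 [C0 C1]]]]; [lia|].
  assert (Hw : exists w, adjU R x w /\ ~ adjU R x' w).
  { pose proof (cardf_diff (adjU R x) (common x x') (finite_adj x) ltac:(unfold common; tauto)) as Kd.
    rewrite K, (Ha x Cx) in Kd.
    destruct (cardf_two (fun t => adjU R x t /\ ~ common x x' t)) as [w [_ [_ [Hw _]]]]; [|lia|].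
    - apply finite_sub with (2 := finite_adj x). tauto.
    - exists w. unfold common in Hw. tauto. }
  destruct Hw as [w [Hw Nw]].
  assert (Ny0w : y0 <> w) by (intros ->; apply Nw, C0).
  assert (Ny1w : y1 <> w) by (intros ->; apply Nw, C1).
  destruct (neighbour_swap x y0 w (proj1 C0) Hw) as [f [Hf [F1 [F2 [F3 F4]]]]].
  set (b := f x').
  assert (Trf : forall t, adjU R x t -> (adjU R b t <-> (adjU R x' t /\ t <> y0) \/ t = w)).
  { intros t Ht. destruct (classic (t = y0)) as [->|N0]; [|destruct (classic (t = w)) as [->|Nw']].
    - rewrite <- F3 at 1. unfold b. rewrite <- (aut_adj f x' w Hf). split; [tauto|].
      intros [[_ N]|N]; congruence.
    - rewrite <- F2 at 1. unfold b. rewrite <- (aut_adj f x' y0 Hf). split; auto. intros _. apply C0.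
    - rewrite <- (F4 t Ht N0 Nw') at 1. unfold b. rewrite <- (aut_adj f x' t Hf). tauto. }
  assert (Nb : b <> x').
  { intros E0. apply Nw. rewrite <- E0. apply Trf; auto. }
  assert (Hz : exists z, common x' b z /\ ~ adjU R x z).
  { apply NNPP. intros N.
    assert (Cb : common x' b y1).
    { split; [apply C1|]. apply Trf; [apply C1|]. left. split; [apply C1|auto]. }
    pose proof (Hc x' b y1 Cx' (fun e => Nb (eq_sym e)) Cb) as K1.
    assert (cardf (common x' b) < cardf (common x x')); [|lia].
    apply cardf_lt with y0; auto; [apply finite_common| |].
    - intros t [T1 T2]. split; auto. apply NNPP. intros T3. apply N. exists t. split; [split|]; auto.
    - intros [T1 T2]. apply Trf in T2; [|apply C0]. destruct T2 as [[_ T2]|T2]; congruence. }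
  destruct Hz as [z [Cz NZ]].
  assert (Hz' : exists z', adjU R x' z' /\ ~ adjU R x z' /\ z' <> z).
  { pose proof (cardf_diff (adjU R x') (common x x') (finite_adj x') ltac:(unfold common; tauto)) as Kd.
    rewrite K, (Ha x' Cx') in Kd.
    destruct (cardf_two (fun t => adjU R x' t /\ ~ common x x' t)) as [p [q [Npq [Hp Hq]]]]; [|lia|].
    - apply finite_sub with (2 := finite_adj x'). tauto.
    - unfold common in *. destruct (classic (p = z)) as [->|]; [exists q|exists p]; intuition. }
  destruct Hz' as [z' [Hz' [NZ' Nzz]]].
  assert (Nout : forall u v, col u = s -> adjU R u v -> col v <> s).
  { intros u v Cu Huv. pose proof (adj_col _ _ Huv). congruence. }
  assert (Colne : forall u v t, col u = s -> col v = s -> adjU R u t -> forall t', adjU R v t' -> col t = col t').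
  { intros u v t Cu Cv Ht t' Ht'. pose proof (adj_col _ _ Ht). pose proof (adj_col _ _ Ht').
    destruct (col u), (col v), (col t), (col t'); congruence. }
  (* [h] fixes [x], [x'] and N and takes [z] to [z'], so the image of [b] keeps its trace and
     changes its outer vertex. *)
  destruct (pair_swap x x' y0 z z' (proj1 C0) (proj2 C0)) as [h [Hh [H1 [H2 [H3 [_ H4]]]]]].
  { apply (Colne x' x); auto; [apply Cz|apply C0]. }
  { apply (Colne x' x); auto. apply C0. }
  { tauto. }
  { pose proof (proj1 Cz). tauto. }
  { right. apply Cz. }
  (* [k] fixes [z], so the image of [b] keeps its outer vertex; it now misses [y1], which tells it
     apart from [b] and [b']. *)
  destruct (pair_swap x x' y0 y0 y1 (proj1 C0) (proj2 C0)) as [k [Hk [K1 [K2 [K3 [K3' K4]]]]]].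
  { auto. }
  { apply (Colne x x); auto; [apply C1|apply C0]. }
  { pose proof (proj1 C0). pose proof (proj1 C1). tauto. }
  { pose proof (proj2 C0). pose proof (proj2 C1). tauto. }
  { left. apply C0. }
  set (b' := h b). set (b1 := k b).
  assert (Trh : forall t, adjU R x t -> (adjU R b' t <-> (adjU R x' t /\ t <> y0) \/ t = w)).
  { intros t Ht. rewrite <- (H4 t (or_introl Ht)) at 1.
    - unfold b'. rewrite <- (aut_adj h b t Hh). auto.
    - intros ->; auto.
    - intros ->; auto. }
  assert (Trk : forall t, adjU R x t -> (adjU R b1 t <-> (adjU R x' t /\ t <> y1) \/ t = w)).
  { intros t Ht. destruct (classic (t = y0)) as [->|N0]; [|destruct (classic (t = y1)) as [->|N1]].
    - rewrite <- K3' at 1. unfold b1. rewrite <- (aut_adj k b y1 Hk), (Trf y1 (proj1 C1)).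
      pose proof (proj2 C0). pose proof (proj2 C1). clear - H N01 Ny0w Ny1w H0. intuition congruence.
    - rewrite <- K3 at 1. unfold b1. rewrite <- (aut_adj k b y0 Hk), (Trf y0 (proj1 C0)).
      clear - N01 Ny0w Ny1w. intuition congruence.
    - rewrite <- (K4 t (or_introl Ht) N0 N1) at 1. unfold b1. rewrite <- (aut_adj k b t Hk), (Trf t Ht).
      clear - N0 N1. intuition congruence. }
  assert (Nw' : forall v, (adjU R v w) -> v <> x') by (intros v Hv ->; auto).
  assert (Wb : adjU R b w) by (apply Trf; auto).
  assert (Wb' : adjU R b' w) by (apply Trh; auto).
  assert (Wb1 : adjU R b1 w) by (apply Trk; auto).
  assert (Zb1 : adjU R b1 z).
  { rewrite <- (K4 z).
    - unfold b1. apply (aut_adj k b z Hk). apply Cz.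
    - right. apply Cz.
    - intros ->. apply NZ. apply C0.
    - intros ->. apply NZ. apply C1. }
  assert (Zb' : adjU R b' z').
  { rewrite <- H3. unfold b'. apply (aut_adj h b z Hh). apply Cz. }
  assert (Nb'z : ~ adjU R b' z).
  { intros H. apply Nzz.
    apply (outer_unique x x' y0 y1 w b' z' z); auto; [split|split]; auto. apply Cz. }
  assert (Yb : adjU R b y1) by (apply Trf; [apply C1|left; split; [apply C1|auto]]).
  assert (Yb' : adjU R b' y1) by (apply Trh; [apply C1|left; split; [apply C1|auto]]).
  assert (Yb1 : ~ adjU R b1 y1) by (rewrite (Trk y1 (proj1 C1)); intros [[_ N]|N]; auto).
  assert (Cb : forall v, adjU R v w -> col v = s).
  { intros v Hv. pose proof (adj_col _ _ Hv). pose proof (adj_col _ _ Hw).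
    destruct (col v), (col w), (col x); congruence. }
  assert (inj : forall g u v, is_aut R g -> g u = g v -> u = v).
  { intros g u v [[g' [G _]] _] Hg. rewrite <- (G u), Hg. auto. }
  assert (Nbx : b <> x).
  { intros H. apply Nx. apply (inj f); auto. rewrite F1. auto. }
  assert (Nbx' : b' <> x).
  { intros H. apply Nbx. apply (inj h); auto. rewrite H1. auto. }
  destruct (finite_enum _ (finite_adj x)) as [A [_ HA]].
  assert (NA : forall v, adjU R v w -> ~ In v A).
  { intros v Hv Hi. apply HA in Hi. apply (Nout x v Cx Hi). auto. }
  destruct (swap_extend b b' (x :: x' :: b1 :: A)) as [g [Hg [G1 [G2 G3]]]].
  - intros [H|[H|[H|H]]]; [auto|apply Nb; auto|congruence|apply (NA b); auto].
  - intros [H|[H|[H|H]]]; [auto|apply (Nw' b'); auto|congruence|apply (NA b'); auto].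
  - rewrite (Cb b), (Cb b'); auto.
  - assert (Hsame : forall t, col t = s -> (adjU R b t <-> adjU R b' t)).
    { intros t Ct. split; intros Hx; exfalso; apply (adj_col _ _ Hx); rewrite Ct; auto. }
    intros t [<-|[<-|[<-|Ht]]]; auto. apply HA in Ht. rewrite (Trf t Ht), (Trh t Ht). tauto.
  - assert (Hwx : In w (x :: A)) by (right; apply HA; auto).
    apply connected_perm with (b :: b' :: b1 :: x' :: x :: A); [intros v; simpl; tauto|].
    apply induced_connected_cons with w; [|simpl; auto 10|auto].
    apply induced_connected_cons with w; [|simpl; auto 10|auto].
    apply induced_connected_cons with w; [|simpl; auto 10|auto].
    apply induced_connected_cons with y0; [|right; apply HA; apply C0|apply C0].
    apply star_connected. intros t Ht. apply HA; auto.
    all: destruct Hwx as [Hwx|Hwx]; auto 10.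
  - assert (Gz : g z = z).
    { apply (outer_unique x x' y1 y0 w b1 (g z) z); auto.
      - split; [rewrite <- (G3 x') by (simpl; auto)|rewrite <- (G3 b1) by (simpl; auto)];
          apply (aut_adj g _ z Hg); auto. apply Cz.
      - rewrite <- (G3 x) by (simpl; auto). rewrite <- (aut_adj g x z Hg). auto.
      - split; auto. apply Cz. }
    apply Nb'z. rewrite <- G1, <- Gz. apply (aut_adj g b z Hg). apply Cz.
Qed.
Section AlmostComplete.
Hypothesis Hc2 : 2 <= c.
Hypothesis Hac : a = c + 1.
Hypothesis Hex : exists x x' y, col x = s /\ x <> x' /\ common x x' y.

(** Sharing a neighbour is transitive on the side: among the [c + 1] neighbours of the middle vertex
    [x2], two subsets of size [c] must meet, as [2 * c > c + 1]. *)
Lemma all_share x x' : col x = s -> col x' = s -> exists y, common x x' y.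
Proof.
  intros Cx Cx'. destruct Hex as [e [e' [_ [_ [Ne _]]]]].
  cut ((col x' = s -> exists y, common x x' y) /\
       (col x' <> s -> exists x2, col x2 = s /\ adjU R x2 x' /\ exists y, common x x2 y)); [tauto|].
  apply (conn_invariant R (fun _ => True) (fun v =>
     (col v = s -> exists y, common x v y) /\
     (col v <> s -> exists x2, col x2 = s /\ adjU R x2 v /\ exists y, common x x2 y)) x x').
  - apply Hconn; auto.
  - split; [|congruence]. intros _. destruct (has_neighbour e e' x Ne) as [y Hy]. exists y. split; auto.
  - intros p q _ _ Hpq [I1 I2]. pose proof (adj_col _ _ Hpq). split; intros Cq.
    + destruct (I2 ltac:(congruence)) as [x2 [C2 [A2 [y Hy]]]].
      assert (Hp : common x2 q p) by (split; auto; apply adjU_sym; auto).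
      destruct (classic (x = x2)) as [->|N1]; [eauto|].
      destruct (classic (x2 = q)) as [->|N2]; [eauto|].
      apply NNPP. intros N.
      assert (Fz : finite_set (fun _ : W => False)) by (exists []; auto).
      destruct (cardf_sum_le (common x x2) (common x2 q) (adjU R x2) (fun _ => False)) as [K _]; auto.
      * apply finite_adj.
      * intros t [_ Ht]; auto.
      * intros t [Ht _]; auto.
      * intros t [T1 T2] [T3 T4]. exfalso. apply N. exists t. split; auto.
      * rewrite (Hc x x2 y), (Hc x2 q p), (Ha x2) in K by auto.
        replace (cardf (fun _ : W => False)) with 0 in K; [lia|].
        rewrite (cardf_list []); auto; [constructor|simpl; tauto].
    + assert (Cp : col p = s) by (destruct (col p), (col q), s; congruence).
      exists p. auto.
Qed.

Lemma one_missing (x x' : W) : col x = s -> col x' = s -> x <> x' ->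
  exists z, adjU R x z /\ ~ adjU R x' z /\ forall z', adjU R x z' -> ~ adjU R x' z' -> z' = z.
Proof.
  intros Cx Cx' N. destruct (all_share x x' Cx Cx') as [y Hy].
  pose proof (cardf_diff (adjU R x) (common x x') (finite_adj x) ltac:(unfold common; tauto)) as K.
  rewrite (Ha x Cx), (Hc x x' y Cx N Hy) in K.
  assert (F : finite_set (fun t => adjU R x t /\ ~ common x x' t)).
  { apply finite_sub with (2 := finite_adj x). tauto. }
  destruct (cardf_card _ F) as [l [Nl [Ll Hl]]].
  destruct l as [|z [|z1 l]]; simpl in Ll; try lia.
  exists z. assert (Hz : adjU R x z /\ ~ common x x' z) by (apply Hl; simpl; auto).
  unfold common in Hz. split; [tauto|]. split; [tauto|]. intros z' H1 H2.
  assert (Hi : In z' [z]) by (apply Hl; unfold common; tauto).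
  destruct Hi as [<-|[]]; auto.
Qed.

(** [z1] and [z2] are the only neighbours of [x1] and [x2] outside the neighbourhood of [x]. As they
    differ, all common neighbours of [x1] and [x2] are neighbours of [x]; if [y2] were not [y1], it
    would be one more common neighbour of [x] and [x1], against the constant count. *)
Lemma missing_agree (x x1 x2 z1 z2 y1 y2 : W) :
  col x = s -> col x1 = s -> col x2 = s -> x1 <> x -> x2 <> x ->
  adjU R x1 z1 -> ~ adjU R x z1 -> adjU R x2 z2 -> ~ adjU R x z2 -> z1 <> z2 ->
  adjU R x y1 -> ~ adjU R x1 y1 -> adjU R x y2 -> ~ adjU R x2 y2 -> y1 = y2.
Proof.
  intros C C1 C2 N1 N2 A1 B1 A2 B2 Nz D1 E1 D2 E2. apply NNPP. intros Ny.
  destruct (one_missing x1 x C1 C N1) as [w1 [_ [_ U1]]].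
  destruct (one_missing x2 x C2 C N2) as [w2 [_ [_ U2]]].
  assert (N12 : x1 <> x2).
  { intros ->. apply Nz. rewrite (U2 z1), (U2 z2); auto. }
  destruct (all_share x1 x2 C1 C2) as [y Hy].
  destruct (all_share x x1 C C1) as [y' Hy'].
  assert (Hin : forall t, common x1 x2 t -> adjU R x t).
  { intros t [T1 T2]. apply NNPP. intros T. apply Nz.
    rewrite (U1 z1), <- (U1 t), (U2 z2), <- (U2 t); auto. }
  assert (K : cardf (common x1 x2) < cardf (common x x1)).
  { apply cardf_lt with y2; [apply finite_common| | |].
    - intros t Ht. split; [apply Hin; auto|apply Ht].
    - split; auto. apply NNPP. intros T. apply Ny.
      destruct (one_missing x x1 C C1 (fun e => N1 (eq_sym e))) as [w [_ [_ U]]].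
      rewrite (U y1), (U y2); auto.
    - intros [_ T]. auto. }
  rewrite (Hc x1 x2 y), (Hc x x1 y') in K by auto. lia.
Qed.

Lemma move_missing x x1 y1 y : col x = s -> adjU R x y1 -> ~ adjU R x1 y1 -> adjU R x y ->
  exists x3, col x3 = col x1 /\ ~ adjU R x3 y /\ (x1 <> x -> x3 <> x).
Proof.
  intros C A1 N1 A. destruct (neighbour_swap x y1 y A1 A) as [g [Hg [G1 [G2 [G3 G4]]]]].
  exists (g x1). split; [|split].
  - destruct Hex as [e [e' [_ [_ [Ne _]]]]]. destruct (has_neighbour e e' x1 Ne) as [t Ht].
    destruct Hg as [_ Hg]. destruct Ht as [Ht|Ht]; pose proof (Hcol _ _ Ht) as K1;
      apply (proj1 (Hg _ _)) in Ht; apply Hcol in Ht; destruct K1, Ht; congruence.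
  - rewrite <- G2, <- (aut_adj g x1 y1 Hg). auto.
  - intros N E0. apply N. destruct Hg as [[h [hg _]] _]. transitivity (h (g x1)); [auto|].
    rewrite E0. transitivity (h (g x)); [rewrite G1; auto|auto].
Qed.

(** Neighbours [x1] of [z1] and [x2] of [z2] miss the same neighbour [y1] of [x]. Moving the missing
    neighbour of [x1] to another [y3] yields [x3], whose neighbour outside that of [x] differs from
    [z1] or [z2]; [missing_agree] then gives [y3 = y1]. *)
Lemma nonneighbour_unique (x z1 z2 : W) : col x = s -> col z1 <> s -> col z2 <> s ->
  ~ adjU R x z1 -> ~ adjU R x z2 -> z1 = z2.
Proof.
  intros C C1 C2 N1 N2. apply NNPP. intros Nz.
  assert (Hn : forall z, col z <> s -> ~ adjU R x z -> exists x', col x' = s /\ x' <> x /\ adjU R x' z).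
  { intros z Cz Nz0. destruct Hex as [e [e' [_ [_ [Ne _]]]]].
    destruct (has_neighbour e e' z Ne) as [t Ht]. exists t. pose proof (adj_col _ _ Ht).
    split; [destruct (col z), (col t), s; congruence|]. split; [|apply adjU_sym; auto].
    intros ->. apply Nz0. apply adjU_sym; auto. }
  destruct (Hn z1 C1 N1) as [x1 [Cx1 [Nx1 A1]]], (Hn z2 C2 N2) as [x2 [Cx2 [Nx2 A2]]].
  destruct (one_missing x x1 C Cx1 (fun e => Nx1 (eq_sym e))) as [y1 [B1 [D1 _]]].
  destruct (one_missing x x2 C Cx2 (fun e => Nx2 (eq_sym e))) as [y2 [B2 [D2 _]]].
  assert (y1 = y2) by (apply (missing_agree x x1 x2 z1 z2); auto). subst y2.
  assert (exists y3, adjU R x y3 /\ y3 <> y1) as [y3 [B3 N3]].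
  { destruct (cardf_two _ (finite_adj x)) as [p [q [Npq [Hp Hq]]]]; [rewrite (Ha x C); lia|].
    destruct (classic (p = y1)) as [->|]; eauto. }
  destruct (move_missing x x1 y1 y3 C B1 D1 B3) as [x3 [C3 [M3 Nx3]]].
  rewrite Cx1 in C3. specialize (Nx3 Nx1).
  destruct (one_missing x3 x C3 C Nx3) as [z3 [A3 [Nz3 _]]].
  apply N3. destruct (classic (z3 = z1)) as [->|Nz31].
  - apply (missing_agree x x3 x2 z1 z2); auto.
  - apply (missing_agree x x3 x1 z3 z1); auto.
Qed.

Lemma second_vertex (x : W) : col x = s -> exists x', col x' = s /\ x' <> x.
Proof.
  intros C. destruct Hex as [e [e' [y [Ce [Ne Hy]]]]].
  pose proof (common_col _ _ _ Hy). destruct (classic (e = x)) as [->|]; [exists e'|exists e]; split; congruence.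
Qed.

Lemma nonneighbour_exists x : col x = s -> exists z, col z <> s /\ ~ adjU R x z.
Proof.
  intros C. destruct (second_vertex x C) as [x' [C' N]].
  destruct (one_missing x' x C' C N) as [z [A [Nz _]]]. exists z. split; auto.
  pose proof (adj_col _ _ A). congruence.
Qed.

Lemma nonneighbour_inj (x x' z : W) : col x = s -> col x' = s -> col z <> s ->
  ~ adjU R x z -> ~ adjU R x' z -> x = x'.
Proof.
  intros C C' Cz N N'. apply NNPP. intros Nx.
  destruct (one_missing x x' C C' Nx) as [t [A [Nt _]]].
  pose proof (adj_col _ _ A).
  assert (t = z) by (apply (nonneighbour_unique x'); auto; congruence). subst t. auto.
Qed.

Lemma nonneighbour_surj z : col z <> s -> exists x, col x = s /\ ~ adjU R x z.
Proof.
  intros Cz. destruct Hex as [e [e' [_ [_ [Ne _]]]]].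
  destruct (has_neighbour e e' z Ne) as [x Hx]. pose proof (adj_col _ _ Hx).
  assert (C : col x = s) by (destruct (col x), (col z), s; congruence).
  destruct (second_vertex x C) as [x1 [C1 N1]].
  destruct (one_missing x x1 C C1 (fun e => N1 (eq_sym e))) as [y1 [A1 [M1 _]]].
  destruct (move_missing x x1 y1 z C A1 M1 (adjU_sym _ _ _ Hx)) as [x3 [C3 [M3 _]]].
  exists x3. split; auto. congruence.
Qed.

End AlmostComplete.
End Side.
End Bipartite.

(** * Homogeneous bipartite graphs without four-cycles *)

Definition is_cycle {V : Type} (E : V -> V -> Prop) (x : V) (l : list V) : Prop :=
  NoDup (x :: l) /\ 2 <= length l /\ adj_chain E x l /\ adjU E (last l x) x.

Lemma cycle_rotate {V : Type} (E : V -> V -> Prop) x y l :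
  is_cycle E x (y :: l) -> is_cycle E y (l ++ [x]).
Proof.
  intros [N [L [[C1 C2] Cl]]]. split; [|split; [|split]].
  - rewrite app_comm_cons. apply NoDup_cons_iff in N. destruct N as [Nx N].
    apply NoDup_app; auto.
    + constructor; [intros []|constructor].
    + intros v Hv [<-|[]]; auto.
  - rewrite length_app. simpl in *. lia.
  - apply adj_chain_app. split; auto. rewrite last_cons in Cl. simpl. auto.
  - rewrite last_last. auto.
Qed.

Section FourCycleFree.
Context {W : Type} (R : W -> W -> Prop) (col : W -> bool).
Hypothesis Hcol : forall x y, R x y -> col x = true /\ col y = false.
Hypothesis Hconn : connected R.
Hypothesis Hlf : locally_finite R.
Hypothesis Hhom : forall M, piso R M -> (forall p, In p M -> col (fst p) = col (snd p)) ->
  induced_connected R (fun v => In v (map fst M)) ->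
  exists g, is_aut R g /\ forall p, In p M -> g (fst p) = snd p.
Hypothesis HC4 : forall u u' v v', u <> u' -> v <> v' ->
  adjU R u v -> adjU R u v' -> adjU R u' v -> adjU R u' v' -> False.

Let adjc := adj_col R col Hcol.

Lemma col_opp (u v w : W) : adjU R u v -> adjU R v w -> col u = col w.
Proof.
  intros H1 H2. apply adjc in H1, H2. destruct (col u), (col v), (col w); congruence.
Qed.

Lemma same_col_nonadj u v : col u = col v -> ~ adjU R u v.
Proof. intros H H'. apply (adjc _ _ H'); auto. Qed.

Definition hexagon (v0 v1 v2 v3 v4 v5 : W) : Prop :=
  (adjU R v0 v1 /\ adjU R v1 v2 /\ adjU R v2 v3 /\ adjU R v3 v4 /\ adjU R v4 v5 /\ adjU R v5 v0) /\
  (v0 <> v2 /\ v2 <> v4 /\ v0 <> v4) /\ (v1 <> v3 /\ v3 <> v5 /\ v1 <> v5).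

Lemma hexagon_rotate v0 v1 v2 v3 v4 v5 :
  hexagon v0 v1 v2 v3 v4 v5 -> hexagon v1 v2 v3 v4 v5 v0.
Proof. unfold hexagon. intuition. Qed.

(** Without four-cycles a non-backtracking path of length four is induced, so it is an image of the
    path from [v0] to [v4], and the image of [v5] closes it. *)
Lemma four_path_closes v0 v1 v2 v3 v4 v5 a0 a1 a2 a3 a4 :
  hexagon v0 v1 v2 v3 v4 v5 -> col a0 = col v0 ->
  adjU R a0 a1 -> adjU R a1 a2 -> adjU R a2 a3 -> adjU R a3 a4 ->
  a0 <> a2 -> a2 <> a4 -> a1 <> a3 -> exists a5, adjU R a0 a5 /\ adjU R a4 a5.
Proof.
  intros [[V01 [V12 [V23 [V34 [V45 V50]]]]] [[D02 [D24 D04]] [D13 _]]] Hc A01 A12 A23 A34 N02 N24 N13.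
  assert (N04 : a0 <> a4).
  { intros <-. apply (HC4 a0 a2 a1 a3); auto; apply adjU_sym; auto. }
  assert (P03 : ~ adjU R v0 v3).
  { intros H. apply (HC4 v0 v2 v1 v3); auto. apply adjU_sym; auto. }
  assert (P14 : ~ adjU R v1 v4).
  { intros H. apply (HC4 v1 v3 v2 v4); auto. apply adjU_sym; auto. }
  assert (Q03 : ~ adjU R a0 a3).
  { intros H. apply (HC4 a0 a2 a1 a3); auto. apply adjU_sym; auto. }
  assert (Q14 : ~ adjU R a1 a4).
  { intros H. apply (HC4 a1 a3 a2 a4); auto. apply adjU_sym; auto. }
  assert (Cv : col v2 = col v0 /\ col v4 = col v0 /\ col v3 = col v1 /\ col v1 <> col v0).
  { pose proof (adjc _ _ V01). pose proof (col_opp _ _ _ V01 V12). pose proof (col_opp _ _ _ V12 V23).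
    pose proof (col_opp _ _ _ V23 V34). repeat split; congruence. }
  assert (Ca : col a2 = col v0 /\ col a4 = col v0 /\ col a3 = col v1 /\ col a1 = col v1).
  { pose proof (adjc _ _ A01). pose proof (col_opp _ _ _ A01 A12). pose proof (col_opp _ _ _ A12 A23).
    pose proof (col_opp _ _ _ A23 A34).
    assert (col a1 = col v1) by (destruct (col a1), (col v1), (col v0); intuition congruence).
    repeat split; congruence. }
  destruct Cv as [Cv2 [Cv4 [Cv3 Cv1]]], Ca as [Ca2 [Ca4 [Ca3 Ca1]]].
  destruct (hom_extend R col Hcol Hhom [(v0, a0); (v1, a1); (v2, a2); (v3, a3); (v4, a4)])
    as [g [Hg HM]].
  - intros p [<-|[<-|[<-|[<-|[<-|[]]]]]]; simpl; congruence.
  - intros p q [<-|[<-|[<-|[<-|[<-|[]]]]]] [<-|[<-|[<-|[<-|[<-|[]]]]]]; simpl; split; congruence.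
  - intros p q [<-|[<-|[<-|[<-|[<-|[]]]]]] [<-|[<-|[<-|[<-|[<-|[]]]]]]; simpl;
    (split; intros Hx;
     solve [assumption | apply adjU_sym; assumption
           | exfalso; apply (fun e => same_col_nonadj _ _ e Hx); congruence
           | exfalso; apply adjU_sym in Hx; auto | exfalso; auto]).
  - apply induced_connected_cons with v1; [|simpl; auto|auto].
    apply induced_connected_cons with v2; [|simpl; auto|auto].
    apply induced_connected_cons with v3; [|simpl; auto|auto].
    apply induced_connected_cons with v4; [|simpl; auto|auto].
    apply induced_connected_single.
  - assert (G0 : g v0 = a0) by (apply (HM (v0, a0)); simpl; auto).
    assert (G4 : g v4 = a4) by (apply (HM (v4, a4)); simpl; auto 6).
    exists (g v5). rewrite <- G0, <- G4, <- (aut_adjU R g v0 v5 Hg), <- (aut_adjU R g v4 v5 Hg).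
    split; auto. apply adjU_sym; auto.
Qed.

(** Four-paths close, so distance four does not occur on this side and connecting walks shorten to
    length two. With the colours read as points and lines this is an axiom of projective planes;
    [hexagon_rotate] gives its dual. *)
Lemma hexagon_collinear v0 v1 v2 v3 v4 v5 p r :
  hexagon v0 v1 v2 v3 v4 v5 -> col p = col v0 -> col r = col v0 ->
  p = r \/ exists n, adjU R p n /\ adjU R r n.
Proof.
  intros Hx Cp Cr.
  set (near := fun q => p = q \/ exists n, adjU R p n /\ adjU R q n).
  cut ((col r = col v0 -> near r) /\ (col r <> col v0 -> exists q, adjU R q r /\ near q)); [unfold near; tauto|].
  apply (conn_invariant R (fun _ => True) (fun r =>
    (col r = col v0 -> near r) /\ (col r <> col v0 -> exists q, adjU R q r /\ near q)) p r).
  - apply Hconn; auto.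
  - split; [left; auto|congruence].
  - intros m t _ _ Hmt [I1 I2]. pose proof (adjc _ _ Hmt) as Hne. split; intros Ct.
    + destruct (I2 ltac:(congruence)) as [q [Hq Nq]].
      destruct Nq as [<-|[n [Pn Qn]]]; [right; exists m; split; auto; apply adjU_sym; auto|].
      destruct (classic (q = t)) as [<-|Nqt]; [right; eauto|].
      destruct (classic (p = q)) as [<-|Npq]; [right; exists m; split; auto; apply adjU_sym; auto|].
      destruct (classic (n = m)) as [->|Nnm]; [right; exists m; split; auto; apply adjU_sym; auto|].
      right. apply (four_path_closes v0 v1 v2 v3 v4 v5 p n q m t); auto. apply adjU_sym; auto.
    + exists m. split; auto. apply I1. destruct (col m), (col t), (col v0); congruence.
Qed.

Lemma third_neighbour v p q : 3 <= cardf (adjU R v) -> exists r, adjU R v r /\ r <> p /\ r <> q.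
Proof.
  intros H. apply NNPP. intros N.
  assert (Hle : cardf (adjU R v) <= cardf (fun t => t = p \/ t = q)).
  { apply cardf_le; [apply finite_or; apply finite_single|].
    intros t Ht. apply NNPP. intros Nt. apply N. exists t. tauto. }
  assert (F0 : finite_set (fun _ : W => False)) by (exists []; auto).
  destruct (cardf_sum_le (fun t => t = p \/ t = q) (fun _ => False) (fun t => t = p) (fun t => t = q))
    as [K _]; try apply finite_single; try tauto.
  rewrite !cardf_single in K. lia.
Qed.

(* A hexagon with a vertex of degree three generates a projective plane; there, a
   line through a point of [l] off the others may or may not pass through [s]. *)
Lemma no_plane v0 v1 v2 v3 v4 v5 :
  hexagon v0 v1 v2 v3 v4 v5 -> 3 <= cardf (adjU R v0) -> False.
Proof.
  intros Hx Hdeg. pose proof (hexagon_rotate _ _ _ _ _ _ Hx) as Hx'.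
  pose proof (hexagon_collinear v0 v1 v2 v3 v4 v5) as Lines.
  pose proof (hexagon_collinear v1 v2 v3 v4 v5 v0) as Points.
  assert (Hdeg' : forall l, col l = col v0 -> 3 <= cardf (adjU R l)).
  { intros l Cl. rewrite (degree_const R col Hcol Hlf Hhom l v0 Cl). auto. }
  assert (Hpt : forall p, col p = col v1 -> exists l l', l <> l' /\ adjU R p l /\ adjU R p l').
  { intros p Cp. destruct (side_transitive R col Hcol Hhom v1 p (eq_sym Cp)) as [g [Hg <-]].
    destruct Hx as [[V01 [V12 _]] [[D02 _] _]]. exists (g v0), (g v2). split; [|split].
    - intros e. apply D02. destruct Hg as [[h [hg _]] _]. rewrite <- (hg v0), e; auto.
    - rewrite <- (aut_adjU R g v1 v0 Hg). apply adjU_sym; auto.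
    - rewrite <- (aut_adjU R g v1 v2 Hg). auto. }
  assert (V01 : adjU R v0 v1) by apply Hx. assert (C01 := adjc _ _ V01).
  set (l := v0).
  destruct (third_neighbour l l l Hdeg) as [p [Lp _]].
  destruct (third_neighbour l p p Hdeg) as [q [Lq [Npq _]]].
  destruct (third_neighbour l p q Hdeg) as [r [Lr [Npr Nqr]]].
  assert (Cpt : forall t u, col u = col v0 -> adjU R u t -> col t = col v1).
  { intros t u Cu Ht. apply adjc in Ht. unfold l in *. destruct (col u), (col t), (col v0), (col v1); congruence. }
  assert (Cln : forall t u, col u = col v1 -> adjU R u t -> col t = col v0).
  { intros t u Cu Ht. apply adjc in Ht. destruct (col u), (col t), (col v0), (col v1); congruence. }
  assert (Hother : forall t, adjU R l t -> exists m, adjU R t m /\ m <> l).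
  { intros t Ht. destruct (Hpt t (Cpt t l eq_refl Ht)) as [m [m' [Nm [Hm Hm']]]].
    destruct (classic (m = l)) as [->|]; eauto. }
  destruct (Hother p Lp) as [m [Pm Nm]]. destruct (Hother q Lq) as [n [Qn Nn]].
  assert (Meet : forall t t' u u', adjU R t u -> adjU R t' u -> adjU R t u' -> adjU R t' u' -> u <> u' -> t = t').
  { intros t t' u u' H1 H2 H3 H4 Nu. apply NNPP. intros Nt. apply (HC4 t t' u u'); auto. }
  assert (Symm : forall u v, adjU R u v -> adjU R v u) by (intros; apply adjU_sym; auto).
  assert (Cm : col m = col v0) by (apply (Cln m p); auto; apply (Cpt p l); auto).
  assert (Cn : col n = col v0) by (apply (Cln n q); auto; apply (Cpt q l); auto).
  assert (Nmn : m <> n).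
  { intros <-. apply Npq. symmetry. apply (Meet p q l m); auto. }
  assert (Hs : exists s, adjU R m s /\ adjU R n s).
  { destruct (Lines m n Hx Cm Cn) as [E0|[s Hs]]; [congruence|eauto]. }
  destruct Hs as [s [Ms Ns]].
  assert (NLs : ~ adjU R l s).
  { intros H. assert (s = p) by (apply (Meet s p l m); auto). subst s.
    apply Npq. symmetry. apply (Meet p q l n); auto. }
  assert (Cs : col s = col v1) by (apply (Cpt s m); auto).
  assert (Cr : col r = col v1) by (apply (Cpt r l); auto).
  assert (Hk : exists k, adjU R r k /\ adjU R s k).
  { destruct (Points r s Hx' Cr Cs) as [E0|[k Hk]]; [subst s; tauto|eauto]. }
  destruct Hk as [k [Rk Sk]].
  assert (Nrm : ~ adjU R m r).
  { intros H. apply Npr. apply (Meet r p l m); auto. }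
  assert (Nrn : ~ adjU R n r).
  { intros H. apply Nqr. apply (Meet r q l n); auto. }
  destruct (third_neighbour m p s (Hdeg' m Cm)) as [m3 [Mm3 [Nm3p Nm3s]]].
  assert (NLm3 : ~ adjU R l m3).
  { intros H. apply Nm3p. apply (Meet m3 p l m); auto. }
  assert (Cm3 : col m3 = col v1) by (apply (Cpt m3 m); auto).
  assert (Hk' : exists k', adjU R r k' /\ adjU R m3 k').
  { destruct (Points r m3 Hx' Cr Cm3) as [E0|[k' Hk']]; [subst m3; tauto|eauto]. }
  destruct Hk' as [k' [Rk' M3k']].
  assert (NK's : ~ adjU R k' s).
  { intros H. assert (k' = m) by (apply (Meet k' m s m3); auto). subst k'. auto. }
  assert (Nkl : k <> l) by (intros ->; auto).
  assert (Nkl' : k' <> l) by (intros ->; auto).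
  assert (Ck : col k = col v0) by (apply (Cln k r); auto).
  assert (Ck' : col k' = col v0) by (apply (Cln k' r); auto).
  assert (Honly : forall j, adjU R r j -> j <> l -> ~ adjU R j p /\ ~ adjU R j q).
  { intros j Hj Nj. split; intros H; apply Nj.
    - apply (Meet j l r p); auto.
    - apply (Meet j l r q); auto. }
  destruct (Honly k Rk Nkl) as [Nkp Nkq]. destruct (Honly k' Rk' Nkl') as [Nkp' Nkq'].
  assert (Cl : col l = col v0) by reflexivity.
  assert (Cp : col p = col v1) by (apply (Cpt p l); auto).
  assert (Cq : col q = col v1) by (apply (Cpt q l); auto).
  (* [k] joins [r] to [s], while [k'] joins [r] to a point of [m] other than [s]. Both see the
     listed vertices alike, and [s] is fixed as the intersection of the fixed lines [m] and [n]. *)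
  destruct (swap_extend R col Hcol Hhom k k' [m; n; p; q; r; l]) as [g [Hg [G1 [G2 G3]]]].
  - intros [H|[H|[H|[H|[H|[H|[]]]]]]]; subst; try congruence; auto.
  - intros [H|[H|[H|[H|[H|[H|[]]]]]]]; subst; try congruence; auto.
  - congruence.
  - intros t [<-|[<-|[<-|[<-|[<-|[<-|[]]]]]]]; split; intros H; auto;
    try (exfalso; tauto); exfalso; revert H; apply same_col_nonadj; congruence.
  - apply induced_connected_cons with r; [|simpl; auto 8|auto].
    apply induced_connected_cons with r; [|simpl; auto 8|auto].
    apply induced_connected_cons with p; [|simpl; auto 8|auto].
    apply induced_connected_cons with q; [|simpl; auto 8|auto].
    apply induced_connected_cons with l; [|simpl; auto 8|auto].
    apply induced_connected_cons with l; [|simpl; auto 8|auto].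
    apply induced_connected_cons with l; [|simpl; auto 8|auto].
    apply induced_connected_single.
  - assert (Gs : g s = s).
    { apply (Meet (g s) s m n); auto.
      - apply Symm. rewrite <- (G3 m) at 1 by (simpl; auto). rewrite <- (aut_adjU R g m s Hg). auto.
      - apply Symm. rewrite <- (G3 n) at 1 by (simpl; auto). rewrite <- (aut_adjU R g n s Hg). auto. }
    apply NK's. rewrite <- G1, <- Gs, <- (aut_adjU R g k s Hg). auto.
Qed.

(** The cycle is [x], [p], [e], [h]. A third neighbour [u] of [x] is adjacent to nothing on [p], and
    neither is [h], because a chord would shorten the cycle. Exchanging [h] and [u] over [x], [p]
    moves [e] to some [w], and [x], [u], [w], [dd], [e], [h] is a hexagon, with [dd] the end of [p];
    [no_plane] excludes it. *)
Lemma shortest_cycle_degree x l :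
  is_cycle R x l -> (forall x' l', is_cycle R x' l' -> length l <= length l') ->
  3 <= cardf (adjU R x) -> False.
Proof.
  intros [N [L [C Cl]]] Hmin Hdeg.
  assert (Hl4 : exists c1 l' e h, l = (c1 :: l') ++ [e; h]).
  { destruct l as [|c1 [|c2 l]]; simpl in L; try lia. clear Hmin.
    destruct (exists_last (l := c2 :: l)) as [l1 [h Hh]]; [discriminate|].
    rewrite Hh in *. destruct l1 as [|z l1].
    - exfalso. simpl in C, Cl. destruct C as [C1 [C2 _]].
      pose proof (adjc _ _ C1). pose proof (adjc _ _ C2). pose proof (adjc _ _ Cl).
      destruct (col x), (col c1), (col h); congruence.
    - destruct (exists_last (l := z :: l1)) as [l2 [e He]]; [discriminate|].
      exists c1, l2, e, h. rewrite He. simpl. rewrite <- app_assoc. auto. }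
  destruct Hl4 as [c1 [l' [e [h ->]]]].
  set (p := c1 :: l') in *. set (dd := last p x).
  apply adj_chain_app in C. destruct C as [Cp [Cde [Ceh _]]]. fold dd in Cde.
  rewrite last_app_cons in Cl. simpl in Cl.
  assert (Nshort : forall x' l', is_cycle R x' l' -> length l' < length p + 2 -> False).
  { intros x' l1 Hc Hlt. apply Hmin in Hc. rewrite length_app in Hc. simpl in *. lia. }
  clear Hmin.
  rewrite app_comm_cons in N.
  assert (Np : NoDup (x :: p)) by (apply NoDup_app_remove_r in N; auto).
  assert (Neh : ~ In e (x :: p) /\ ~ In h (x :: p) /\ e <> h).
  { rewrite <- (app_nil_r [e; h]) in N. repeat split.
    - intros Hi. destruct (in_split _ _ Hi) as [A1 [A2 HA]]. rewrite HA in N.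
      rewrite <- app_assoc in N. apply NoDup_remove_2 in N. apply N. apply in_or_app. right.
      apply in_or_app. right. left. auto.
    - intros Hi. destruct (in_split _ _ Hi) as [A1 [A2 HA]]. rewrite HA in N.
      rewrite <- app_assoc in N. apply NoDup_remove_2 in N. apply N. apply in_or_app. right.
      apply in_or_app. right. right; left. auto.
    - intros <-. apply NoDup_app_remove_l in N. apply NoDup_cons_iff in N. apply (proj1 N). left; auto. }
  destruct Neh as [Ne [Nh Neh]].
  assert (Far : forall z, adjU R x z -> ~ In z (x :: p) -> forall t, In t p -> ~ adjU R z t).
  { intros z Hz Nz t Ht Hzt. destruct (in_split _ _ Ht) as [l1 [l2 Hp]].
    apply (Nshort z (x :: l1 ++ [t])).
    - rewrite Hp in Np, Nz, Cp.
      replace (l1 ++ t :: l2) with ((l1 ++ [t]) ++ l2) in * by (rewrite <- app_assoc; auto).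
      split; [|split; [|split]].
      + constructor.
        * intros Hi. apply Nz. rewrite app_comm_cons. apply in_or_app; left; auto.
        * rewrite app_comm_cons in Np. apply NoDup_app_remove_r in Np. auto.
      + simpl. rewrite length_app. simpl. lia.
      + split; [apply adjU_sym; auto|]. apply adj_chain_app in Cp. apply Cp.
      + rewrite last_cons, last_last. apply adjU_sym; auto.
    - rewrite Hp. simpl. rewrite !length_app. simpl. lia. }
  destruct (third_neighbour x c1 h Hdeg) as [u [Xu [Nuc Nuh]]].
  assert (Nux : u <> x) by (intros ->; apply (same_col_nonadj x x); auto).
  assert (Nu : ~ In u (x :: p)).
  { intros [Hi|[Hi|Hi]]; [congruence|congruence|].
    destruct (in_split _ _ Hi) as [l1 [l2 Hp]]. unfold p in *. rewrite Hp in *.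
    apply (Nshort x (c1 :: l1 ++ [u])).
    - replace (l1 ++ u :: l2) with ((l1 ++ [u]) ++ l2) in * by (rewrite <- app_assoc; auto).
      split; [|split; [|split]].
      + rewrite !app_comm_cons in Np. apply NoDup_app_remove_r in Np. auto.
      + simpl. rewrite length_app. simpl. lia.
      + rewrite app_comm_cons in Cp. apply adj_chain_app in Cp. apply Cp.
      + rewrite last_cons, last_last. apply adjU_sym; auto.
    - simpl. rewrite !length_app. simpl. lia. }
  assert (Xh : adjU R x h) by (apply adjU_sym; auto).
  destruct (swap_extend R col Hcol Hhom h u (x :: p)) as [g [Hg [G1 [_ G3]]]]; auto.
  { pose proof (adjc _ _ Xh). pose proof (adjc _ _ Xu). destruct (col x), (col h), (col u); congruence. }
  { intros t [<-|Ht]; [split; intros; apply adjU_sym; auto|].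
    split; intros H; exfalso; [apply (Far h Xh Nh t)|apply (Far u Xu Nu t)]; auto. }
  { apply induced_connected_cons with x; [|simpl; auto|auto].
    apply induced_connected_cons with x; [|simpl; auto|apply adjU_sym; auto].
    clear - Cp. revert x Cp. generalize p as l0. induction l0 as [|y l0 IH]; intros x Cp.
    - apply induced_connected_single.
    - destruct Cp as [C1 C2]. apply induced_connected_cons with y; [apply IH; auto|left; auto|auto]. }
  assert (Hdp : In dd p) by (unfold dd, p; rewrite last_cons; apply last_in).
  set (w := g e).
  assert (Wu : adjU R u w).
  { unfold w. rewrite <- G1, <- (aut_adjU R g h e Hg). apply adjU_sym; auto. }
  assert (Wd : adjU R dd w).
  { unfold w. rewrite <- (G3 dd) by (right; auto). rewrite <- (aut_adjU R g dd e Hg). auto. }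
  assert (Nex : e <> x) by (intros ->; apply Ne; left; auto).
  assert (Nhd : h <> dd) by (intros ->; apply Nh; right; auto).
  assert (Nud : u <> dd) by (intros ->; apply Nu; right; auto).
  assert (Nwe : w <> e).
  { intros E0. rewrite E0 in Wu. apply (HC4 e x u h); auto; apply adjU_sym; auto. }
  assert (Nwx : w <> x).
  { intros E0. rewrite E0 in Wd. apply (HC4 e x h dd); auto; apply adjU_sym; auto. }
  apply (no_plane x u w dd e h); auto.
  unfold hexagon. repeat split; auto; apply adjU_sym; auto.
Qed.

Lemma cycle_degree_two : (exists x l, is_cycle R x l) -> forall v, cardf (adjU R v) <= 2.
Proof.
  intros Hex v. destruct (le_lt_dec (cardf (adjU R v)) 2) as [|Hdeg]; auto. exfalso.
  destruct (least_nat (fun n => exists x l, length l = n /\ is_cycle R x l)) as [n [[x [l [Hn Hc]]] Hmin]].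
  { destruct Hex as [x [l H]]. eauto. }
  assert (Hmin' : forall x' l', is_cycle R x' l' -> length l <= length l').
  { intros x' l' H. rewrite Hn. apply Hmin. eauto. }
  destruct (bool_dec (col x) (col v)) as [Ce|Ce].
  - apply (shortest_cycle_degree x l); auto. rewrite (degree_const R col Hcol Hlf Hhom x v Ce). auto.
  - destruct l as [|y l]; [destruct Hc as [_ [L _]]; simpl in L; lia|].
    assert (Cy : col y = col v).
    { destruct Hc as [_ [_ [[Hxy _] _]]]. apply adjc in Hxy.
      destruct (col x), (col y), (col v); congruence. }
    apply (shortest_cycle_degree y (l ++ [x])).
    + apply cycle_rotate; auto.
    + intros x' l' H. apply Hmin' in H. rewrite length_app. simpl in *. lia.
    + rewrite (degree_const R col Hcol Hlf Hhom y v Cy). auto.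
Qed.

End FourCycleFree.

(** * Identification with the listed graphs *)

Lemma sig_eq {T : Type} (P : T -> Prop) (a b : {x | P x}) : proj1_sig a = proj1_sig b -> a = b.
Proof. destruct a, b; simpl. intros ->. f_equal. apply proof_irrelevance. Qed.

Lemma rel_iso_bijection {T U : Type} (RT : T -> T -> Prop) (RU : U -> U -> Prop) (f : U -> T) :
  (forall a b, f a = f b -> a = b) -> (forall t, exists u, f u = t) ->
  (forall a b, RU a b <-> RT (f a) (f b)) -> rel_iso RT RU.
Proof.
  intros Hinj Hsur HR. destruct (choice_fun _ Hsur) as [h Hh].
  exists h, f. split; [auto|]. split; [intros b; apply Hinj; auto|].
  intros a a'. rewrite HR, !Hh. tauto.
Qed.

Lemma rel_iso_und {T U : Type} (RT : T -> T -> Prop) (RU : U -> U -> Prop) :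
  rel_iso RT RU -> rel_iso (fun a b => RT a b \/ RT b a) (fun a b => RU a b \/ RU b a).
Proof.
  intros [f [g [H1 [H2 H3]]]]. exists f, g. split; auto. split; auto.
  intros a a'. rewrite (H3 a a'), (H3 a' a). tauto.
Qed.

Lemma rel_iso_refl {T : Type} (RT : T -> T -> Prop) : rel_iso RT RT.
Proof. exists (fun x => x), (fun x => x). tauto. Qed.

Lemma two_neighbours_only {T : Type} (P : T -> Prop) a b t :
  finite_set P -> cardf P <= 2 -> a <> b -> P a -> P b -> P t -> t = a \/ t = b.
Proof.
  intros F H N Ha Hb Ht. apply NNPP. intros Hn. apply not_or_and in Hn. destruct Hn as [N1 N2].
  destruct (cardf_card P F) as [l [Nl [Ll Hl]]].
  assert (3 <= length l); [|lia].
  apply (NoDup_incl_length (l := [t; a; b])).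
  - repeat constructor; simpl; intuition.
  - intros z [<-|[<-|[<-|[]]]]; apply Hl; auto.
Qed.

Section Classification.
Context {W : Type} (R : W -> W -> Prop) (col : W -> bool).
Hypothesis Hcol : forall x y, R x y -> col x = true /\ col y = false.
Hypothesis Hconn : connected R.
Hypothesis Hlf : locally_finite R.
Hypothesis Hhom : forall M, piso R M -> (forall p, In p M -> col (fst p) = col (snd p)) ->
  induced_connected R (fun v => In v (map fst M)) ->
  exists g, is_aut R g /\ forall p, In p M -> g (fst p) = snd p.

Let adjc := adj_col R col Hcol.
Let adjR := adj_R R col Hcol.

Lemma listed_complete :
  (exists x y, R x y) -> (forall x y, col x = true -> col y <> true -> adjU R x y) ->
  exists B, listed B /\ rel_iso R (bor B).
Proof.
  intros [x0 [y0 H0]] Hall. destruct (Hcol _ _ H0) as [Cx Cy].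
  assert (FX : finite_set (fun w => col w = true)).
  { apply finite_sub with (2 := finite_adj R Hlf y0). intros w Hw.
    apply adjU_sym. apply Hall; auto. congruence. }
  assert (FY : finite_set (fun w => col w = false)).
  { apply finite_sub with (2 := finite_adj R Hlf x0). intros w Hw.
    apply Hall; auto. congruence. }
  destruct (finite_enum _ FX) as [lx [Nx Hx]], (finite_enum _ FY) as [ly [Ny Hy]].
  exists (complete_bg (length lx) (length ly)). split.
  { right; left. exists (length lx), (length ly). split; [|split; [|apply rel_iso_refl]].
    - destruct lx; [exfalso; apply (proj2 (Hx x0)); auto|simpl; lia].
    - destruct ly; [exfalso; apply (proj2 (Hy y0)); auto|simpl; lia]. }
  apply rel_iso_bijection with (fun u : fin (length lx) + fin (length ly) =>
    match u with inl i => nth (proj1_sig i) lx x0 | inr j => nth (proj1_sig j) ly y0 end).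
  - assert (Hcx : forall i : fin (length lx), col (nth (proj1_sig i) lx x0) = true).
    { intros [i Hi]. apply Hx. apply nth_In; auto. }
    assert (Hcy : forall i : fin (length ly), col (nth (proj1_sig i) ly y0) = false).
    { intros [i Hi]. apply Hy. apply nth_In; auto. }
    intros [i|i] [j|j] He.
    + f_equal. apply sig_eq. apply (proj1 (NoDup_nth lx x0) Nx); auto; apply proj2_sig.
    + exfalso. pose proof (Hcx i) as K. rewrite He, Hcy in K. discriminate.
    + exfalso. pose proof (Hcy i) as K. rewrite He, Hcx in K. discriminate.
    + f_equal. apply sig_eq. apply (proj1 (NoDup_nth ly y0) Ny); auto; apply proj2_sig.
  - intros w. destruct (col w) eqn:Cw.
    + apply Hx in Cw. destruct (In_nth lx w x0 Cw) as [i [Hi Hn]].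
      exists (inl (exist _ i Hi)). auto.
    + apply Hy in Cw. destruct (In_nth ly w y0 Cw) as [i [Hi Hn]].
      exists (inr (exist _ i Hi)). auto.
  - assert (Hcx : forall i : fin (length lx), col (nth (proj1_sig i) lx x0) = true).
    { intros [i Hi]. apply Hx. apply nth_In; auto. }
    assert (Hcy : forall i : fin (length ly), col (nth (proj1_sig i) ly y0) = false).
    { intros [i Hi]. apply Hy. apply nth_In; auto. }
    intros [i|i] [j|j]; simpl; split; intros H; try tauto;
      try (apply Hcol in H; rewrite ?Hcx, ?Hcy in H; destruct H; discriminate).
    apply adjR; auto. apply Hall; auto. rewrite Hcy. discriminate.
Qed.

Lemma listed_almost_complete a c x x' y :
  (forall x, col x = true -> cardf (adjU R x) = a) ->
  (forall x x' y, col x = true -> x <> x' -> common R x x' y -> cardf (common R x x') = c) ->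
  2 <= c -> a = c + 1 -> col x = true -> x <> x' -> common R x x' y ->
  exists B, listed B /\ rel_iso R (bor B).
Proof.
  intros Ha Hc Hc2 Hac Cx Nx Hy.
  assert (Hex : exists x x' y, col x = true /\ x <> x' /\ common R x x' y) by eauto 6.
  pose proof (nonneighbour_unique R col Hcol Hconn Hlf Hhom true a c Ha Hc Hc2 Hac Hex) as U.
  pose proof (nonneighbour_exists R col Hcol Hconn Hlf true a c Ha Hc Hc2 Hac Hex) as X.
  pose proof (nonneighbour_inj R col Hcol Hconn Hlf Hhom true a c Ha Hc Hc2 Hac Hex) as J.
  pose proof (nonneighbour_surj R col Hcol Hconn Hlf Hhom true a c Ha Hc Hc2 Hac Hex) as S.
  (* On the true side [eta] picks the only non-neighbour on the other side and thus becomes the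
     removed matching; elsewhere its value is junk. *)
  destruct (choice_fun (fun w z => col w = true -> col z <> true /\ ~ adjU R w z)) as [eta Heta].
  { intros w. destruct (classic (col w = true)) as [Cw|Cw]; [|exists w; tauto].
    destruct (X w Cw) as [z Hz]. exists z. auto. }
  assert (Cy : col y <> true).
  { destruct Hy as [Hy _]. apply adjc in Hy. congruence. }
  assert (FX : finite_set (fun w => col w = true)).
  { destruct (S y Cy) as [w0 [Cw0 Hw0]].
    apply finite_sub with (fun w => adjU R y w \/ w = w0).
    - intros w Cw. destruct (classic (adjU R y w)); auto. right. apply (J w w0 y); auto.
      intros H'. apply adjU_sym in H'. auto.
    - apply finite_or; [apply finite_adj; auto|apply finite_single]. }
  destruct (finite_enum _ FX) as [lx [Nlx Hx]].
  assert (Ey : forall z, col z <> true -> exists w, In w lx /\ eta w = z).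
  { intros z Cz. destruct (S z Cz) as [w [Cw Hw]]. exists w. split; [apply Hx; auto|].
    destruct (Heta w Cw). apply (U w); auto. }
  assert (En : forall v w, col v = true -> col w = true -> eta v = eta w -> v = w).
  { intros v w Cv Cw He. destruct (Heta v Cv), (Heta w Cw). apply (J v w (eta v)); auto. congruence. }
  assert (Hlen : 3 <= length lx).
  { apply Nat.le_trans with (cardf (adjU R x)); [rewrite (Ha x Cx); lia|].
    destruct (cardf_card _ (finite_adj R Hlf x)) as [la [Na [La Hla]]]. rewrite <- La.
    rewrite <- (length_map eta lx). apply NoDup_incl_length; auto. intros z Hz.
    apply Hla in Hz. apply in_map_iff. destruct (Ey z) as [w [Hw He]]; [|eauto].
    apply adjc in Hz. congruence. }
  exists (CP_bg (length lx)). split.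
  { right; right; left. exists (length lx). split; auto. apply rel_iso_refl. }
  assert (Hcx : forall i : fin (length lx), col (nth (proj1_sig i) lx x) = true).
  { intros [i Hi]. apply Hx. apply nth_In; auto. }
  assert (Inj : forall i j : fin (length lx), nth (proj1_sig i) lx x = nth (proj1_sig j) lx x -> proj1_sig i = proj1_sig j).
  { intros i j He. apply (proj1 (NoDup_nth lx x) Nlx); auto; apply proj2_sig. }
  apply rel_iso_bijection with (fun u : fin (length lx) + fin (length lx) =>
    match u with inl i => nth (proj1_sig i) lx x | inr j => eta (nth (proj1_sig j) lx x) end).
  - intros [i|i] [j|j] He.
    + f_equal. apply sig_eq. auto.
    + exfalso. destruct (Heta _ (Hcx j)) as [K _]. apply K. rewrite <- He. apply Hcx.
    + exfalso. destruct (Heta _ (Hcx i)) as [K _]. apply K. rewrite He. apply Hcx.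
    + f_equal. apply sig_eq. apply Inj. apply En; auto.
  - intros w. destruct (classic (col w = true)) as [Cw|Cw].
    + apply Hx in Cw. destruct (In_nth lx w x Cw) as [i [Hi Hn]].
      exists (inl (exist _ i Hi)). auto.
    + destruct (Ey w Cw) as [v [Hv He]]. destruct (In_nth lx v x Hv) as [i [Hi Hn]].
      exists (inr (exist _ i Hi)). simpl. rewrite Hn. auto.
  - intros [i|i] [j|j]; simpl; split; intros H; try tauto.
    + exfalso. apply Hcol in H. rewrite !Hcx in H. destruct H; discriminate.
    + apply adjR; auto. apply NNPP. intros N. apply H. apply Inj. apply En; auto.
      destruct (Heta _ (Hcx i)), (Heta _ (Hcx j)). apply (U (nth (proj1_sig i) lx x)); auto.
    + intros He. rewrite He in H. apply (proj2 (Heta _ (Hcx j))). left. auto.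
    + exfalso. apply Hcol in H. apply (proj1 (Heta _ (Hcx i))). apply H.
    + exfalso. apply Hcol in H. apply (proj1 (Heta _ (Hcx i))). apply H.
Qed.

Lemma listed_cycle x l :
  is_cycle R x l -> (forall v, cardf (adjU R v) <= 2) ->
  exists B, listed B /\ rel_iso R (bor B).
Proof.
  intros H0 Hdeg.
  (* Starting on the false side puts [inr j] at position 2j and [inl i] at 2i + 1, which matches the
     adjacency of x_i with y_i and y_(i+1). *)
  assert (Hrot : exists x l, is_cycle R x l /\ col x = false).
  { destruct (col x) eqn:Cx; [|eauto]. destruct l as [|y l]; [destruct H0 as [_ [L _]]; simpl in L; lia|].
    exists y, (l ++ [x]). split; [apply cycle_rotate; auto|].
    destruct H0 as [_ [_ [[Hxy _] _]]]. apply adjc in Hxy. destruct (col y); congruence. }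
  clear x l H0. destruct Hrot as [x [l [Hcy Cx]]].
  pose proof Hcy as [Nd [L [Ch Cl]]].
  set (cyc := fun i => nth i (x :: l) x).
  assert (Fadj : forall i, i < length l -> adjU R (cyc i) (cyc (S i))).
  { intros i Hi. apply adj_chain_nth; auto. }
  assert (Flast : adjU R (cyc (length l)) (cyc 0)).
  { unfold cyc. rewrite nth_last. auto. }
  assert (Finj : forall i j, i <= length l -> j <= length l -> cyc i = cyc j -> i = j).
  { intros i j Hi Hj He. apply (proj1 (NoDup_nth (x :: l) x) Nd); simpl; auto; lia. }
  assert (Fcol : forall i, i <= length l -> col (cyc i) = Nat.odd i).
  { induction i as [|i IH]; intros Hi; [auto|].
    specialize (IH ltac:(lia)). pose proof (adjc _ _ (Fadj i ltac:(lia))) as Hne.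
    rewrite Nat.odd_succ, <- Nat.negb_odd, <- IH.
    revert Hne. destruct (col (cyc i)), (col (cyc (S i))); simpl; intros Hne;
      solve [reflexivity | exfalso; apply Hne; reflexivity]. }
  assert (Hk : exists k, S (length l) = 2 * k /\ 2 <= k).
  { pose proof (adjc _ _ Flast) as Hne. rewrite !Fcol in Hne by lia.
    destruct (Nat.odd (length l)) eqn:Ho; [|exfalso; apply Hne; reflexivity].
    apply Nat.odd_spec in Ho. destruct Ho as [m Hm]. exists (S m). lia. }
  destruct Hk as [k [Hk Hk2]].
  (* With degree two no edge leaves the cycle, so by connectedness it contains every vertex. *)
  assert (Hall : forall w, In w (x :: l)).
  { intros w. apply (conn_invariant R (fun _ => True) (fun w => In w (x :: l)) x w).
    - apply Hconn; auto.
    - left; auto.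
    - intros p q _ _ Hpq Hp.
      destruct (cycle_neighbours R x l p Nd L Ch Cl Hp) as [b [c [Hb [Hc [Nbc [Ab Ac]]]]]].
      destruct (two_neighbours_only (adjU R p) b c q) as [->| ->]; auto.
      + apply finite_adj; auto.
      + apply adjU_sym; auto. }
  exists (cycle_bg k). split.
  { left. exists k. split; auto. apply rel_iso_refl. }
  apply rel_iso_bijection with (fun u : fin k + fin k =>
    match u with inl i => cyc (S (2 * proj1_sig i)) | inr j => cyc (2 * proj1_sig j) end).
  - intros [[i Hi]|[i Hi]] [[j Hj]|[j Hj]] He; simpl in He; apply Finj in He; try lia;
      f_equal; apply sig_eq; simpl; lia.
  - intros w. destruct (In_nth _ _ x (Hall w)) as [n [Hn Hw]]. simpl length in Hn.
    destruct (Nat.Even_or_Odd n) as [[m Hm]|[m Hm]].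
    + assert (Hmk : m < k) by lia. exists (inr (exist _ m Hmk)). simpl proj1_sig. rewrite <- Hm. auto.
    + assert (Hmk : m < k) by lia. exists (inl (exist _ m Hmk)). simpl proj1_sig.
      replace (S (2 * m)) with n by lia. auto.
  - assert (Ho : forall i, i < k -> col (cyc (S (2 * i))) = true).
    { intros i Hi. rewrite Fcol by lia. apply Nat.odd_spec. exists i. lia. }
    assert (He : forall i, i < k -> col (cyc (2 * i)) = false).
    { intros i Hi. rewrite Fcol by lia. rewrite Nat.odd_mul. auto. }
    assert (Hnb : forall i, i < k -> adjU R (cyc (S (2 * i))) (cyc (2 * ((i + 1) mod k)))).
    { intros i Hi. destruct (Nat.eq_dec (i + 1) k) as [Hik|Hik].
      - rewrite Hik, Nat.Div0.mod_same. replace (S (2 * i)) with (length l) by lia. auto.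
      - rewrite Nat.mod_small by lia. replace (2 * (i + 1)) with (S (S (2 * i))) by lia.
        apply Fadj. lia. }
    assert (Hmod : forall i, (i + 1) mod k < k) by (intros; apply Nat.mod_upper_bound; lia).
    assert (Hne : forall i, i < k -> (i + 1) mod k <> i).
    { intros i Hi. destruct (Nat.eq_dec (i + 1) k) as [Hik|Hik].
      - rewrite Hik, Nat.Div0.mod_same. lia.
      - rewrite Nat.mod_small by lia. lia. }
    intros [[i Hi]|[i Hi]] [[j Hj]|[j Hj]]; simpl bor; simpl proj1_sig; split; intros H; try tauto;
      try (exfalso; apply Hcol in H; rewrite ?Ho, ?He in H by auto; destruct H; discriminate).
    + apply adjR; auto. destruct H as [->| ->]; auto. apply adjU_sym. apply Fadj. lia.
    + pose proof (Hmod i). pose proof (Hne i Hi).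
      destruct (two_neighbours_only (adjU R (cyc (S (2 * i)))) (cyc (2 * i)) (cyc (2 * ((i + 1) mod k)))
        (cyc (2 * j))) as [Hx|Hx]; auto.
      * apply finite_adj; auto.
      * intros Hx. apply Finj in Hx; lia.
      * apply adjU_sym. apply Fadj. lia.
      * left. auto.
      * left. apply Finj in Hx; lia.
      * right. apply Finj in Hx; lia.
Qed.

Lemma listed_tree :
  (forall x l, ~ is_cycle R x l) -> (exists w : W, True) ->
  (forall w, 2 <= cardf (adjU R w)) ->
  exists B, listed B /\ rel_iso R (bor B).
Proof.
  intros Hac [w0 _] Hdeg.
  set (B := {| BX := {w | col w = true}; BY := {w | col w = false};
               badj := fun x y => R (proj1_sig x) (proj1_sig y) |}).
  set (f := fun u : BX B + BY B => match u with inl x => proj1_sig x | inr y => proj1_sig y end).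
  assert (Finj : forall u v, f u = f v -> u = v).
  { intros [[u Hu]|[u Hu]] [[v Hv]|[v Hv]] He; simpl in He; subst; try congruence;
    f_equal; apply sig_eq; auto. }
  assert (Fsur : forall w, exists u, f u = w).
  { intros w. destruct (col w) eqn:Cw; [exists (inl (exist _ w Cw))|exists (inr (exist _ w Cw))]; auto. }
  assert (FR : forall u v, bor B u v <-> R (f u) (f v)).
  { intros [[u Hu]|[u Hu]] [[v Hv]|[v Hv]]; simpl; split; intros H; try tauto;
    apply Hcol in H; destruct H; congruence. }
  assert (Fadj : forall u v, adjU (bund B) u v <-> adjU R (f u) (f v)).
  { intros u v. unfold adjU, bund. rewrite !FR. tauto. }
  destruct (choice_fun _ Fsur) as [h Hh].
  assert (hf : forall u, h (f u) = u) by (intros u; apply Finj; auto).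
  assert (Hside : forall s, exists n, forall w, col w = s -> cardf (adjU R w) = n).
  { intros s. destruct (classic (exists w, col w = s)) as [[w Hw]|N].
    - exists (cardf (adjU R w)). intros v Hv. apply (degree_const R col Hcol Hlf Hhom). congruence.
    - exists 0. intros w Hw. exfalso; eauto. }
  assert (Hboth : forall s, exists w, col w = s).
  { intros s. destruct (bool_dec (col w0) s) as [<-|N]; [eauto|].
    destruct (cardf_two _ (finite_adj R Hlf w0) (Hdeg w0)) as [y [_ [_ [Hy _]]]].
    exists y. apply adjc in Hy. destruct (col w0), (col y), s; congruence. }
  destruct (Hside true) as [a Ha], (Hside false) as [b Hb].
  exists B. split.
  2:{ apply rel_iso_bijection with f; auto. }
  right; right; right. exists a, b.
  destruct (Hboth true) as [wx Cwx], (Hboth false) as [wy Cwy].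
  split; [rewrite <- (Ha wx); auto|]. split; [rewrite <- (Hb wy); auto|].
  split; [split|split; [|split]].
  - intros u v _ _.
    assert (Hc : conn R (fun _ => True) (f u) (f v)) by (apply Hconn; auto).
    rewrite <- (hf u), <- (hf v).
    induction Hc as [p q [_ [_ Hpq]]| |p q r _ IH1 _ IH2].
    + apply rt_step. repeat split; auto. apply Fadj. rewrite !Hh. auto.
    + apply rt_refl.
    + eapply rt_trans; eauto.
  - intros u l N L _ C Cl. apply (Hac (f u) (map f l)). split; [|split; [|split]].
    + change (f u :: map f l) with (map f (u :: l)).
      apply FinFun.Injective_map_NoDup; auto.
    + rewrite length_map. auto.
    + clear - C Fadj. revert u C. induction l as [|v l IH]; intros u C; simpl in *; auto.
      split; [apply Fadj|apply IH]; tauto.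
    + assert (Hlast : last (map f l) (f u) = f (last l u)).
      { clear. revert u. induction l as [|v l IH]; intros u; auto.
        simpl map. rewrite !last_cons. auto. }
      rewrite Hlast. apply Fadj. auto.
  - constructor. exact (inl (exist _ wx Cwx)).
  - intros [x Cx]. destruct (cardf_card _ (finite_adj R Hlf x)) as [l [N [Ll Hl]]].
    assert (Hsig : exists m : list (BY B), map (@proj1_sig _ _) m = l).
    { clear N Ll. assert (Hl' : forall y, In y l -> col y = false).
      { intros y Hy. apply Hl, adjc in Hy. simpl in Cx. destruct (col y); congruence. }
      clear Hl. induction l as [|y l IH]; [exists []; auto|].
      destruct IH as [m Hm]; [intros; apply Hl'; right; auto|].
      exists (exist _ y (Hl' y (or_introl eq_refl)) :: m). simpl. f_equal. auto. }
    destruct Hsig as [m Hm]. exists m. split; [|split].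
    + transitivity (length l); [rewrite <- Hm; symmetry; apply length_map|].
      rewrite Ll. auto.
    + apply (NoDup_map_inv (@proj1_sig _ _)). rewrite Hm. auto.
    + intros [y Cy]. simpl. rewrite <- adjR by auto. rewrite <- (Hl y), <- Hm.
      rewrite in_map_iff. split; [intros Hi; exists (exist _ y Cy); auto|].
      intros [[y' Cy'] [He Hi]]. simpl in He. subst y'.
      replace (exist (fun w => col w = false) y Cy) with (exist (fun w => col w = false) y Cy'); auto.
      apply sig_eq; auto.
  - intros [y Cy]. destruct (cardf_card _ (finite_adj R Hlf y)) as [l [N [Ll Hl]]].
    assert (Hsig : exists m : list (BX B), map (@proj1_sig _ _) m = l).
    { clear N Ll. assert (Hl' : forall x, In x l -> col x = true).
      { intros x Hx. apply Hl, adjc in Hx. simpl in Cy. destruct (col x); congruence. }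
      clear Hl. induction l as [|x l IH]; [exists []; auto|].
      destruct IH as [m Hm]; [intros; apply Hl'; right; auto|].
      exists (exist _ x (Hl' x (or_introl eq_refl)) :: m). simpl. f_equal. auto. }
    destruct Hsig as [m Hm]. exists m. split; [|split].
    + transitivity (length l); [rewrite <- Hm; symmetry; apply length_map|].
      rewrite Ll. auto.
    + apply (NoDup_map_inv (@proj1_sig _ _)). rewrite Hm. auto.
    + intros [x Cx]. simpl. rewrite <- adjR by auto.
      assert (Hsw : adjU R x y <-> adjU R y x) by (split; apply adjU_sym).
      rewrite Hsw, <- (Hl x), <- Hm.
      rewrite in_map_iff. split; [intros Hi; exists (exist _ x Cx); auto|].
      intros [[x' Cx'] [He Hi]]. simpl in He. subst x'.
      replace (exist (fun w => col w = true) x Cx) with (exist (fun w => col w = true) x Cx'); auto.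
      apply sig_eq; auto.
Qed.

Theorem homogeneous_bipartite_listed :
  (exists x y, R x y) -> exists B, listed B /\ rel_iso R (bor B).
Proof.
  intros Hex.
  destruct (classic (forall x x' y t, col x = true -> common R x x' y -> adjU R x t -> adjU R x' t))
    as [Hcomp|Hn].
  { apply listed_complete; auto. apply (complete_structure R col Hcol Hconn true); auto. }
  assert (exists x x' y t, col x = true /\ common R x x' y /\ adjU R x t /\ ~ adjU R x' t)
    as [x [x' [y [t [Cx [Hy [Ht Ht']]]]]]].
  { apply NNPP. intros N. apply Hn. intros x x' y t Cx Hy Ht. apply NNPP. intros Ht'. apply N. eauto 8. }
  assert (Nx : x <> x') by (intros ->; auto).
  set (c := cardf (common R x x')). set (a := cardf (adjU R x)).
  assert (Ha : forall v, col v = true -> cardf (adjU R v) = a).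
  { intros v Cv. apply (degree_const R col Hcol Hlf Hhom). congruence. }
  assert (Hc : forall v v' z, col v = true -> v <> v' -> common R v v' z -> cardf (common R v v') = c).
  { intros v v' z Cv Nv Hz. apply (common_const R col Hcol Hlf Hhom v v' z x x' y); auto. congruence. }
  assert (Hca : c < a).
  { apply cardf_lt with t; auto; [apply finite_adj; auto| |]; unfold common; tauto. }
  assert (Hc1 : 1 <= c) by (apply cardf_pos with y; auto; apply finite_common; auto).
  destruct (le_lt_dec 2 c) as [Hc2|Hc2].
  { destruct (le_lt_dec (c + 2) a) as [Hbig|Hsmall].
    - exfalso. apply (no_middle R col Hcol Hlf Hhom true a c Ha Hc x x' y); auto.
    - apply (listed_almost_complete a c x x' y); auto. lia. }
  (* Here [c = 1]. A four-cycle has two vertices of each colour, so it suffices to exclude two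
     common neighbours on the true side. *)
  assert (Hge2 : forall v v' z z', col v = true -> v <> v' -> z <> z' -> common R v v' z ->
    common R v v' z' -> False).
  { intros v v' z z' Cv Nv Nz Hz Hz'.
    destruct (cardf_card _ (finite_common R Hlf v v')) as [l [Nl [Ll Hl]]].
    rewrite (Hc v v' z Cv Nv Hz) in Ll.
    assert (2 <= length l); [|lia]. apply (NoDup_incl_length (l := [z; z'])).
    - repeat constructor; simpl; intuition.
    - intros q [<-|[<-|[]]]; apply Hl; auto. }
  assert (HC4 : forall u u' v v', u <> u' -> v <> v' ->
    adjU R u v -> adjU R u v' -> adjU R u' v -> adjU R u' v' -> False).
  { intros u u' v v' Nu Nv A1 A2 A3 A4. destruct (col u) eqn:Cu.
    - apply (Hge2 u u' v v'); auto; split; auto.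
    - apply (Hge2 v v' u u'); auto.
      + apply adjc in A1. destruct (col v); congruence.
      + split; apply adjU_sym; auto.
      + split; apply adjU_sym; auto. }
  destruct (classic (exists x l, is_cycle R x l)) as [[z [l Hz]]|Nc].
  - apply (listed_cycle z l); auto. apply (cycle_degree_two R col Hcol Hconn Hlf Hhom HC4). eauto.
  - apply listed_tree.
    + intros z l Hz. eauto.
    + eauto.
    + assert (Hy2 : 2 <= cardf (adjU R y)).
      { destruct (cardf_card _ (finite_adj R Hlf y)) as [l [Nl [Ll Hl]]]. rewrite <- Ll.
        destruct Hy as [Hy Hy']. apply (NoDup_incl_length (l := [x; x'])).
        - repeat constructor; simpl; intuition.
        - intros q [<-|[<-|[]]]; apply Hl; apply adjU_sym; auto. }
      intros w. destruct (col w) eqn:Cw; [rewrite (Ha w Cw); lia|].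
      rewrite (degree_const R col Hcol Hlf Hhom w y); auto.
      destruct Hy as [Hy _]. apply adjc in Hy. destruct (col y); congruence.
Qed.

End Classification.

Lemma finite_sig {T : Type} (P Q : T -> Prop) :
  finite_set Q -> finite_set (fun w : {x | P x} => Q (proj1_sig w)).
Proof.
  intros [l Hl].
  assert (H : exists m : list {x | P x}, forall w, In (proj1_sig w) l -> In w m).
  { clear Hl. induction l as [|x l [m Hm]]; [exists []; auto|].
    destruct (classic (P x)) as [Hx|Hx].
    - exists (exist _ x Hx :: m). intros w [Hw|Hw]; [left|right; auto]. apply sig_eq; auto.
    - exists m. intros w [Hw|Hw]; auto. exfalso. apply Hx. rewrite Hw. apply proj2_sig. }
  destruct H as [m Hm]. exists m. auto.
Qed.

Lemma is_aut_id {V : Type} (E : V -> V -> Prop) : is_aut E (fun x => x).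
Proof. split; [exists (fun x => x); auto|tauto]. Qed.

(** * The reachability classes of a homogeneous digraph *)

Section ReachabilityClass.
Context {V : Type} (E : V -> V -> Prop).
Hypothesis HD : is_digraph E.
Hypothesis Hconn : connected E.
Hypothesis Hlf : locally_finite E.
Hypothesis Htf : triangle_free E.
Hypothesis Hch : conn_hom E.
Hypothesis Hends : more_than_one_end E.
Variables x0 y0 : V.
Hypothesis H0 : E x0 y0.

Let e0 := (x0, y0).
Let W := DeltaV E e0.
Let R : W -> W -> Prop := Delta_arc E e0.

Definition is_tail (w : DeltaV E (x0, y0)) : bool :=
  holds (exists u, Arel E (x0, y0) (proj1_sig w, u)).

Lemma Delta_arc_sides (v w : W) : R v w -> is_tail v = true /\ is_tail w = false.
Proof.
  intros H. split.
  - apply holds_true. eauto.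
  - apply holds_false. intros [u Hu].
    apply (class_bipartite E HD Hconn Hlf Htf Hch Hends x0 y0 _ _ u H Hu).
Qed.

Lemma Delta_arc_iff (v w : W) : R v w <-> E (proj1_sig v) (proj1_sig w).
Proof.
  split.
  - intros H. apply (Arel_arc E _ _ _ _ H).
  - intros H. apply (class_induced E HD Hconn Hlf Htf Hch Hends); auto; apply proj2_sig.
Qed.

Lemma Delta_adjU_iff (v w : W) : adjU R v w <-> adjU E (proj1_sig v) (proj1_sig w).
Proof. unfold adjU. rewrite !Delta_arc_iff. tauto. Qed.

Lemma Delta_connected : connected R.
Proof.
  assert (Hx0 : Delta_vertex E e0 x0) by (exists y0; left; apply Arel_refl; auto).
  set (b := exist _ x0 Hx0 : W).
  set (P := fun a c => Arel E e0 (a, c) /\ exists va vc : W, proj1_sig va = a /\ proj1_sig vc = c /\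
              conn R (fun _ => True) b va /\ conn R (fun _ => True) b vc).
  assert (HP : forall a c, Arel E e0 (a, c) -> P a c).
  { intros a c HA. apply (Arel_closure E P x0 y0 a c HA).
    - split; [apply Arel_refl; auto|].
      assert (Hy0 : Delta_vertex E e0 y0) by (exists x0; right; apply Arel_refl; auto).
      exists b, (exist _ y0 Hy0). repeat split; auto; [apply conn_refl|].
      apply conn_step; auto. apply Delta_adjU_iff. left; auto.
    - intros p q q' Hq Hq' [Hr [vp [vq [E1 [E2 [C1 C2]]]]]].
      assert (Hr' : Arel E e0 (p, q')) by (eapply Arel_tail; eauto). split; auto.
      assert (Hv : Delta_vertex E e0 q') by (exists p; right; auto).
      exists vp, (exist _ q' Hv). repeat split; auto. apply conn_trans with vp; auto.
      apply conn_step; auto. apply Delta_adjU_iff. left. simpl. rewrite E1. auto.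
    - intros p q p' Hq Hq' [Hr [vp [vq [E1 [E2 [C1 C2]]]]]].
      assert (Hr' : Arel E e0 (p', q)) by (eapply Arel_head; eauto). split; auto.
      assert (Hv : Delta_vertex E e0 p') by (exists q; left; auto).
      exists (exist _ p' Hv), vq. repeat split; auto. apply conn_trans with vq; auto.
      apply conn_step; auto. apply Delta_adjU_iff. right. simpl. rewrite E2. auto. }
  assert (Hall : forall v : W, conn R (fun _ => True) b v).
  { intros v. destruct (proj2_sig v) as [u [Hu|Hu]].
    - destruct (HP _ _ Hu) as [_ [va [vc [E1 [_ [C1 _]]]]]]. apply sig_eq in E1. subst. auto.
    - destruct (HP _ _ Hu) as [_ [va [vc [_ [E1 [_ C1]]]]]]. apply sig_eq in E1. subst. auto. }
  intros v w _ _. apply conn_trans with b; auto. apply conn_sym; auto.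
Qed.

Lemma Delta_locally_finite : locally_finite R.
Proof.
  intros v. destruct (Hlf (proj1_sig v)) as [F1 F2]. split.
  - apply finite_sub with (fun w : W => E (proj1_sig v) (proj1_sig w)).
    + intros w. apply Delta_arc_iff.
    + apply (finite_sig (Delta_vertex E e0)); auto.
  - apply finite_sub with (fun w : W => E (proj1_sig w) (proj1_sig v)).
    + intros w. apply Delta_arc_iff.
    + apply (finite_sig (Delta_vertex E e0) (fun w => E w (proj1_sig v))); auto.
Qed.

(** The automorphism [g] obtained from the whole digraph preserves the class once it sends one of
    its arcs to another. A single pair of [M] with equal colours provides such an arc, which is why
    the empty [M] is treated apart. *)
Lemma Delta_homogeneous (M : list (W * W)) :
  piso R M -> (forall p, In p M -> is_tail (fst p) = is_tail (snd p)) ->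
  induced_connected R (fun v => In v (map fst M)) ->
  exists g, is_aut R g /\ forall p, In p M -> g (fst p) = snd p.
Proof.
  intros HM Hc Hic. destruct M as [|m M'].
  { exists (fun x => x). split; [apply is_aut_id|intros p []]. }
  assert (Hm : In m (m :: M')) by (left; auto).
  set (M := m :: M') in *. clearbody M.
  destruct (conn_hom_piso E (map (fun p => (proj1_sig (fst p), proj1_sig (snd p))) M) Hch) as [g [Hg HgM]].
  - intros p q Hp Hq. apply in_map_iff in Hp, Hq.
    destruct Hp as [p' [<- Hp]], Hq as [q' [<- Hq]]. simpl.
    destruct (HM p' q' Hp Hq) as [H1 H2]. rewrite <- !Delta_arc_iff. split; auto.
    split; intros He; apply f_equal; apply H1; apply sig_eq; auto.
  - rewrite map_map. simpl.
    assert (Hin : forall v, In v (map fst M) ->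
      In (proj1_sig v) (map (fun p : W * W => proj1_sig (fst p)) M)).
    { intros v Hv. apply in_map_iff in Hv. destruct Hv as [p [<- Hp]].
      apply in_map_iff. exists p; auto. }
    intros a b Ha Hb. apply in_map_iff in Ha, Hb. destruct Ha as [p [<- Hp]], Hb as [q [<- Hq]].
    assert (Hpq : conn R (fun v => In v (map fst M)) (fst p) (fst q)).
    { apply Hic; apply in_map; auto. }
    clear - Hpq Hin HD Hconn Hlf Htf Hch Hends.
    induction Hpq as [v w [H1 [H2 H3]]| |u v w _ IH1 _ IH2].
    + apply rt_step. split; [auto|]. split; [auto|]. apply Delta_adjU_iff; auto.
    + apply rt_refl.
    + eapply rt_trans; eauto.
  - assert (Hgm : g (proj1_sig (fst m)) = proj1_sig (snd m)).
    { apply (HgM (proj1_sig (fst m), proj1_sig (snd m))). apply in_map_iff. exists m; auto. }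
    destruct (is_aut_inv E g Hg) as [h [Hh [hg gh]]].
    assert (Harc : exists a b, Arel E e0 (a, b) /\ Arel E e0 (g a, g b)).
    { pose proof (Hc m Hm) as Hcm. destruct (is_tail (fst m)) eqn:Ct.
      - symmetry in Hcm. apply (proj1 (holds_true _)) in Ct, Hcm.
        destruct Ct as [u Hu], Hcm as [u' Hu'].
        exists (proj1_sig (fst m)), u. split; auto. rewrite Hgm. apply Arel_tail with u'; auto.
        rewrite <- Hgm. apply (proj1 (proj2 Hg _ _)). apply (Arel_arc E _ _ _ _ Hu).
      - symmetry in Hcm. apply (proj1 (holds_false _)) in Ct, Hcm.
        destruct (proj2_sig (fst m)) as [u [Hu|Hu]]; [exfalso; eauto|].
        destruct (proj2_sig (snd m)) as [u' [Hu'|Hu']]; [exfalso; eauto|].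
        exists u, (proj1_sig (fst m)). split; auto. rewrite Hgm. apply Arel_head with u'; auto.
        rewrite <- Hgm. apply (proj1 (proj2 Hg _ _)). apply (Arel_arc E _ _ _ _ Hu). }
    destruct Harc as [a [b [Hab Hgab]]].
    assert (Hcl : forall f c d, is_aut E f -> Arel E e0 (c, d) -> Arel E e0 (f c, f d) ->
      forall p q, Arel E e0 (p, q) -> Arel E e0 (f p, f q)).
    { intros f c d Hf Hcd Hfcd p q Hpq.
      apply (Arel_closure E (fun p q => Arel E e0 (f p, f q)) c d p q).
      - apply Arel_trans with x0 y0; auto. apply Arel_sym; auto.
      - auto.
      - intros r s s' _ Hs' Hr. apply Arel_tail with (f s); auto. apply (proj1 (proj2 Hf _ _)); auto.
      - intros r s r' _ Hs' Hr. apply Arel_head with (f r); auto. apply (proj1 (proj2 Hf _ _)); auto. }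
    assert (Hgv : forall v, Delta_vertex E e0 v -> Delta_vertex E e0 (g v)).
    { intros v [u [Hu|Hu]]; exists (g u); [left|right]; apply (Hcl g a b); auto. }
    assert (Hhv : forall v, Delta_vertex E e0 v -> Delta_vertex E e0 (h v)).
    { intros v [u [Hu|Hu]]; exists (h u); [left|right]; apply (Hcl h (g a) (g b)); auto;
      rewrite !hg; auto. }
    exists (fun w : W => exist _ (g (proj1_sig w)) (Hgv _ (proj2_sig w)) : W). split; [split|].
    + exists (fun w : W => exist _ (h (proj1_sig w)) (Hhv _ (proj2_sig w)) : W).
      split; intros w; apply sig_eq; simpl; auto.
    + intros v w. rewrite !Delta_arc_iff. simpl. apply (proj2 Hg).
    + intros p Hp. apply sig_eq. simpl.
      apply (HgM (proj1_sig (fst p), proj1_sig (snd p))). apply in_map_iff. exists p; auto.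
Qed.

Theorem Delta_listed : exists B, listed B /\ rel_iso (Delta_und E e0) (bund B).
Proof.
  destruct (homogeneous_bipartite_listed R is_tail Delta_arc_sides Delta_connected
              Delta_locally_finite Delta_homogeneous) as [B [HB Hiso]].
  - assert (Hx0 : Delta_vertex E e0 x0) by (exists y0; left; apply Arel_refl; auto).
    assert (Hy0 : Delta_vertex E e0 y0) by (exists x0; right; apply Arel_refl; auto).
    exists (exist _ x0 Hx0), (exist _ y0 Hy0). apply Delta_arc_iff. auto.
  - exists B. split; auto. apply (rel_iso_und _ _ Hiso).
Qed.

End ReachabilityClass.

(** * One-step extensions and back-and-forth *)

Definition swap_pairs {V : Type} (M : list (V * V)) : list (V * V) :=
  map (fun p => (snd p, fst p)) M.

Lemma in_swap_pairs {V : Type} (M : list (V * V)) x y : In (x, y) (swap_pairs M) <-> In (y, x) M.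
Proof.
  unfold swap_pairs. rewrite in_map_iff. split.
  - intros [[a b] [He Hp]]. simpl in He. injection He as <- <-. auto.
  - intros H. exists (y, x). auto.
Qed.

Lemma swap_pairs_fst {V : Type} (M : list (V * V)) : map fst (swap_pairs M) = map snd M.
Proof. unfold swap_pairs. rewrite map_map. auto. Qed.

Lemma swap_pairs_snd {V : Type} (M : list (V * V)) : map snd (swap_pairs M) = map fst M.
Proof. unfold swap_pairs. rewrite map_map. auto. Qed.

Lemma piso_swap {V : Type} (E : V -> V -> Prop) M : piso E M -> piso E (swap_pairs M).
Proof.
  intros H [a b] [c d] Hp Hq. apply (proj1 (in_swap_pairs _ _ _)) in Hp, Hq.
  destruct (H _ _ Hp Hq) as [H1 H2]. simpl in *. tauto.
Qed.

Lemma piso_image_connected {V : Type} (E : V -> V -> Prop) M : piso E M ->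
  induced_connected E (fun v => In v (map fst M)) -> induced_connected E (fun v => In v (map snd M)).
Proof.
  intros HM Hic a b Ha Hb. apply in_map_iff in Ha, Hb.
  destruct Ha as [p [<- Hp]], Hb as [q [<- Hq]].
  assert (Hc : conn E (fun v => In v (map fst M)) (fst p) (fst q)).
  { apply Hic; apply in_map; auto. }
  apply (conn_invariant E _ (fun w => forall r, In r M -> fst r = w ->
      conn E (fun v => In v (map snd M)) (snd p) (snd r)) (fst p) (fst q) Hc); auto.
  - intros r Hr He. apply (HM r p Hr Hp) in He. rewrite He. apply conn_refl.
  - intros c d Hc' Hd Hcd IH r Hr He. apply in_map_iff in Hc'. destruct Hc' as [s [Hs Hin]].
    apply conn_trans with (snd s); [apply IH; auto|].
    apply conn_step; [apply in_map; auto|apply in_map; auto|].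
    rewrite <- Hs, <- He in Hcd. destruct Hcd as [Hcd|Hcd].
    + left. apply (HM s r Hin Hr). auto.
    + right. apply (HM r s Hr Hin). auto.
Qed.

(** [K] constrains the pairs: it is trivial for the digraphs DL(B) and [same_side] for B itself,
    whose sides must not be exchanged. *)
Definition one_step_extendable {V : Type} (E : V -> V -> Prop) (K : V -> V -> Prop) : Prop :=
  forall M v, piso E M -> (forall p, In p M -> K (fst p) (snd p)) ->
    induced_connected E (fun u => In u (map fst M)) ->
    (exists p, In p M /\ adjU E v (fst p)) -> ~ In v (map fst M) ->
    exists v', K v v' /\ piso E ((v, v') :: M).

Section BackAndForth.
Context {V : Type} (E : V -> V -> Prop).
Hypothesis Hconn : connected E.
Hypothesis Hlf : locally_finite E.
Hypothesis Hose : one_step_extendable E (fun _ _ => True).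

Definition partial_aut (M : list (V * V)) : Prop :=
  piso E M /\ induced_connected E (fun u => In u (map fst M)).

Lemma partial_aut_swap M : partial_aut M -> partial_aut (swap_pairs M).
Proof.
  intros [H1 H2]. split; [apply piso_swap; auto|].
  rewrite swap_pairs_fst. apply piso_image_connected; auto.
Qed.

Lemma partial_aut_extend_list L : forall M, partial_aut M ->
  (forall v, In v L -> exists p, In p M /\ adjU E v (fst p)) ->
  exists M', partial_aut M' /\ incl M M' /\ forall v, In v L -> In v (map fst M').
Proof.
  induction L as [|v L IH]; intros M HM HL.
  - exists M. split; auto. split; [apply incl_refl|intros v []].
  - destruct (IH M HM) as [M1 [HM1 [I1 D1]]]; [intros u Hu; apply HL; right; auto|].
    destruct (classic (In v (map fst M1))) as [Hv|Hv].
    { exists M1. split; auto. split; auto. intros u [<-|Hu]; auto. }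
    destruct (HL v (or_introl eq_refl)) as [p [Hp Hvp]].
    destruct (Hose M1 v (proj1 HM1) (fun _ _ => I) (proj2 HM1)) as [v' [_ Hv']]; auto.
    { exists p. auto. }
    exists ((v, v') :: M1). split; [split; auto|split].
    + simpl map. apply induced_connected_cons with (fst p); auto; [apply HM1|].
      apply in_map; auto.
    + intros q Hq. right; auto.
    + intros u [<-|Hu]; [left; auto|right; auto].
Qed.

Lemma partial_aut_forth M : partial_aut M ->
  exists M', partial_aut M' /\ incl M M' /\
    forall v p, In p M -> adjU E v (fst p) -> In v (map fst M').
Proof.
  intros HM.
  assert (F : finite_set (fun v => exists p, In p M /\ adjU E (fst p) v)).
  { apply finite_bigor. intros p _. apply finite_neighbours; auto. }
  destruct (finite_enum _ F) as [L [_ HL]].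
  destruct (partial_aut_extend_list L M HM) as [M' [H1 [H2 H3]]].
  - intros v Hv. apply HL in Hv. destruct Hv as [p [Hp Hpv]]. exists p. split; auto. apply adjU_sym; auto.
  - exists M'. split; auto. split; auto. intros v p Hp Hv. apply H3, HL. exists p.
    split; auto. apply adjU_sym; auto.
Qed.

Lemma partial_aut_back_forth M : partial_aut M ->
  exists M', partial_aut M' /\ incl M M' /\
    (forall v p, In p M -> adjU E v (fst p) -> In v (map fst M')) /\
    (forall v p, In p M -> adjU E v (snd p) -> In v (map snd M')).
Proof.
  intros HM. destruct (partial_aut_forth M HM) as [M1 [H1 [I1 D1]]].
  destruct (partial_aut_forth _ (partial_aut_swap M1 H1)) as [M2 [H2 [I2 D2]]].
  exists (swap_pairs M2). split; [apply partial_aut_swap; auto|].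
  assert (I3 : incl M1 (swap_pairs M2)).
  { intros [a b] H. apply in_swap_pairs. apply I2. apply in_swap_pairs. auto. }
  split; [intros p Hp; apply I3, I1; auto|]. split.
  - intros v p Hp Hv. specialize (D1 v p Hp Hv). apply in_map_iff in D1.
    destruct D1 as [q [<- Hq]]. apply in_map. auto.
  - intros v [a b] Hp Hv. rewrite swap_pairs_snd. apply (D2 v (b, a)); auto.
    apply in_swap_pairs. auto.
Qed.

(** One round absorbs all neighbours of the current domain and range, finitely many by local
    finiteness; by connectedness the union of the rounds is total and onto. *)
Theorem one_step_conn_hom : conn_hom E.
Proof.
  intros S f Hic Hinj HE. destruct S as [|o S'].
  { exists (fun x => x). split; [apply is_aut_id|intros x []]. }
  set (S := o :: S') in *.
  set (M0 := map (fun x => (x, f x)) S).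
  assert (HM0 : partial_aut M0).
  { split.
    - intros p q Hp Hq. apply in_map_iff in Hp, Hq. destruct Hp as [x [<- Hx]], Hq as [y [<- Hy]].
      simpl fst. simpl snd. split; auto. split; [congruence|auto].
    - unfold M0. rewrite map_map. simpl. rewrite map_id. auto. }
  destruct (choice_fun (fun a b : {M | partial_aut M} =>
    incl (proj1_sig a) (proj1_sig b) /\
    (forall v p, In p (proj1_sig a) -> adjU E v (fst p) -> In v (map fst (proj1_sig b))) /\
    (forall v p, In p (proj1_sig a) -> adjU E v (snd p) -> In v (map snd (proj1_sig b)))))
    as [next Hnext].
  { intros [M HM]. destruct (partial_aut_back_forth M HM) as [M' [H1 H2]].
    exists (exist _ M' H1). auto. }
  set (st := fun n => Nat.iter n next (exist _ M0 HM0)).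
  set (Ms := fun n => proj1_sig (st n)).
  assert (Hst : forall n, partial_aut (Ms n)) by (intros n; apply (proj2_sig (st n))).
  assert (Hmono : forall n m, n <= m -> incl (Ms n) (Ms m)).
  { intros n m H. induction H as [|m H IH]; [apply incl_refl|].
    intros p Hp. apply (proj1 (Hnext (st m))). apply IH. auto. }
  assert (Hpair : forall p q n m, In p (Ms n) -> In q (Ms m) ->
    (fst p = fst q <-> snd p = snd q) /\ (E (fst p) (fst q) <-> E (snd p) (snd q))).
  { intros p q n m Hp Hq. apply (proj1 (Hst (Nat.max n m))).
    - apply (Hmono n); [lia|auto].
    - apply (Hmono m); [lia|auto]. }
  assert (Hdom : forall x, exists y n, In (x, y) (Ms n)).
  { intros x. apply (conn_invariant E (fun _ => True) (fun x => exists y n, In (x, y) (Ms n)) o x).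
    - apply Hconn; auto.
    - exists (f o), 0. left. auto.
    - intros a b _ _ Hab [y [n Hy]].
      assert (Hb : In b (map fst (Ms (Datatypes.S n)))).
      { apply (proj1 (proj2 (Hnext (st n))) b (a, y)); auto. apply adjU_sym; auto. }
      apply in_map_iff in Hb. destruct Hb as [[b' z] [<- Hb]]. exists z, (Datatypes.S n). auto. }
  assert (Hran : forall y, exists x n, In (x, y) (Ms n)).
  { intros y. apply (conn_invariant E (fun _ => True) (fun y => exists x n, In (x, y) (Ms n)) (f o) y).
    - apply Hconn; auto.
    - exists o, 0. left. auto.
    - intros a b _ _ Hab [x [n Hx]].
      assert (Hb : In b (map snd (Ms (Datatypes.S n)))).
      { apply (proj2 (proj2 (Hnext (st n))) b (x, a)); auto. apply adjU_sym; auto. }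
      apply in_map_iff in Hb. destruct Hb as [[z b'] [<- Hb]]. exists z, (Datatypes.S n). auto. }
  destruct (choice_fun _ Hdom) as [g Hg]. destruct (choice_fun _ Hran) as [h Hh].
  exists g. split; [split|].
  - exists h. split.
    + intros x. destruct (Hg x) as [n Hn], (Hh (g x)) as [m Hm].
      apply (proj1 (Hpair _ _ _ _ Hm Hn)). auto.
    + intros y. destruct (Hg (h y)) as [n Hn], (Hh y) as [m Hm].
      apply (proj1 (Hpair _ _ _ _ Hn Hm)). auto.
  - intros x y. destruct (Hg x) as [n Hn], (Hg y) as [m Hm].
    apply (proj2 (Hpair _ _ _ _ Hn Hm)).
  - intros x Hx. destruct (Hg x) as [n Hn].
    assert (H0 : In (x, f x) (Ms 0)) by (unfold Ms, M0; simpl; apply (in_map (fun x => (x, f x)) S x Hx)).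
    apply (proj1 (Hpair _ _ _ _ Hn H0)). auto.
Qed.

End BackAndForth.

(** * Bipartite graphs with one-step extensions *)

(** Reads the side off the relation alone: without isolated vertices, the X side consists of the
    vertices with an out-arc. In this form it transfers along isomorphisms. *)
Definition same_side {W : Type} (R : W -> W -> Prop) (u v : W) : Prop :=
  (exists w, R u w) <-> (exists w, R v w).

Definition building_block {W : Type} (R : W -> W -> Prop) : Prop :=
  connected R /\ locally_finite R /\ (forall w, exists w', adjU R w w') /\
  one_step_extendable R (same_side R).

Lemma conn_iso {T U : Type} (RT : T -> T -> Prop) (RU : U -> U -> Prop) (f : T -> U) (P : T -> Prop) (Q : U -> Prop) a b :
  (forall x y, adjU RT x y -> adjU RU (f x) (f y)) -> (forall x, P x -> Q (f x)) ->
  conn RT P a b -> conn RU Q (f a) (f b).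
Proof.
  intros H HPQ Hc. induction Hc as [x y [H1 [H2 H3]]| |x y z _ IH1 _ IH2].
  - apply conn_step; auto.
  - apply conn_refl.
  - eapply conn_trans; eauto.
Qed.

Lemma building_block_iso {T U : Type} (RT : T -> T -> Prop) (RU : U -> U -> Prop) :
  rel_iso RT RU -> building_block RU -> building_block RT.
Proof.
  intros [f [g [gf [fg Hf]]]] [Hc [Hlf [Hn Ho]]].
  assert (Hg : forall a b, RU a b <-> RT (g a) (g b)).
  { intros a b. rewrite Hf, !fg. tauto. }
  assert (Af : forall a b, adjU RT a b <-> adjU RU (f a) (f b)).
  { intros a b. unfold adjU. rewrite !Hf. tauto. }
  assert (Ag : forall a b, adjU RU a b <-> adjU RT (g a) (g b)).
  { intros a b. unfold adjU. rewrite !Hg. tauto. }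
  assert (Hs : forall a, (exists w, RT a w) <-> exists w, RU (f a) w).
  { intros a. split; intros [w Hw].
    - exists (f w). apply Hf; auto.
    - exists (g w). apply Hf. rewrite fg. auto. }
  split; [|split; [|split]].
  - intros a b _ _. rewrite <- (gf a), <- (gf b).
    apply (conn_iso RU RT g (fun _ => True)); auto.
    + intros; apply Ag; auto.
    + apply Hc; auto.
  - intros v. destruct (Hlf (f v)) as [[l1 H1] [l2 H2]]. split.
    + exists (map g l1). intros w Hw. apply in_map_iff. exists (f w). split; auto. apply H1, Hf; auto.
    + exists (map g l2). intros w Hw. apply in_map_iff. exists (f w). split; auto. apply H2, Hf; auto.
  - intros w. destruct (Hn (f w)) as [w' Hw']. exists (g w'). apply Af. rewrite fg. auto.
  - intros M v HM HK Hic [p0 [Hp0 Hv]] Nv.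
    set (F := fun p : T * T => (f (fst p), f (snd p))).
    assert (Hfst : map fst (map F M) = map f (map fst M)) by (rewrite !map_map; auto).
    assert (Finj : forall a b, f a = f b -> a = b).
    { intros a b He. rewrite <- (gf a), He. auto. }
    destruct (Ho (map F M) (f v)) as [v' [Kv' Hv']].
    + intros p q Hp Hq. apply in_map_iff in Hp, Hq. destruct Hp as [p' [<- Hp]], Hq as [q' [<- Hq]].
      destruct (HM p' q' Hp Hq) as [E1 E2]. simpl. rewrite <- !Hf.
      split; auto. split; intros He; apply f_equal; apply E1; auto.
    + intros p Hp. apply in_map_iff in Hp. destruct Hp as [p' [<- Hp]]. simpl.
      specialize (HK p' Hp). unfold same_side in *. rewrite <- !Hs. auto.
    + rewrite Hfst. intros a b Ha Hb. apply in_map_iff in Ha, Hb.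
      destruct Ha as [a' [<- Ha]], Hb as [b' [<- Hb]].
      apply (conn_iso RT RU f (fun v => In v (map fst M))).
      * intros; apply Af; auto.
      * intros; apply in_map; auto.
      * apply Hic; auto.
    + exists (F p0). split; [apply in_map; auto|]. simpl. apply Af; auto.
    + rewrite Hfst. intros Hi. apply in_map_iff in Hi. destruct Hi as [w [He Hw]].
      apply Finj in He. subst. auto.
    + exists (g v'). split.
      * unfold same_side in *. rewrite !Hs, fg. auto.
      * intros p q Hp Hq.
        assert (HF : forall p, In p ((v, g v') :: M) -> In (F p) ((f v, v') :: map F M)).
        { intros r [<-|Hr]; [left; unfold F; simpl; rewrite fg; auto|right; apply in_map; auto]. }
        destruct (Hv' _ _ (HF p Hp) (HF q Hq)) as [E1 E2]. simpl in *. rewrite !Hf. split; auto.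
        split; intros He; apply Finj, E1; congruence.
Qed.

(** If all of [Q] were used, its preimages would be [cardf Q] distinct elements of [P] other than
    [v], which are too few. *)
Lemma fresh_image {T U : Type} (M : list (T * U)) (P : T -> Prop) (Q : U -> Prop) v :
  finite_set P -> finite_set Q -> cardf P <= cardf Q ->
  (forall p q, In p M -> In q M -> (fst p = fst q <-> snd p = snd q)) ->
  (forall p, In p M -> Q (snd p) -> P (fst p)) ->
  P v -> ~ In v (map fst M) -> exists v', Q v' /\ ~ In v' (map snd M).
Proof.
  intros FP FQ Hle HM HQ Hv Nv. apply NNPP. intros N.
  destruct (choice_fun (fun y x => Q y -> In (x, y) M)) as [pre Hpre].
  { intros y. destruct (classic (Q y)) as [Hy|Hy]; [|exists v; tauto].
    destruct (classic (In y (map snd M))) as [Hi|Hi]; [|exfalso; eauto].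
    apply in_map_iff in Hi. destruct Hi as [[x y'] [<- Hi]]. exists x. auto. }
  destruct (cardf_card Q FQ) as [l [Nl [Ll Hl]]].
  assert (F' : finite_set (fun x => P x /\ x <> v)) by (apply finite_sub with (2 := FP); tauto).
  destruct (cardf_card _ F') as [m [Nm [Lm Hm]]].
  assert (Hlm : length (map pre l) <= length m).
  { apply NoDup_incl_length.
    - assert (Hinj : forall a b, In a l -> In b l -> pre a = pre b -> a = b).
      { intros a b Ha Hb He. apply Hl in Ha, Hb.
        apply (proj1 (HM _ _ (Hpre a Ha) (Hpre b Hb)) He). }
      clear - Nl Hinj. induction l as [|a l IH]; [constructor|]. apply NoDup_cons_iff in Nl.
      simpl. constructor.
      + intros Hi. apply in_map_iff in Hi. destruct Hi as [b [He Hb]]. apply (proj1 Nl).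
        rewrite <- (Hinj b a); simpl; auto.
      + apply IH; [tauto|]. intros; apply Hinj; simpl; auto.
    - intros x Hx. apply in_map_iff in Hx. destruct Hx as [y [<- Hy]]. apply Hl in Hy.
      apply Hm. split; [apply (HQ _ (Hpre y Hy)); auto|].
      intros He. apply Nv. rewrite <- He. apply (in_map fst _ _ (Hpre y Hy)). }
  rewrite length_map, Ll, Lm in Hlm.
  assert (cardf (fun x => P x /\ x <> v) < cardf P); [|lia].
  apply cardf_lt with v; tauto.
Qed.

Section ColouredBlocks.
Context {W : Type} (R : W -> W -> Prop) (col : W -> bool).
Hypothesis Hcol : forall x y, R x y -> col x = true /\ col y = false.
Hypothesis Hconn : connected R.
Hypothesis Hlf : locally_finite R.
Hypothesis Hnb : forall w, exists w', adjU R w w'.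

Definition coloured_piso (M : list (W * W)) : Prop :=
  (forall p, In p M -> col (fst p) = col (snd p)) /\
  (forall p q, In p M -> In q M -> (fst p = fst q <-> snd p = snd q)) /\
  (forall p q, In p M -> In q M -> (adjU R (fst p) (fst q) <-> adjU R (snd p) (snd q))).

Lemma same_side_col u v : same_side R u v <-> col u = col v.
Proof.
  assert (H : forall u, (exists w, R u w) <-> col u = true).
  { intros w. split.
    - intros [w' Hw]. apply (Hcol _ _ Hw).
    - intros Cw. destruct (Hnb w) as [w' [Hw|Hw]]; [eauto|]. apply Hcol in Hw. destruct Hw; congruence. }
  unfold same_side. rewrite !H. destruct (col u), (col v); intuition congruence.
Qed.

Lemma coloured_building_block :
  (forall M v u u', coloured_piso M -> induced_connected R (fun w => In w (map fst M)) ->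
     In (u, u') M -> adjU R v u -> ~ In v (map fst M) ->
     exists v', col v' = col v /\ ~ In v' (map snd M) /\
       forall p, In p M -> (adjU R v (fst p) <-> adjU R v' (snd p))) ->
  building_block R.
Proof.
  intros H. split; [|split; [|split]]; auto.
  intros M v HM HK Hic [[u u'] [Hu Hv]] Nv.
  assert (HMc : coloured_piso M).
  { split; [|split].
    - intros p Hp. apply same_side_col. auto.
    - intros p q Hp Hq. apply (HM p q Hp Hq).
    - intros p q Hp Hq. unfold adjU. rewrite (proj2 (HM p q Hp Hq)), (proj2 (HM q p Hq Hp)). tauto. }
  destruct (H M v u u' HMc Hic Hu Hv Nv) as [v' [Cv' [Nv' Ha]]].
  exists v'. split; [apply same_side_col; auto|].
  destruct HMc as [H1 [H2 H3]].
  assert (Nl : forall z, ~ adjU R z z) by (intros z Hz; apply (adj_col R col Hcol _ _ Hz); auto).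
  assert (Sy : forall a b, adjU R a b <-> adjU R b a) by (intros; split; apply adjU_sym).
  apply (piso_bipartite R col Hcol).
  - intros p [<-|Hp]; simpl; auto.
  - intros p q [<-|Hp] [<-|Hq]; simpl; auto.
    + tauto.
    + split; intros He; exfalso; [apply Nv|apply Nv']; rewrite He; apply in_map; auto.
    + split; intros He; exfalso; [apply Nv|apply Nv']; rewrite <- He; apply in_map; auto.
  - intros p q [<-|Hp] [<-|Hq]; simpl; auto.
    + split; intros Hx; exfalso; eapply Nl; eauto.
    + rewrite Sy, (Sy (snd p)). auto.
Qed.

(** Once the domain contains an edge, a partial isomorphism agrees there with an automorphism [g],
    and by degree at most two it agrees with [g] along the connected domain; so [g v] extends it. If
    the domain is just [u], any neighbour of [u'] will do. *)
Lemma cycle_block :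
  (forall u n a b, adjU R u n -> adjU R u a -> adjU R u b -> a <> n -> b <> n -> a = b) ->
  (forall u n u' n', adjU R u n -> adjU R u' n' -> col u = col u' ->
     exists g, is_aut R g /\ g u = u' /\ g n = n') ->
  building_block R.
Proof.
  intros Hdeg Het. apply coloured_building_block. intros M v u u' [H1 [H2 H3]] Hic Hu Hv Nv.
  assert (Sy : forall a b, adjU R a b -> adjU R b a) by (intros; apply adjU_sym; auto).
  destruct (classic (forall p, In p M -> fst p = u)) as [Hone|Hmore].
  { destruct (Hnb u') as [v' Hv']. exists v'.
    assert (Huu : forall p, In p M -> snd p = u').
    { intros p Hp. apply (H2 p (u, u') Hp Hu). apply Hone; auto. }
    split; [|split].
    - pose proof (H1 _ Hu) as Cu. simpl in Cu. pose proof (adj_col R col Hcol _ _ Hv).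
      pose proof (adj_col R col Hcol _ _ Hv'). destruct (col u), (col u'), (col v), (col v'); congruence.
    - intros Hi. apply in_map_iff in Hi. destruct Hi as [p [<- Hp]]. rewrite (Huu p Hp) in Hv'.
      apply (adj_col R col Hcol _ _ Hv'); auto.
    - intros p Hp. rewrite (Hone p Hp), (Huu p Hp). split; auto. }
  apply not_all_ex_not in Hmore. destruct Hmore as [q Hq]. apply imply_to_and in Hq. destruct Hq as [Hq Nq].
  assert (Hn : exists n n', In (n, n') M /\ adjU R u n).
  { destruct (conn_crossing R _ (fun w => w = u) u (fst q) (Hic u (fst q) (in_map fst _ _ Hu) (in_map fst _ _ Hq)))
      as [a [b [_ [Hb [Hab [-> _]]]]]]; auto.
    apply in_map_iff in Hb. destruct Hb as [[b' n'] [<- Hb]]. eauto. }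
  destruct Hn as [n [n' [Hn Hun]]].
  destruct (Het u n u' n') as [g [Hg [Gu Gn]]]; auto.
  { apply (H3 (u, u') (n, n')); auto. }
  { apply (H1 _ Hu). }
  assert (Hgi : forall a b, g a = g b -> a = b).
  { intros a b He. destruct Hg as [[h [hg _]] _]. rewrite <- (hg a), He. auto. }
  assert (Hagree : forall p, In p M -> snd p = g (fst p)).
  { intros p Hp.
    cut ((forall r, In r M -> fst r = fst p -> snd r = g (fst r)) /\
         exists r, In r M /\ adjU R (fst p) (fst r) /\ snd r = g (fst r)).
    { intros [K _]. apply K; auto. }
    apply (conn_invariant R (fun w => In w (map fst M)) (fun w => (forall r, In r M -> fst r = w -> snd r = g (fst r)) /\
         exists r, In r M /\ adjU R w (fst r) /\ snd r = g (fst r)) u (fst p)).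
    - apply Hic; [apply (in_map fst _ _ Hu)|apply in_map; auto].
    - split.
      + intros r Hr He. rewrite He, Gu. apply (H2 r (u, u') Hr Hu). auto.
      + exists (n, n'). simpl. auto.
    - intros a b Ha Hb Hab [I1 [r [Hr [Har Er]]]].
      apply in_map_iff in Ha. destruct Ha as [pa [Ea Hpa]]. split.
      + intros pb Hpb Eb. destruct (classic (fst pb = fst r)) as [Hbr|Hbr].
        { rewrite Hbr, <- Er. apply (H2 pb r Hpb Hr). auto. }
        assert (Ga : snd pa = g a) by (rewrite <- Ea; apply I1; auto).
        apply (Hdeg (g a) (g (fst r))).
        * apply (aut_adjU R g a (fst r) Hg); auto.
        * rewrite <- Ga. apply (H3 pa pb); auto. rewrite Ea, Eb. auto.
        * apply (aut_adjU R g a (fst pb) Hg). rewrite Eb. auto.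
        * rewrite <- Er. intros He. apply Hbr. apply (H2 pb r Hpb Hr). auto.
        * intros He. apply Hbr, Hgi, He.
      + exists pa. split; auto. split; [rewrite Ea; auto|]. apply I1; auto. }
  exists (g v). split; [|split].
  - pose proof (H1 _ Hu) as Cu. simpl in Cu. pose proof (adj_col R col Hcol _ _ Hv).
    assert (Hgv : adjU R (g v) u') by (rewrite <- Gu; apply (aut_adjU R g v u Hg); auto).
    pose proof (adj_col R col Hcol _ _ Hgv). destruct (col u), (col u'), (col v), (col (g v)); congruence.
  - intros Hi. apply in_map_iff in Hi. destruct Hi as [p [He Hp]]. apply Nv.
    rewrite (Hagree p Hp) in He. apply Hgi in He. rewrite <- He. apply in_map; auto.
  - intros p Hp. rewrite (Hagree p Hp). apply aut_adjU; auto.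
Qed.

Lemma acyclic_single_neighbour (L : list W) v u w :
  (forall x l, ~ is_cycle R x l) -> induced_connected R (fun t => In t L) ->
  ~ In v L -> In u L -> In w L -> adjU R v u -> adjU R v w -> u = w.
Proof.
  intros Hac Hic Nv Hu Hw Au Aw. apply NNPP. intros Nuw.
  destruct (conn_simple_path R _ u w Hu (Hic u w Hu Hw)) as [l [Nd [Ch [La Hin]]]].
  apply (Hac v (u :: l)). split; [|split; [|split]].
  - constructor; auto.
  - destruct l as [|x l]; [simpl in La; congruence|simpl; lia].
  - split; auto.
  - rewrite last_cons, La. apply adjU_sym; auto.
Qed.

(** By acyclicity [v] is adjacent only to [u] in the connected domain, and a fresh neighbour of [u']
    only to [u'] in the range. Equal degrees guarantee a fresh neighbour. *)
Lemma tree_block :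
  (forall x l, ~ is_cycle R x l) ->
  (forall u u', col u = col u' -> cardf (adjU R u) = cardf (adjU R u')) ->
  building_block R.
Proof.
  intros Hac Hdeg. apply coloured_building_block. intros M v u u' [H1 [H2 H3]] Hic Hu Hv Nv.
  assert (Hic' : induced_connected R (fun w => In w (map snd M))).
  { apply piso_image_connected; auto. apply (piso_bipartite R col Hcol); auto. }
  destruct (fresh_image M (adjU R u) (adjU R u') v) as [v' [Hv' Nv']].
  - apply finite_neighbours; auto.
  - apply finite_neighbours; auto.
  - rewrite (Hdeg u u' (H1 _ Hu)). auto.
  - auto.
  - intros p Hp. apply (H3 (u, u') p Hu Hp).
  - apply adjU_sym; auto.
  - auto.
  - exists v'. split; [|split; auto].
    + pose proof (H1 _ Hu) as Cu. simpl in Cu. pose proof (adj_col R col Hcol _ _ Hv).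
      pose proof (adj_col R col Hcol _ _ Hv'). destruct (col u), (col u'), (col v), (col v'); congruence.
    + intros p Hp. pose proof (in_map fst _ _ Hp) as Ip. pose proof (in_map snd _ _ Hp) as Jp. split; intros Ha.
      * assert (He : fst p = u).
        { apply (acyclic_single_neighbour (map fst M) v); auto. apply (in_map fst _ _ Hu). }
        apply (H2 p (u, u') Hp Hu) in He. simpl in He. rewrite He. apply adjU_sym; auto.
      * assert (He : snd p = u').
        { apply (acyclic_single_neighbour (map snd M) v'); auto; [apply (in_map snd _ _ Hu)|].
          apply adjU_sym; auto. }
        apply (H2 p (u, u') Hp Hu) in He. simpl in He. rewrite He. auto.
Qed.

Lemma complete_block :
  finite_set (fun _ : W => True) -> (forall u v, col u <> col v -> adjU R u v) -> building_block R.
Proof.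
  intros HF Hall. apply coloured_building_block. intros M v u u' [H1 [H2 H3]] Hic Hu Hv Nv.
  assert (Fc : finite_set (fun w => col w = col v)) by (apply finite_sub with (2 := HF); auto).
  destruct (fresh_image M (fun w => col w = col v) (fun w => col w = col v) v) as [v' [Cv' Nv']]; auto.
  - intros p Hp. rewrite (H1 p Hp). auto.
  - exists v'. split; auto. split; auto. intros p Hp.
    assert (Hadj : forall a b, adjU R a b <-> col a <> col b).
    { intros a b. split; [apply adj_col; auto|apply Hall]. }
    rewrite !Hadj, (H1 p Hp), Cv'. tauto.
Qed.

(** [idx] names the removed edges. Vertices of opposite colour are non-adjacent exactly when their
    indices agree, so a partial isomorphism acts on indices. The image of [v] takes the index of its
    mate's image if the mate is in the domain, and a fresh index otherwise. *)
Lemma CP_block {I : Type} (idx : W -> I) :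
  finite_set (fun _ : I => True) -> (forall u v, col u = col v -> idx u = idx v -> u = v) ->
  (forall b i, exists w, col w = b /\ idx w = i) ->
  (forall u v, adjU R u v <-> col u <> col v /\ idx u <> idx v) -> building_block R.
Proof.
  intros HF Hinj Hsur Hadj. apply coloured_building_block. intros M v u u' [H1 [H2 H3]] Hic Hu Hv Nv.
  assert (Hidx : forall p q, In p M -> In q M -> (idx (fst p) = idx (fst q) <-> idx (snd p) = idx (snd q))).
  { intros p q Hp Hq. pose proof (H1 p Hp). pose proof (H1 q Hq).
    destruct (bool_dec (col (fst p)) (col (fst q))) as [Hc|Hc].
    - transitivity (fst p = fst q); [split; [apply Hinj; auto|congruence]|].
      rewrite (H2 p q Hp Hq). split; [congruence|apply Hinj; congruence].
    - pose proof (H3 p q Hp Hq) as K. rewrite !Hadj in K.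
      assert (col (snd p) <> col (snd q)) by congruence.
      destruct (classic (idx (fst p) = idx (fst q))), (classic (idx (snd p) = idx (snd q))); tauto. }
  assert (Hfin : forall i, (forall p, In p M -> (idx (fst p) = idx v <-> idx (snd p) = i)) ->
    exists v', col v' = col v /\ ~ In v' (map snd M) /\
       forall p, In p M -> (adjU R v (fst p) <-> adjU R v' (snd p))).
  { intros i Hi. destruct (Hsur (col v) i) as [v' [Cv' Iv']]. exists v'. split; auto. split.
    - intros Hin. apply in_map_iff in Hin. destruct Hin as [p [He Hp]]. apply Nv.
      replace v with (fst p); [apply in_map; auto|]. apply Hinj.
      + rewrite (H1 p Hp), He. auto.
      + apply Hi; auto. congruence.
    - intros p Hp. rewrite !Hadj, Cv', (H1 p Hp), Iv'. pose proof (Hi p Hp) as K.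
      assert (K' : idx v <> idx (fst p) <-> i <> idx (snd p)).
      { split; intros Hne He; apply Hne; symmetry; apply K; auto. }
      rewrite K'. tauto. }
  destruct (classic (exists p, In p M /\ idx (fst p) = idx v)) as [[p [Hp Ip]]|Nidx].
  - apply (Hfin (idx (snd p))). intros q Hq. rewrite <- Ip. apply Hidx; auto.
  - destruct (fresh_image (map (fun p => (idx (fst p), idx (snd p))) M) (fun _ => True) (fun _ => True) (idx v))
      as [i [_ Ni]]; auto.
    + intros p q Hp Hq. apply in_map_iff in Hp, Hq.
      destruct Hp as [p' [<- Hp]], Hq as [q' [<- Hq]]. simpl. apply Hidx; auto.
    + rewrite map_map. simpl. intros Hi. apply in_map_iff in Hi. destruct Hi as [p [He Hp]]. eauto.
    + apply (Hfin i). intros p Hp. split; intros He; exfalso; [eauto|]. apply Ni. rewrite map_map. simpl.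
      rewrite <- He. apply (in_map (fun p => idx (snd p)) M p Hp).
Qed.

End ColouredBlocks.

(** * The listed graphs are building blocks *)

Definition side {X Y : Type} (u : X + Y) : bool := match u with inl _ => true | inr _ => false end.

Lemma bor_side (B : bigraph) u v : bor B u v -> side u = true /\ side v = false.
Proof. destruct u, v; simpl; tauto. Qed.

Lemma finite_fin k : finite_set (fun _ : fin k => True).
Proof.
  apply finite_sub with (fun i : fin k => proj1_sig i < k); [intros [i Hi]; auto|].
  apply (finite_sig (fun i => i < k) (fun i => i < k)). exists (seq 0 k). intros i Hi. apply in_seq. lia.
Qed.

Lemma finite_sum {X Y : Type} : finite_set (fun _ : X => True) -> finite_set (fun _ : Y => True) ->
  finite_set (fun _ : X + Y => True).
Proof.
  intros [l Hl] [m Hm]. exists (map inl l ++ map inr m). intros [x|y] _; apply in_or_app.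
  - left. apply in_map. auto.
  - right. apply in_map. auto.
Qed.

Lemma finite_locally_finite {W : Type} (R : W -> W -> Prop) :
  finite_set (fun _ : W => True) -> locally_finite R.
Proof. intros H v. split; apply finite_sub with (2 := H); auto. Qed.

Lemma complete_bg_block m n : 1 <= m -> 1 <= n -> building_block (bor (complete_bg m n)).
Proof.
  intros Hm Hn.
  assert (HF : finite_set (fun _ : fin m + fin n => True)) by (apply finite_sum; apply finite_fin).
  assert (Hall : forall u v : fin m + fin n, side u <> side v -> adjU (bor (complete_bg m n)) u v).
  { intros [u|u] [v|v] H; simpl in H; try congruence; [left|right]; exact I. }
  set (x0 := exist _ 0 Hm : fin m). set (y0 := exist _ 0 Hn : fin n).
  apply (complete_block _ side (bor_side _)).
  - intros u v _ _.
    assert (Hb : forall u, conn (bor (complete_bg m n)) (fun _ => True) (inl x0) u).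
    { intros [u'|u'].
      - apply conn_trans with (inr y0); apply conn_step; auto; apply Hall; simpl; discriminate.
      - apply conn_step; auto. apply Hall. simpl; discriminate. }
    apply conn_trans with (inl x0); auto. apply conn_sym; auto.
  - apply finite_locally_finite; auto.
  - intros [w|w]; [exists (inr y0)|exists (inl x0)]; apply Hall; simpl; discriminate.
  - auto.
  - auto.
Qed.

Lemma CP_bg_block n : 3 <= n -> building_block (bor (CP_bg n)).
Proof.
  intros Hn. set (W := (fin n + fin n)%type). set (R := (bor (CP_bg n) : W -> W -> Prop)).
  change (building_block R).
  assert (HF : finite_set (fun _ : W => True)) by (apply finite_sum; apply finite_fin).
  set (idx := fun u : W => match u with inl i => i | inr i => i end).
  assert (Hadj : forall u v : W, adjU R u v <-> side u <> side v /\ idx u <> idx v).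
  { assert (Hne : forall i j : fin n, proj1_sig i <> proj1_sig j <-> i <> j).
    { intros i j. split; intros H He; apply H; [congruence|apply sig_eq; auto]. }
    intros [u|u] [v|v]; unfold adjU, R; simpl; rewrite ?Hne; intuition congruence. }
  assert (Hthird : forall i j : fin n, exists l, l <> i /\ l <> j).
  { intros i j.
    assert (Hx : exists l, l < n /\ l <> proj1_sig i /\ l <> proj1_sig j).
    { destruct (Nat.eq_dec 0 (proj1_sig i)), (Nat.eq_dec 0 (proj1_sig j)),
        (Nat.eq_dec 1 (proj1_sig i)), (Nat.eq_dec 1 (proj1_sig j));
      first [exists 0; lia | exists 1; lia | exists 2; lia]. }
    destruct Hx as [l [Hl [N1 N2]]]. exists (exist _ l Hl).
    split; intros He; [apply N1|apply N2]; rewrite <- He; auto. }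
  assert (Hsur : forall b i, exists w : W, side w = b /\ idx w = i).
  { intros [|] i; [exists (inl i)|exists (inr i)]; auto. }
  assert (Hstep : forall u v : W, side u <> side v -> idx u <> idx v -> conn R (fun _ => True) u v).
  { intros u v H1 H2. apply conn_step; auto. apply Hadj; auto. }
  assert (Hsame : forall u v : W, side u = side v -> conn R (fun _ => True) u v).
  { intros u v H. destruct (Hthird (idx u) (idx v)) as [l [N1 N2]].
    destruct (Hsur (negb (side u)) l) as [w [Sw Iw]].
    apply conn_trans with w; apply Hstep.
    - rewrite Sw. intros He. apply (no_fixpoint_negb _ (eq_sym He)).
    - congruence.
    - rewrite Sw, H. apply no_fixpoint_negb.
    - congruence. }
  apply (CP_block R (side : W -> bool) (bor_side (CP_bg n))) with (idx := idx).
  - intros u v _ _. destruct (bool_dec (side u) (side v)) as [H|H]; [apply Hsame; auto|].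
    destruct (Hthird (idx u) (idx u)) as [l [N1 _]].
    destruct (Hsur (side v) l) as [w [Sw Iw]].
    apply conn_trans with w; [apply Hstep; congruence|apply Hsame; auto].
  - apply finite_locally_finite; auto.
  - intros w. destruct (Hthird (idx w) (idx w)) as [l [N1 _]].
    destruct (Hsur (negb (side w)) l) as [w' [Sw Iw]]. exists w'. apply Hadj.
    split; [rewrite Sw; intros He; apply (no_fixpoint_negb _ (eq_sym He))|congruence].
  - apply finite_fin.
  - intros [u|u] [v|v] H1 H2; simpl in *; congruence.
  - auto.
  - auto.
Qed.

Lemma Tab_block B a b : 2 <= a -> 2 <= b -> is_Tab B a b -> building_block (bor B).
Proof.
  intros Ha Hb [[Hc Hac] [_ [HX HY]]].
  assert (Hadj : forall u v, adjU (bund B) u v <-> adjU (bor B) u v).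
  { intros u v. unfold adjU, bund. tauto. }
  assert (Hnx : forall x, exists l, NoDup l /\ length l = a /\ forall w, In w l <-> adjU (bor B) (inl x) w).
  { intros x. destruct (HX x) as [l [Ll [Nl Hl]]]. exists (map inr l). split; [|split].
    - apply FinFun.Injective_map_NoDup; auto. intros p q He. congruence.
    - rewrite length_map. auto.
    - intros w. rewrite in_map_iff. unfold adjU. destruct w as [x'|y]; simpl.
      + split; [intros [y [He _]]; discriminate|tauto].
      + split; [intros [y' [He Hy]]; injection He as <-; left; apply Hl; auto|].
        intros [H|H]; [exists y; split; auto; apply Hl; auto|tauto]. }
  assert (Hny : forall y, exists l, NoDup l /\ length l = b /\ forall w, In w l <-> adjU (bor B) (inr y) w).
  { intros y. destruct (HY y) as [l [Ll [Nl Hl]]]. exists (map inl l). split; [|split].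
    - apply FinFun.Injective_map_NoDup; auto. intros p q He. congruence.
    - rewrite length_map. auto.
    - intros w. rewrite in_map_iff. unfold adjU. destruct w as [x|y']; simpl.
      + split; [intros [x' [He Hx]]; injection He as <-; right; apply Hl; auto|].
        intros [H|H]; [tauto|exists x; split; auto; apply Hl; auto].
      + split; [intros [x [He _]]; discriminate|tauto]. }
  apply (tree_block _ side (bor_side _)).
  - intros u v _ _. apply conn_graph_mono with (bund B); [intros; apply Hadj; auto|]. apply Hc; auto.
  - intros [x|y].
    + destruct (Hnx x) as [l [_ [_ Hl]]]. split; exists l; intros w Hw; apply Hl; [left|right]; auto.
    + destruct (Hny y) as [l [_ [_ Hl]]]. split; exists l; intros w Hw; apply Hl; [left|right]; auto.
  - intros [x|y].
    + destruct (Hnx x) as [[|w l] [_ [Ll Hl]]]; simpl in Ll; [lia|]. exists w. apply Hl. left; auto.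
    + destruct (Hny y) as [[|w l] [_ [Ll Hl]]]; simpl in Ll; [lia|]. exists w. apply Hl. left; auto.
  - intros x l [Nd [L [Ch Cl]]]. apply (Hac x l); auto.
    + clear - Ch Hadj. revert x Ch. induction l as [|y l IH]; intros x Ch; simpl in *; auto.
      split; [apply Hadj|apply IH]; tauto.
    + apply Hadj; auto.
  - intros [u|u] [v|v] He; simpl in He; try discriminate.
    + destruct (Hnx u) as [l [N1 [L1 H1]]], (Hnx v) as [l' [N2 [L2 H2]]].
      rewrite (cardf_list l), (cardf_list l'); auto. congruence.
    + destruct (Hny u) as [l [N1 [L1 H1]]], (Hny v) as [l' [N2 [L2 H2]]].
      rewrite (cardf_list l), (cardf_list l'); auto. congruence.
Qed.

Section CycleBlock.
Variable k : nat.
Hypothesis Hk : 2 <= k.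
Let kz := Z.of_nat k.
Let R := bor (cycle_bg k).

Lemma zmod_fin z : Z.to_nat (z mod Z.of_nat k) < k.
Proof. pose proof (Z.mod_pos_bound z (Z.of_nat k)). lia. Qed.

(** Integer representatives of the indices, so that rotations and reflections of the cycle are
    affine maps. *)
Definition zfin (z : Z) : fin k := exist _ (Z.to_nat (z mod Z.of_nat k)) (zmod_fin z).

Definition eqk (p q : Z) : Prop := exists t, (q = p + t * Z.of_nat k)%Z.

Lemma eqk_mod p q : eqk p q <-> (p mod kz = q mod kz)%Z.
Proof.
  unfold eqk, kz. split.
  - intros [t ->]. symmetry. apply Z_mod_plus_full.
  - intros H. exists (q / Z.of_nat k - p / Z.of_nat k)%Z.
    pose proof (Z.div_mod p (Z.of_nat k)). pose proof (Z.div_mod q (Z.of_nat k)). lia.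
Qed.

Lemma zfin_eq p q : zfin p = zfin q <-> eqk p q.
Proof.
  rewrite eqk_mod. pose proof (Z.mod_pos_bound p kz). pose proof (Z.mod_pos_bound q kz). unfold kz in *. split.
  - intros H'. apply (f_equal (@proj1_sig _ _)) in H'. simpl in H'. lia.
  - intros H'. apply sig_eq. simpl. lia.
Qed.

Lemma zfin_of_nat (i : fin k) : zfin (Z.of_nat (proj1_sig i)) = i.
Proof.
  apply sig_eq. simpl. destruct i as [i Hi]. simpl. rewrite Z.mod_small by lia. lia.
Qed.

Lemma zfin_surj (i : fin k) : exists z, zfin z = i.
Proof. exists (Z.of_nat (proj1_sig i)). apply zfin_of_nat. Qed.

Lemma cycle_badj p q : badj (cycle_bg k) (zfin p) (zfin q) <-> eqk p q \/ eqk (p + 1) q.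
Proof.
  rewrite !eqk_mod. simpl.
  pose proof (Z.mod_pos_bound p kz). pose proof (Z.mod_pos_bound q kz).
  pose proof (Z.mod_pos_bound (p + 1) kz).
  assert (Hs : (Z.to_nat (p mod Z.of_nat k) + 1) mod k = Z.to_nat ((p + 1) mod kz)).
  { unfold kz in *. rewrite <- (Zplus_mod_idemp_l p 1).
    replace (Z.to_nat (p mod Z.of_nat k) + 1) with (Z.to_nat (p mod Z.of_nat k + 1)) by lia.
    rewrite Z2Nat.inj_mod by lia. rewrite Nat2Z.id. auto. }
  rewrite Hs. unfold kz in *. split; intros [H'|H']; [left|right|left|right]; lia.
Qed.

Lemma adj_xy p q : adjU R (inl (zfin p)) (inr (zfin q)) <-> eqk p q \/ eqk (p + 1) q.
Proof. rewrite <- cycle_badj. unfold adjU, R. simpl. tauto. Qed.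

Lemma adj_yx p q : adjU R (inr (zfin q)) (inl (zfin p)) <-> eqk p q \/ eqk (p + 1) q.
Proof. rewrite <- cycle_badj. unfold adjU, R. simpl. tauto. Qed.

(** Adjacency means that [q - p] is 0 or 1 modulo [k]. Rotations keep this difference; a reflection
    turns it into [r' - r - (q - p)], and [r' = r + 1] makes that exchange 0 and 1. *)
Lemma cycle_affine_aut (s r r' : Z) :
  (s = 1 /\ r' = r \/ s = -1 /\ r' = r + 1)%Z ->
  exists g, is_aut R g /\ (forall p, g (inl (zfin p)) = inl (zfin (s * p + r))) /\
    (forall q, g (inr (zfin q)) = inr (zfin (s * q + r'))).
Proof.
  intros Hs.
  set (aff := fun (s r r' : Z) (u : fin k + fin k) => match u with
    | inl i => inl (zfin (s * Z.of_nat (proj1_sig i) + r))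
    | inr i => inr (zfin (s * Z.of_nat (proj1_sig i) + r')) end).
  assert (Hz : forall (s r p : Z), zfin (s * Z.of_nat (proj1_sig (zfin p)) + r) = zfin (s * p + r)).
  { intros s0 r0 p. apply zfin_eq.
    assert (Hp : eqk (Z.of_nat (proj1_sig (zfin p))) p) by (apply zfin_eq, zfin_of_nat).
    destruct Hp as [t Ht]. exists (s0 * t)%Z.
    set (x := Z.of_nat (proj1_sig (zfin p))) in *. clearbody x. rewrite Ht. ring. }
  assert (Hx : forall s r r' p, aff s r r' (inl (zfin p)) = inl (zfin (s * p + r))).
  { intros. unfold aff. cbv beta iota. rewrite Hz. auto. }
  assert (Hy : forall s r r' p, aff s r r' (inr (zfin p)) = inr (zfin (s * p + r'))).
  { intros. unfold aff. cbv beta iota. rewrite Hz. auto. }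
  assert (Hcases : forall P : fin k + fin k -> Prop, (forall p, P (inl (zfin p))) -> (forall p, P (inr (zfin p))) ->
    forall u, P u).
  { intros P H1 H2 [u|u]; destruct (zfin_surj u) as [z <-]; auto. }
  exists (aff s r r'). split; [split|split; intros; auto].
  (* As [s * s = 1], solving for the argument gives the translation parts [- s * r] and
     [- s * r']. *)
  - exists (aff s (- s * r) (- s * r'))%Z. split; apply Hcases; intros p;
      rewrite ?Hx, ?Hy, ?Hx, ?Hy; do 2 f_equal; destruct Hs as [[-> ->]|[-> ->]]; ring.
  - clearbody aff. intros u v. revert u. apply (Hcases (fun u => R u v <-> R (aff s r r' u) (aff s r r' v))); intros p;
    revert v; apply Hcases; intros q; rewrite ?Hx, ?Hy;
      try (unfold R; simpl; tauto).
    change (badj (cycle_bg k) (zfin p) (zfin q) <->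
            badj (cycle_bg k) (zfin (s * p + r)) (zfin (s * q + r'))).
    rewrite !cycle_badj. unfold eqk.
    destruct Hs as [[-> ->]|[-> ->]]; split; intros [[t Ht]|[t Ht]].
    + left. exists t. lia.
    + right. exists t. lia.
    + left. exists t. lia.
    + right. exists t. lia.
    + right. exists (- t)%Z. lia.
    + left. exists (- t)%Z. lia.
    + right. exists (- t)%Z. lia.
    + left. exists (- t)%Z. lia.
Qed.

Lemma cycle_bg_block : building_block (bor (cycle_bg k)).
Proof.
  assert (HF : finite_set (fun _ : fin k + fin k => True)) by (apply finite_sum; apply finite_fin).
  assert (E0 : forall p, eqk p p) by (intros p; exists 0%Z; lia).
  apply (cycle_block R side (bor_side (cycle_bg k))).
  - assert (Hb : forall n, conn R (fun _ => True) (inr (zfin 0)) (inr (zfin (Z.of_nat n))) /\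
                 conn R (fun _ => True) (inr (zfin 0)) (inl (zfin (Z.of_nat n)))).
    { induction n as [|n [I1 I2]].
      - split; [apply conn_refl|]. apply conn_step; auto. apply adj_yx. auto.
      - assert (I3 : conn R (fun _ => True) (inr (zfin 0)) (inr (zfin (Z.of_nat (S n))))).
        { apply conn_trans with (inl (zfin (Z.of_nat n))); auto. apply conn_step; auto. apply adj_xy.
          right. exists 0%Z. lia. }
        split; auto. apply conn_trans with (inr (zfin (Z.of_nat (S n)))); auto.
        apply conn_step; auto. apply adj_yx. auto. }
    assert (Hall : forall u, conn R (fun _ => True) (inr (zfin 0)) u).
    { intros [u|u]; rewrite <- (zfin_of_nat u); apply Hb. }
    intros u v _ _. apply conn_trans with (inr (zfin 0)); auto. apply conn_sym; auto.
  - apply finite_locally_finite; auto.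
  - intros [u|u]; destruct (zfin_surj u) as [z <-].
    + exists (inr (zfin z)). apply adj_xy. auto.
    + exists (inl (zfin z)). apply adj_yx. auto.
  - assert (Nxx : forall i j, ~ adjU R (inl i) (inl j)) by (intros i j [H|H]; exact H).
    assert (Nyy : forall i j, ~ adjU R (inr i) (inr j)) by (intros i j [H|H]; exact H).
    assert (Zx : forall p q, zfin p <> zfin q -> ~ eqk p q) by (intros p q H He; apply H, zfin_eq, He).
    assert (Tr : forall p q r, eqk p q -> eqk p r -> eqk q r).
    { intros p q r [t ->] [t' ->]. exists (t' - t)%Z. lia. }
    assert (Tr' : forall p q r, eqk (p + 1) r -> eqk (q + 1) r -> eqk p q).
    { intros p q r [t H1] [t' H2]. exists (t - t')%Z. lia. }
    assert (Tr2 : forall p q r, eqk p r -> eqk q r -> eqk p q).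
    { intros p q r [t H1] [t' H2]. exists (t - t')%Z. lia. }
    intros [u|u] [n|n] [a|a] [b|b] H1 H2 H3 N1 N2; try (match goal with
           | H : adjU R (inl ?i) (inl ?j) |- _ => destruct (Nxx i j H)
           | H : adjU R (inr ?i) (inr ?j) |- _ => destruct (Nyy i j H) end);
    destruct (zfin_surj u) as [u' <-], (zfin_surj n) as [n' <-], (zfin_surj a) as [a' <-], (zfin_surj b) as [b' <-];
    f_equal; apply zfin_eq.
    + apply adj_xy in H1, H2, H3.
      assert (M1 : ~ eqk a' n') by (apply Zx; congruence).
      assert (M2 : ~ eqk b' n') by (apply Zx; congruence).
      destruct H1 as [H1|H1], H2 as [H2|H2], H3 as [H3|H3];
        try (exfalso; apply M1; eapply Tr; eassumption);
        try (exfalso; apply M2; eapply Tr; eassumption); eapply Tr; eassumption.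
    + apply adj_yx in H1, H2, H3.
      assert (M1 : ~ eqk a' n') by (apply Zx; congruence).
      assert (M2 : ~ eqk b' n') by (apply Zx; congruence).
      destruct H1 as [H1|H1], H2 as [H2|H2], H3 as [H3|H3];
        try (exfalso; apply M1; first [eapply Tr2; eassumption | eapply Tr'; eassumption]; fail);
        try (exfalso; apply M2; first [eapply Tr2; eassumption | eapply Tr'; eassumption]; fail);
        first [eapply Tr2; eassumption | eapply Tr'; eassumption].
  - assert (Nxx : forall i j, ~ adjU R (inl i) (inl j)) by (intros i j [H|H]; exact H).
    assert (Nyy : forall i j, ~ adjU R (inr i) (inr j)) by (intros i j [H|H]; exact H).
    assert (Key : forall p q p' q', adjU R (inl (zfin p)) (inr (zfin q)) ->
      adjU R (inl (zfin p')) (inr (zfin q')) ->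
      exists g, is_aut R g /\ g (inl (zfin p)) = inl (zfin p') /\ g (inr (zfin q)) = inr (zfin q')).
    { intros p q p' q' H H'. apply adj_xy in H, H'.
      destruct H as [[t Ht]|[t Ht]], H' as [[t' Ht']|[t' Ht']].
      - destruct (cycle_affine_aut 1 (p' - p) (p' - p)) as [g [Hg [G1 G2]]]; [lia|].
        exists g. rewrite G1, G2. split; auto. split; f_equal; apply zfin_eq;
          [exists 0%Z|exists (t' - t)%Z]; lia.
      - destruct (cycle_affine_aut (-1) (p' + p) (p' + p + 1)) as [g [Hg [G1 G2]]]; [lia|].
        exists g. rewrite G1, G2. split; auto. split; f_equal; apply zfin_eq;
          [exists 0%Z|exists (t' + t)%Z]; lia.
      - destruct (cycle_affine_aut (-1) (p' + p) (p' + p + 1)) as [g [Hg [G1 G2]]]; [lia|].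
        exists g. rewrite G1, G2. split; auto. split; f_equal; apply zfin_eq;
          [exists 0%Z|exists (t' + t)%Z]; lia.
      - destruct (cycle_affine_aut 1 (p' - p) (p' - p)) as [g [Hg [G1 G2]]]; [lia|].
        exists g. rewrite G1, G2. split; auto. split; f_equal; apply zfin_eq;
          [exists 0%Z|exists (t' - t)%Z]; lia. }
    intros [u|u] [n|n] [u'|u'] [n'|n'] H H' Hs; try discriminate;
      try (match goal with
           | H : adjU R (inl ?i) (inl ?j) |- _ => destruct (Nxx i j H)
           | H : adjU R (inr ?i) (inr ?j) |- _ => destruct (Nyy i j H) end);
      destruct (zfin_surj u) as [p <-], (zfin_surj n) as [q <-], (zfin_surj u') as [p' <-], (zfin_surj n') as [q' <-].
    + apply Key; auto.
    + destruct (Key q p q' p') as [g [Hg [G1 G2]]]; [apply adjU_sym; auto|apply adjU_sym; auto|].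
      exists g. auto.
Qed.

End CycleBlock.

Theorem listed_building_block B : listed B -> building_block (bor B).
Proof.
  intros [[k [Hk Hiso]]|[[m [n [Hm [Hn Hiso]]]]|[[n [Hn Hiso]]|[a [b [Ha [Hb HT]]]]]]].
  - apply building_block_iso with (1 := Hiso). apply cycle_bg_block; auto.
  - apply building_block_iso with (1 := Hiso). apply complete_bg_block; auto.
  - apply building_block_iso with (1 := Hiso). apply CP_bg_block; auto.
  - apply (Tab_block B a b); auto.
Qed.

(** * The digraphs DL(B) *)

Section DL.
Context (B : bigraph) {VT : Type} (ET : VT -> VT -> Prop).
Variables (phi : VT -> VT -> BX B) (psi : VT -> VT -> BY B).
Hypothesis Hdata : DL_data B ET phi psi.
Hypothesis Hblock : building_block (bor B).

Let D := DL_arc B ET phi psi.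
Implicit Types (t : VT).

Definition src (p : DLV ET) : VT := fst (proj1_sig p).
Definition tgt (p : DLV ET) : VT := snd (proj1_sig p).
(** The vertices incident with [t] form a copy of B, with [lab t] as isomorphism; every vertex lies
    in the two copies at its ends. *)
Definition inc (t : VT) (p : DLV ET) : Prop := src p = t \/ tgt p = t.

Definition lab (t : VT) (p : DLV ET) : BX B + BY B :=
  if excluded_middle_informative (tgt p = t) then inl (phi t (src p)) else inr (psi t (tgt p)).

Lemma node_arc p : ET (src p) (tgt p).
Proof. apply (proj2_sig p). Qed.

Lemma node_eq p q : src p = src q -> tgt p = tgt q -> p = q.
Proof.
  intros H1 H2. apply sig_eq. unfold src, tgt in *.
  destruct (proj1_sig p), (proj1_sig q). simpl in *. congruence.
Qed.

Lemma ET_irr t : ~ ET t t.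
Proof. exact (proj1 (proj1 Hdata) t). Qed.

Lemma ET_anti t t' : ET t t' -> ~ ET t' t.
Proof. exact (proj2 (proj1 Hdata) t t'). Qed.

Lemma src_neq_tgt p : src p <> tgt p.
Proof. intros H. pose proof (node_arc p) as A. rewrite H in A. apply (ET_irr _ A). Qed.

Lemma lab_tgt p : lab (tgt p) p = inl (phi (tgt p) (src p)).
Proof. unfold lab. destruct (excluded_middle_informative _); tauto. Qed.

Lemma lab_src p : lab (src p) p = inr (psi (src p) (tgt p)).
Proof.
  unfold lab. destruct (excluded_middle_informative _) as [H|H]; auto.
  exfalso. apply (src_neq_tgt p); auto.
Qed.

Lemma side_lab t p : side (lab t p) = true <-> tgt p = t.
Proof. unfold lab. destruct (excluded_middle_informative _); simpl; intuition congruence. Qed.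

Lemma lab_inj t p q : inc t p -> inc t q -> lab t p = lab t q -> p = q.
Proof.
  intros Hp Hq He.
  assert (Hs : tgt p = t <-> tgt q = t) by (rewrite <- !side_lab, He; tauto).
  destruct (classic (tgt p = t)) as [Tp|Tp].
  - assert (Tq : tgt q = t) by tauto. subst t.
    rewrite lab_tgt in He. rewrite <- Tq, lab_tgt in He. injection He as He. rewrite Tq in He.
    apply node_eq; auto. destruct Hdata as [_ [_ [_ [Hphi _]]]].
    apply (proj1 (Hphi (tgt p))); auto; [apply node_arc|]. rewrite <- Tq. apply node_arc.
  - destruct Hp as [Sp|Tp']; [|tauto]. destruct Hq as [Sq|Tq']; [|tauto]. subst t.
    rewrite lab_src in He. rewrite <- Sq, lab_src in He. injection He as He. rewrite Sq in He.
    apply node_eq; auto. destruct Hdata as [_ [_ [_ [_ Hpsi]]]].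
    apply (proj1 (Hpsi (src p))); auto; [apply node_arc|]. rewrite <- Sq. apply node_arc.
Qed.

Lemma lab_surj t b : exists p, inc t p /\ lab t p = b.
Proof.
  destruct Hdata as [_ [_ [_ [Hphi Hpsi]]]]. destruct b as [x|y].
  - destruct (proj2 (Hphi t) x) as [s [Hs <-]].
    exists (exist (fun e => ET (fst e) (snd e)) (s, t) Hs). split; [right; auto|].
    apply (lab_tgt (exist (fun e => ET (fst e) (snd e)) (s, t) Hs)).
  - destruct (proj2 (Hpsi t) y) as [s [Hs <-]].
    exists (exist (fun e => ET (fst e) (snd e)) (t, s) Hs). split; [left; auto|].
    apply (lab_src (exist (fun e => ET (fst e) (snd e)) (t, s) Hs)).
Qed.

Lemma D_shared p q : D p q -> tgt p = src q.
Proof. intros [H _]. auto. Qed.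

Lemma D_lab t p q : inc t p -> inc t q -> (D p q <-> bor B (lab t p) (lab t q)).
Proof.
  intros Hp Hq. split.
  - intros [H1 H2]. fold (tgt p) (src q) in H1.
    destruct (classic (tgt p = t)) as [Tp|Tp].
    + subst t. rewrite lab_tgt. rewrite H1 at 2. rewrite lab_src. simpl. rewrite <- H1. auto.
    + exfalso. destruct Hp as [Sp|]; [|tauto]. destruct Hq as [Sq|Tq]; [congruence|].
      apply (ET_anti (src p) (tgt p)); [apply node_arc|].
      rewrite H1, Sp, <- Tq. apply node_arc.
  - intros H. destruct (bor_side B _ _ H) as [H1 H2]. apply side_lab in H1.
    assert (Tq : tgt q <> t) by (rewrite <- side_lab; congruence).
    destruct Hq as [Sq|]; [|tauto]. rewrite <- H1 in Sq, H. rewrite lab_tgt in H.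
    rewrite <- Sq, lab_src in H. simpl in H. split; [auto|]. rewrite Sq in H. auto.
Qed.

Lemma adj_lab t p q : inc t p -> inc t q -> (adjU D p q <-> adjU (bor B) (lab t p) (lab t q)).
Proof. intros Hp Hq. unfold adjU. rewrite (D_lab t p q), (D_lab t q p); auto. tauto. Qed.

Lemma adj_inc p q : adjU D p q -> exists t, inc t p /\ inc t q.
Proof.
  intros [H|H]; apply D_shared in H.
  - exists (tgt p). split; [right|left]; auto.
  - exists (tgt q). split; [left|right]; auto.
Qed.

Lemma inc_two t t' p : inc t p -> inc t' p -> t <> t' ->
  (src p = t /\ tgt p = t') \/ (src p = t' /\ tgt p = t).
Proof. intros [H|H] [H'|H'] N; subst; tauto. Qed.

(** A walk in DL(B) that avoids the vertex [p] induces a walk in the tree that avoids the edge [p].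
    Joining the ends of that edge, it would close a cycle; so [p] separates its two copies of B. *)
Lemma no_bypass p (S : DLV ET -> Prop) s w :
  (forall u, S u -> u <> p) -> S s -> inc (src p) s -> inc (tgt p) w -> conn D S s w -> False.
Proof.
  intros HS Ss Is Iw Hc.
  assert (Sw : S w) by (apply (conn_mem D S s); auto).
  set (E' := fun a b => ET a b /\ ~ (a = src p /\ b = tgt p)).
  assert (Hedge : forall u, S u -> conn E' (fun _ => True) (src u) (tgt u)).
  { intros u Su. apply conn_step; auto. left. split; [apply node_arc|].
    intros [H1 H2]. apply (HS u Su). apply node_eq; auto. }
  assert (Hin : forall u t t', S u -> inc t u -> inc t' u -> conn E' (fun _ => True) t t').
  { intros u t t' Su [<-|<-] [<-|<-]; try apply conn_refl; auto. apply conn_sym; auto. }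
  assert (Hall : forall t, inc t w -> conn E' (fun _ => True) (src p) t).
  { apply (conn_invariant D S (fun w => forall t, inc t w -> conn E' (fun _ => True) (src p) t) s w Hc).
    - intros t Ht. apply (Hin s); auto.
    - intros a b Sa Sb Hab IH t Ht. destruct (adj_inc a b Hab) as [t' [Ha Hb]].
      apply conn_trans with t'; auto. apply (Hin b); auto. }
  destruct (conn_simple_path E' (fun _ => True) (src p) (tgt p) I (Hall _ Iw)) as [l [Nd [Ch [La _]]]].
  destruct Hdata as [_ [[_ Hac] _]].
  assert (Ch' : adj_chain ET (src p) l).
  { clear - Ch. revert Ch. generalize (src p) as a. induction l as [|b l IH]; intros a Ch; simpl in *; auto.
    split; [|apply IH; tauto]. destruct Ch as [[[H _]|[H _]] _]; [left|right]; auto. }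
  apply (Hac (src p) l); auto.
  - destruct l as [|a [|b l]]; simpl in *; try lia.
    + exfalso. apply (src_neq_tgt p); auto.
    + exfalso. subst a. destruct Ch as [[[_ H]|[H _]] _]; [tauto|].
      apply (ET_anti _ _ H). apply node_arc.
  - rewrite La. right. apply node_arc.
Qed.

Lemma no_bypass' t t' p (S : DLV ET -> Prop) s w :
  inc t p -> inc t' p -> t <> t' ->
  (forall u, S u -> u <> p) -> S s -> inc t s -> inc t' w -> conn D S s w -> False.
Proof.
  intros Hp Hp' N HS Ss Is Iw Hc.
  destruct (inc_two t t' p Hp Hp' N) as [[<- <-]|[<- <-]].
  - apply (no_bypass p S s w); auto.
  - apply (no_bypass p S w s); auto; [apply (conn_mem D S s); auto|apply conn_sym; auto].
Qed.

(** A simple path that left the copy at [t] would do so through a vertex it cannot revisit, and by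
    [no_bypass'] there is no other way back. *)
Lemma piece_connected (L : list (DLV ET)) t s w :
  induced_connected D (fun v => In v L) -> In s L -> In w L -> inc t s -> inc t w ->
  conn D (fun v => In v L /\ inc t v) s w.
Proof.
  intros Hic Hs Hw Is Iw.
  destruct (conn_simple_path D _ s w Hs (Hic s w Hs Hw)) as [l [Nd [Ch [La Hin]]]].
  rewrite <- La in Iw |- *. clear La Hw w Hs.
  revert s Is Nd Ch Hin Iw. induction l as [|v l IH]; intros s Is Nd Ch Hin Iw; [apply conn_refl|].
  destruct Ch as [Hsv Ch]. rewrite last_cons in *.
  assert (Iv : inc t v).
  { apply NNPP. intros Nv. destruct (adj_inc s v Hsv) as [t' [Is' Iv']].
    assert (N : t <> t') by (intros <-; auto).
    apply NoDup_cons_iff in Nd.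
    apply (no_bypass' t' t s (fun u => In u (v :: l)) v (last l v)); auto.
    - intros u Hu ->. apply (proj1 Nd); auto.
    - left; auto.
    - apply conn_chain; auto. }
  apply conn_trans with v.
  - apply conn_step; auto; split; auto; apply Hin; simpl; auto.
  - apply IH; auto.
    + apply NoDup_cons_iff in Nd. tauto.
    + intros u Hu. apply Hin. right; auto.
Qed.

(** Adjacent vertices of the copy meet in [t], one as target and one as source; their images meet in
    one tree vertex in the same manner. This passes [t'] along the part of the domain inside the
    copy, which is connected. *)
Lemma piece_image M s s' t t' : piso D M -> induced_connected D (fun v => In v (map fst M)) ->
  In (s, s') M -> inc t s -> inc t' s' -> (tgt s = t <-> tgt s' = t') ->
  forall p, In p M -> inc t (fst p) -> inc t' (snd p) /\ (tgt (fst p) = t <-> tgt (snd p) = t').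
Proof.
  intros HM Hic Hs Is Is' Hss p Hp Ip.
  pose proof (piece_connected (map fst M) t s (fst p) Hic (in_map fst _ _ Hs) (in_map fst _ _ Hp) Is Ip) as Hc.
  apply (conn_invariant D _ (fun w => inc t w -> forall p, In p M -> fst p = w ->
     inc t' (snd p) /\ (tgt (fst p) = t <-> tgt (snd p) = t')) s (fst p) Hc); auto.
  - intros _ q Hq He. apply (HM q (s, s') Hq Hs) in He as He'. simpl in He, He'. rewrite He, He'. auto.
  - intros a b [Ha Ia] [Hb Ib] Hab IH _ q Hq He. apply in_map_iff in Ha. destruct Ha as [r [Er Hr]].
    destruct (IH Ia r Hr Er) as [I1 I2]. subst a b.
    destruct Hab as [Hab|Hab].
    + assert (T1 : tgt (fst r) = t).
      { apply (D_lab t) in Hab; auto. apply bor_side in Hab. apply side_lab. tauto. }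
      assert (T2 : tgt (fst q) <> t).
      { apply (D_lab t) in Hab; auto. apply bor_side in Hab. rewrite <- side_lab. intuition congruence. }
      apply (HM r q Hr Hq) in Hab. apply D_shared in Hab.
      assert (T3 : tgt (snd r) = t') by tauto.
      assert (T4 : src (snd q) = t') by congruence.
      split; [left; auto|]. split; [tauto|]. intros T5. exfalso.
      apply (src_neq_tgt (snd q)). congruence.
    + assert (T1 : tgt (fst q) = t).
      { apply (D_lab t) in Hab; auto. apply bor_side in Hab. apply side_lab. tauto. }
      assert (T2 : tgt (fst r) <> t).
      { apply (D_lab t) in Hab; auto. apply bor_side in Hab. rewrite <- side_lab. intuition congruence. }
      apply (HM q r Hq Hr) in Hab. apply D_shared in Hab.
      assert (T3 : src (snd r) = t') by (destruct I1; tauto).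
      assert (T4 : tgt (snd q) = t') by congruence.
      split; [right; auto|tauto].
Qed.

Lemma bor_tail_iff_side b : (exists b', bor B b b') <-> side b = true.
Proof.
  split.
  - intros [b' H]. apply (bor_side B _ _ H).
  - intros Hb. destruct Hblock as [_ [_ [Hn _]]]. destruct (Hn b) as [b' [H|H]]; [eauto|].
    apply bor_side in H. destruct H; congruence.
Qed.

Lemma same_side_bor b b' : same_side (bor B) b b' <-> side b = side b'.
Proof.
  unfold same_side. rewrite !bor_tail_iff_side. destruct (side b), (side b'); intuition congruence.
Qed.

(** The new vertex [v] is adjacent to the domain only within the copy at [t]; a neighbour elsewhere
    would let the connected domain bypass [v]. So the part of [M] in that copy is transported to B
    by labels, extended there, and the answer is pulled back to the copy at [t']. *)
Lemma DL_one_step : one_step_extendable D (fun _ _ => True).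
Proof.
  intros M v HM _ Hic [[s s'] [Hs Hvs]] Nv. simpl in Hvs.
  destruct (adj_inc v s Hvs) as [t [Iv Is]].
  (* [t'] is the end of [s'] that corresponds to [t]: target for target, source for source. *)
  assert (Ht' : exists t', inc t' s' /\ (tgt s = t <-> tgt s' = t')).
  { destruct (classic (tgt s = t)) as [T|T].
    - exists (tgt s'). split; [right; auto|tauto].
    - exists (src s'). split; [left; auto|]. split; [tauto|]. intros H. exfalso.
      apply (src_neq_tgt s'); auto. }
  destruct Ht' as [t' [Is' Hss]].
  pose proof (piece_image M s s' t t' HM Hic Hs Is Is' Hss) as Fwd.
  pose proof (piece_image (swap_pairs M) s' s t' t (piso_swap D M HM)) as Bwd0.
  rewrite swap_pairs_fst in Bwd0.
  specialize (Bwd0 (piso_image_connected D M HM Hic) (proj2 (in_swap_pairs M s' s) Hs) Is' Is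
                (iff_sym Hss)).
  assert (Bwd : forall p, In p M -> inc t' (snd p) -> inc t (fst p)).
  { intros [a b] Hp Hi. apply (Bwd0 (b, a)); auto. apply in_swap_pairs; auto. }
  clear Bwd0.
  set (MF := filter (fun p => holds (inc t (fst p))) M).
  assert (HMF : forall p, In p MF <-> In p M /\ inc t (fst p)).
  { intros p. unfold MF. rewrite filter_In, holds_true. tauto. }
  set (F := fun p : DLV ET * DLV ET => (lab t (fst p), lab t' (snd p))).
  assert (Hpiso : piso (bor B) (map F MF)).
  { intros p q Hp Hq. apply in_map_iff in Hp, Hq. destruct Hp as [a [<- Ha]], Hq as [b [<- Hb]].
    apply HMF in Ha, Hb. destruct Ha as [Ha Ia], Hb as [Hb Ib].
    destruct (Fwd a Ha Ia) as [Ja _], (Fwd b Hb Ib) as [Jb _].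
    destruct (HM a b Ha Hb) as [E1 E2]. simpl. split.
    - split; intros He.
      + apply lab_inj in He; auto. apply E1 in He. rewrite He. auto.
      + apply lab_inj in He; auto. apply E1 in He. rewrite He. auto.
    - rewrite <- (D_lab t (fst a) (fst b)), <- (D_lab t' (snd a) (snd b)); auto. }
  destruct Hblock as [_ [_ [_ Hose]]].
  destruct (Hose (map F MF) (lab t v)) as [b' [Sb' Pb']].
  - exact Hpiso.
  - intros p Hp. apply in_map_iff in Hp. destruct Hp as [a [<- Ha]]. apply HMF in Ha.
    destruct Ha as [Ha Ia]. destruct (Fwd a Ha Ia) as [_ Hs']. apply same_side_bor. simpl.
    rewrite <- !side_lab in Hs'. destruct (side (lab t (fst a))), (side (lab t' (snd a))); intuition congruence.
  - assert (Hlift : forall a b, conn D (fun v => In v (map fst M) /\ inc t v) a b ->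
      conn (bor B) (fun u => In u (map fst (map F MF))) (lab t a) (lab t b)).
    { intros a b Hab. induction Hab as [x y [[H1 H2] [[H3 H4] H5]]| |x y z _ IH1 _ IH2].
      - assert (Hmem : forall z, In z (map fst M) -> inc t z -> In (lab t z) (map fst (map F MF))).
        { intros z Hz Iz. apply in_map_iff in Hz. destruct Hz as [p [<- Hp]].
          rewrite map_map. apply in_map_iff. exists p. split; auto. apply HMF. auto. }
        apply conn_step; auto. apply adj_lab; auto.
      - apply conn_refl.
      - eapply conn_trans; eauto. }
    intros a b Ha Hb. rewrite map_map in Ha, Hb. apply in_map_iff in Ha, Hb.
    destruct Ha as [p [<- Hp]], Hb as [q [<- Hq]]. apply HMF in Hp, Hq. simpl.
    apply Hlift. apply piece_connected; try tauto; apply in_map; tauto.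
  - exists (F (s, s')). split.
    + apply in_map, HMF. auto.
    + simpl. apply adj_lab; auto.
  - rewrite map_map. intros Hi. apply in_map_iff in Hi. destruct Hi as [p [He Hp]].
    apply HMF in Hp. simpl in He. apply lab_inj in He; try tauto.
    apply Nv. rewrite <- He. apply in_map; tauto.
  - destruct (lab_surj t' b') as [v' [Iv' <-]].
    exists v'. split; auto.
    assert (Pf : forall p, In p M -> inc t (fst p) ->
      (v' = snd p -> v = fst p) /\ (D v (fst p) <-> D v' (snd p)) /\ (D (fst p) v <-> D (snd p) v')).
    { intros p Hp Ip. destruct (Fwd p Hp Ip) as [Jp _].
      assert (Hin : In (F p) ((lab t v, lab t' v') :: map F MF)).
      { right. apply in_map, HMF. auto. }
      destruct (Pb' _ _ (or_introl eq_refl) Hin) as [E1 E2].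
      destruct (Pb' _ _ Hin (or_introl eq_refl)) as [_ E3]. simpl in E1, E2, E3.
      rewrite (D_lab t v (fst p) Iv Ip), (D_lab t' v' (snd p) Iv' Jp),
        (D_lab t (fst p) v Ip Iv), (D_lab t' (snd p) v' Jp Iv').
      split; [|split; auto]. intros He. apply (lab_inj t); auto. apply E1. rewrite He. auto. }
    assert (Nv' : ~ In v' (map snd M)).
    { intros Hi. apply in_map_iff in Hi. destruct Hi as [p [He Hp]].
      apply Nv. assert (Ip : inc t (fst p)) by (apply Bwd; auto; rewrite He; auto).
      rewrite (proj1 (Pf p Hp Ip)); auto. apply in_map; auto. }
    assert (Far : forall (L : list (DLV ET)) u r x w, induced_connected D (fun v => In v L) -> ~ In u L ->
      In x L -> inc r u -> inc r x -> In w L -> ~ inc r w -> ~ adjU D u w).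
    { intros L u r x w HL Nu Hx Iu Ix Hw Nw Huw.
      destruct (adj_inc u w Huw) as [r' [Iu' Iw]].
      assert (Nr : r <> r') by (intros <-; auto).
      apply (no_bypass' r r' u (fun v => In v L) x w); auto.
      - intros y Hy ->. auto.
      - apply HL; auto. }
    assert (Pn : forall p, In p M -> ~ inc t (fst p) -> ~ adjU D v (fst p) /\ ~ adjU D v' (snd p)).
    { intros p Hp Np. split.
      - apply (Far (map fst M) v t s (fst p)); auto; [apply (in_map fst _ _ Hs)|apply in_map; auto].
      - apply (Far (map snd M) v' t' s' (snd p)); auto.
        + apply piso_image_connected; auto.
        + apply (in_map snd _ _ Hs).
        + apply in_map; auto. }
    assert (Pall : forall p, In p M -> (D v (fst p) <-> D v' (snd p)) /\ (D (fst p) v <-> D (snd p) v')).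
    { intros p Hp. destruct (classic (inc t (fst p))) as [Ip|Np]; [apply (Pf p Hp Ip)|].
      destruct (Pn p Hp Np) as [N1 N2]. unfold adjU in N1, N2. tauto. }
    assert (Dirr : forall u, ~ D u u).
    { intros u Hu. apply D_shared in Hu. apply (src_neq_tgt u); auto. }
    intros p q [<-|Hp] [<-|Hq]; simpl.
    + pose proof (Dirr v). pose proof (Dirr v'). tauto.
    + split; [|apply Pall; auto]. split; intros He; exfalso.
      * apply Nv. rewrite He. apply in_map; auto.
      * apply Nv'. rewrite He. apply in_map; auto.
    + split; [|apply Pall; auto]. split; intros He; exfalso.
      * apply Nv. rewrite <- He. apply in_map; auto.
      * apply Nv'. rewrite <- He. apply in_map; auto.
    + apply HM; auto.
Qed.

Lemma DL_digraph : is_digraph D.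
Proof.
  split.
  - intros p H. apply D_shared in H. apply (src_neq_tgt p); auto.
  - intros p q H H'. apply D_shared in H, H'. apply (ET_anti (src p) (tgt p)); [apply node_arc|].
    rewrite H, <- H'. apply node_arc.
Qed.

Lemma piece_all_connected t p q : inc t p -> inc t q -> conn D (fun _ => True) p q.
Proof.
  intros Ip Iq. destruct Hblock as [Hc _].
  apply (conn_invariant (bor B) (fun _ => True)
    (fun b => forall q, inc t q -> lab t q = b -> conn D (fun _ => True) p q) (lab t p) (lab t q)); auto.
  - apply Hc; auto.
  - intros r Ir He. apply lab_inj in He; auto. subst. apply conn_refl.
  - intros a b _ _ Hab IH r Ir He. destruct (lab_surj t a) as [u [Iu Lu]].
    apply conn_trans with u; [apply IH; auto|]. apply conn_step; auto. apply (adj_lab t); auto.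
    rewrite Lu, He. auto.
Qed.

(** Copies at adjacent tree vertices share the vertex of DL(B) given by the tree edge between
    them. *)
Lemma DL_connected : connected D.
Proof.
  intros p q _ _.
  assert (H : forall r, inc (src q) r -> conn D (fun _ => True) p r).
  { destruct Hdata as [_ [[Hc _] _]].
    apply (conn_invariant ET (fun _ => True) (fun t => forall r, inc t r -> conn D (fun _ => True) p r)
      (src p) (src q)).
    - apply Hc; auto.
    - intros r Hr. apply (piece_all_connected (src p)); auto. left; auto.
    - intros a b _ _ Hab IH r Hr.
      assert (exists e, inc a e /\ inc b e) as [e [Ha Hb]].
      { destruct Hab as [Hab|Hab].
        - exists (exist (fun e => ET (fst e) (snd e)) (a, b) Hab). split; [left|right]; auto.
        - exists (exist (fun e => ET (fst e) (snd e)) (b, a) Hab). split; [right|left]; auto. }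
      apply conn_trans with e; auto. apply (piece_all_connected b); auto. }
  apply H. left; auto.
Qed.

(** A triangle inside one copy contradicts bipartiteness; in any other, [y] and [z] lie in different
    copies at [x], and their edge bypasses [x]. *)
Lemma DL_triangle_free : triangle_free D.
Proof.
  intros x y z Hxy Hyz Hxz. destruct (adj_inc x y Hxy) as [t [Ix Iy]].
  assert (Nyx : y <> x).
  { intros ->. destruct Hxy as [H|H]; apply (proj1 DL_digraph _ H). }
  assert (Nzx : z <> x).
  { intros ->. destruct Hxz as [H|H]; apply (proj1 DL_digraph _ H). }
  destruct (classic (inc t z)) as [Iz|Nz].
  - apply (adj_lab t) in Hxy, Hyz, Hxz; auto.
    pose proof (adj_col _ _ (bor_side B) _ _ Hxy). pose proof (adj_col _ _ (bor_side B) _ _ Hyz).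
    pose proof (adj_col _ _ (bor_side B) _ _ Hxz).
    destruct (side (lab t x)), (side (lab t y)), (side (lab t z)); congruence.
  - destruct (adj_inc x z Hxz) as [t' [Ix' Iz']].
    assert (N : t <> t') by (intros <-; auto).
    apply (no_bypass' t t' x (fun u => u = y \/ u = z) y z); auto.
    + intros u [->| ->]; auto.
    + apply conn_step; auto.
Qed.

Lemma DL_locally_finite : locally_finite D.
Proof.
  destruct Hblock as [_ [Hlf _]].
  assert (Hfin : forall t (P : DLV ET -> Prop) (Q : BX B + BY B -> Prop), finite_set Q ->
    (forall q, P q -> inc t q /\ Q (lab t q)) -> finite_set P).
  { intros t P Q [l Hl] HPQ.
    apply finite_sub with (fun q => exists b, In b l /\ (inc t q /\ lab t q = b)).
    - intros q Hq. destruct (HPQ q Hq) as [H1 H2]. exists (lab t q). auto.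
    - apply finite_bigor. intros b _. destruct (lab_surj t b) as [q [Iq Lq]].
      exists [q]. intros r [Ir Lr]. left. apply (lab_inj t); auto. congruence. }
  intros p. split.
  - apply (Hfin (tgt p) _ (bor B (lab (tgt p) p))); [apply Hlf|].
    intros q Hq. pose proof (D_shared _ _ Hq) as Hs.
    assert (Iq : inc (tgt p) q) by (left; auto). split; auto. apply (D_lab (tgt p)); auto. right; auto.
  - apply (Hfin (src p) _ (fun b => bor B b (lab (src p) p))); [apply Hlf|].
    intros q Hq. pose proof (D_shared _ _ Hq) as Hs.
    assert (Iq : inc (src p) q) by (right; auto). split; auto. apply (D_lab (src p)); auto. left; auto.
Qed.

Lemma DL_conn_hom : conn_hom D.
Proof. apply one_step_conn_hom; [apply DL_connected|apply DL_locally_finite|apply DL_one_step]. Qed.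

(** Arcs with a common tail or head pass through the same tree vertex, so a class stays inside one
    copy; connectedness of B spreads it over the copy. *)
Lemma DL_class p0 q0 a b : D p0 q0 -> (Arel D (p0, q0) (a, b) <-> D a b /\ tgt a = tgt p0).
Proof.
  intros H0. set (t := tgt p0).
  assert (It : forall a b, D a b -> tgt a = t -> inc t a /\ inc t b).
  { intros x y Hxy Tx. apply D_shared in Hxy. split; [right|left]; congruence. }
  split.
  - intros HA. apply (Arel_closure D (fun a b => D a b /\ tgt a = t) p0 q0 a b HA); auto.
    + intros x y y' _ Hy' [_ Tx]. auto.
    + intros x y x' Hx Hx' [_ Tx]. split; auto. apply D_shared in Hx, Hx'. congruence.
  - intros [Hab Ta].
    (* The side of [c] tells whether the arcs of the copy leave or enter it; all of them are to lie
       in the class. *)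
    set (ok := fun c => (side (lab t c) = true -> forall d, D c d -> Arel D (p0, q0) (c, d)) /\
                        (side (lab t c) = false -> forall d, D d c -> Arel D (p0, q0) (d, c))).
    assert (Hok : forall c, inc t c -> ok c).
    { intros c Ic. destruct Hblock as [Hc _].
      apply (conn_invariant (bor B) (fun _ => True) (fun l => forall c, inc t c -> lab t c = l -> ok c)
        (lab t p0) (lab t c)); auto.
      - apply Hc; auto.
      - intros c' Ic' Lc. apply lab_inj in Lc; [|auto|right; auto]. subst c'. split.
        + intros _ d Hd. apply Arel_tail with q0; auto. apply Arel_refl; auto.
        + intros Hs. exfalso. assert (K : side (lab t p0) = true) by (apply side_lab; auto). congruence.
      - intros l l' _ _ Hll IH c' Ic' Lc'. destruct (lab_surj t l) as [u [Iu Lu]].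
        specialize (IH u Iu Lu). assert (Huc : adjU D u c') by (apply (adj_lab t); auto; congruence).
        assert (Hs := adj_col _ _ (bor_side B) _ _ Hll). rewrite <- Lu, <- Lc' in Hs.
        destruct IH as [I1 I2]. split; intros Sc d Hd.
        + assert (Su : side (lab t u) = false) by (destruct (side (lab t u)); congruence).
          assert (Hcu : D c' u).
          { destruct Huc as [Huc|Huc]; auto. apply (D_lab t) in Huc; auto. apply bor_side in Huc.
            destruct Huc; congruence. }
          apply Arel_tail with u; auto.
        + assert (Su : side (lab t u) = true) by (destruct (side (lab t u)); congruence).
          assert (Hcu : D u c').
          { destruct Huc as [Huc|Huc]; auto. apply (D_lab t) in Huc; auto. apply bor_side in Huc.
            destruct Huc; congruence. }
          apply Arel_head with u; auto. }
    apply (Hok a); auto; [right; auto|]. apply side_lab; auto.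
Qed.

Lemma DL_reachability e0 : is_arc D e0 -> rel_iso (Delta_arc D e0) (bor B).
Proof.
  destruct e0 as [p0 q0]. intros H0. unfold is_arc in H0. simpl in H0. set (t := tgt p0).
  assert (Hinc : forall v, Delta_vertex D (p0, q0) v -> inc t v).
  { intros v [w [Hw|Hw]]; apply (DL_class p0 q0) in Hw; auto; destruct Hw as [Hw Tw].
    - right; auto.
    - apply D_shared in Hw. left. unfold t. congruence. }
  assert (Hiso : rel_iso (bor B) (Delta_arc D (p0, q0))).
  { apply rel_iso_bijection with (fun v : DeltaV D (p0, q0) => lab t (proj1_sig v)).
    - intros v w He. apply sig_eq. apply (lab_inj t); auto; apply Hinc; apply proj2_sig.
    - intros b. destruct (lab_surj t b) as [p [Ip Lp]].
      (* B has no isolated vertices, so every vertex of the copy is on an arc and hence in the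
         class. *)
      assert (Hv : Delta_vertex D (p0, q0) p).
      { destruct Hblock as [_ [_ [Hn _]]]. destruct (Hn b) as [b' Hb'].
        destruct (lab_surj t b') as [q [Iq Lq]]. rewrite <- Lp, <- Lq in Hb'. exists q.
        destruct Hb' as [Hb'|Hb']; [left|right]; apply DL_class; auto;
          pose proof (proj1 (bor_side B _ _ Hb')) as K; apply side_lab in K;
          (split; [apply (D_lab t); auto|auto]). }
      exists (exist _ p Hv). auto.
    - intros v w. unfold Delta_arc. rewrite DL_class by auto.
      rewrite <- (D_lab t) by (apply Hinc; apply proj2_sig).
      split; [tauto|]. intros Hvw. split; auto.
      apply (D_lab t) in Hvw; try (apply Hinc; apply proj2_sig). apply bor_side in Hvw.
      apply side_lab. tauto. }
  destruct Hiso as [f [g [gf [fg Hfg]]]]. exists g, f. split; auto. split; auto.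
  intros a a'. rewrite Hfg, !fg. tauto.
Qed.

End DL.

Theorem theorem4p1 (V : Type) (E : V -> V -> Prop)
  (HD : is_digraph E) (Hconn : connected E) (Hlf : locally_finite E)
  (Htf : triangle_free E) (Hends : more_than_one_end E)
  (Hch : conn_hom E) :
  (* (i) *)
  highly_arc_transitive E /\
  (* (ii) *)
  (~ A_universal E /\ forall e0, is_arc E e0 -> Delta_bipartite E e0) /\
  (* (iii) *)
  (forall e0, is_arc E e0 ->
     exists B : bigraph, listed B /\ rel_iso (Delta_und E e0) (bund B)) /\
  (* (iv) *)
  (forall B : bigraph, listed B ->
     forall (VT : Type) (ET : VT -> VT -> Prop)
            (phi : VT -> VT -> BX B) (psi : VT -> VT -> BY B),
       DL_data B ET phi psi ->
       is_digraph (DL_arc B ET phi psi) /\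
       connected (DL_arc B ET phi psi) /\
       triangle_free (DL_arc B ET phi psi) /\
       locally_finite (DL_arc B ET phi psi) /\
       conn_hom (DL_arc B ET phi psi) /\
       (forall e0, is_arc (DL_arc B ET phi psi) e0 ->
          rel_iso (Delta_arc (DL_arc B ET phi psi) e0) (bor B))) /\
  (* (v) *)
  (more_than_two_ends E ->
     forall u : V, induced_tree E (desc E u) /\ induced_tree E (anc E u)).
Proof.
  split; [apply highly_arc_transitive_of_homogeneous; auto|].
  split.
  { split; [apply reachability_not_universal; auto|].
    intros [x y] He. exists (fun v => exists w, Arel E (x, y) (v, w)).
    intros v w Hvw. split; [eauto|]. intros [u Hu].
    apply (class_bipartite E HD Hconn Hlf Htf Hch Hends x y v w u Hvw Hu). }
  split; [intros [x y] He; apply Delta_listed; auto|].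
  split; [|apply descendants_and_ancestors_trees; auto].
  intros B HB VT ET phi psi Hdata. pose proof (listed_building_block B HB) as Hblock.
  split; [apply DL_digraph; auto|].
  split; [apply DL_connected; auto|].
  split; [apply DL_triangle_free; auto|].
  split; [apply DL_locally_finite; auto|].
  split; [apply DL_conn_hom; auto|].
  intros e0 He0. apply DL_reachability; auto.
Qed.
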